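(* Let $S=\{z\in\mathbb{C}:|z|=1\}$, $B=(S\times\{1\})\cup(\{1\}\times S)$, and let $f:B\to B$ be the continuous map given by $$f(z,1)=\begin{cases}(z^4,1),&0\le\arg z\le\frac{\pi}{2}\\(1,z^4),&\frac{\pi}{2}\le\arg z\le\pi\\(z^{-4},1),&\pi\le\arg z\le\frac{3\pi}{2}\\(1,z^{-4}),&\frac{3\pi}{2}\le\arg z\le2\pi\end{cases}\qquad f(1,t)=\begin{cases}(t^{-4},1),&0\le\arg t\le\frac{\pi}{2}\\(1,t^{-4}),&\frac{\pi}{2}\le\arg t\le\pi\\(t^{4},1),&\pi\le\arg t\le\frac{3\pi}{2}\\(1,t^{4}),&\frac{3\pi}{2}\le\arg t\le2\pi\end{cases}$$ for $z,t\in S$. Let $P=\varprojlim\{B,f\}$ be the limit of the inverse sequence $B\xleftarrow{f}B\xleftarrow{f}B\xleftarrow{f}\cdots$, and let $\Sigma P=\varprojlim\{\Sigma B,\Sigma f\}$ be its suspension, with the action of $Z_2=\{e,g\}$ induced by the action $g[x,t]=[x,-t]$ on $\Sigma B$. Then the space $\Sigma P$ has trivial shape (the shape of a one-point space), but it is not $Z_2$-movable.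
   Context: $\Sigma$ denotes suspension: $\Sigma B$ is the quotient of $B\times[-1,1]$ collapsing $B\times\{1\}$ to a point and $B\times\{-1\}$ to a point, with points $[x,t]$, $x\in B$, $-1\le t\le1$, and $\Sigma f[x,t]=[f(x),t]$. The suspension of $P$ is identified with $\varprojlim\{\Sigma B,\Sigma f\}$, and $Z_2$ acts on it coordinatewise. Conventions (used with $G=Z_2$): all topological groups $G$ are compact (Hausdorff) and all topological spaces are $p$-paracompact, i.e. paracompact $p$-spaces in the sense of Arhangel'skii (equivalently, Hausdorff spaces admitting a perfect map onto a metrizable space). A $G$-space is a space with a continuous action $G\times X\to X$; a $G$-map is a continuous equivariant map; a $G$-homotopy is an equivariant homotopy $X\times I\to Y$ ($G$ acting trivially on $I=[0,1]$), and $G$-homotopy classes of $G$-maps are composed via representatives. $P_G$ is the class of $p$-paracompact $G$-spaces. A $G$-space $Y$ is a $G$-$ANR(P_G)$ if $Y\in P_G$ and whenever $Y$ is a closed invariant subset of a $G$-space $Z\in P_G$, there exist an invariant neighborhood $U$ of $Y$ in $Z$ and a $G$-map $r:U\to Y$ with $r|_Y=1_Y$. Below, ''$G$-$ANR$'' means $G$-$ANR(P_G)$. An inverse $G$-system $\underline{X}=\{X_\alpha,p_{\alpha\alpha'},A\}$ consists of $G$-spaces $X_\alpha$ indexed by a directed set $A$ and $G$-homotopy classes $p_{\alpha\alpha'}:X_{\alpha'}\to X_\alpha$ for $\alpha\le\alpha'$, with $p_{\alpha\alpha}=\mathrm{id}$ and $p_{\alpha\alpha'}p_{\alpha'\alpha''}=p_{\alpha\alpha''}$.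 It is $G$-movable (equivariantly movable) if for every $\alpha\in A$ there is $\alpha'\ge\alpha$ such that for all $\alpha''\ge\alpha$ there is a $G$-homotopy class $r^{\alpha'\alpha''}:X_{\alpha'}\to X_{\alpha''}$ with $p_{\alpha\alpha''}\circ r^{\alpha'\alpha''}=p_{\alpha\alpha'}$. An inverse $G$-$ANR$-system (one whose terms are $G$-$ANR$'s) is associated with $X$ (in the sense of Morita; equivalently, it is a $G$-$ANR$-expansion of $X$) if there are $G$-homotopy classes $p_\alpha:X\to X_\alpha$ with $p_\alpha=p_{\alpha\alpha'}p_{\alpha'}$ for $\alpha\le\alpha'$ such that for every $G$-$ANR$ $K$: (i) each $G$-homotopy class $h:X\to K$ has the form $h=f p_\alpha$ for some $\alpha$ and some $G$-homotopy class $f:X_\alpha\to K$; (ii) if $f,f':X_\alpha\to K$ are $G$-homotopy classes with $fp_\alpha=f'p_\alpha$, then $fp_{\alpha\alpha'}=f'p_{\alpha\alpha'}$ for some $\alpha'\ge\alpha$. A $G$-space $X$ is $G$-movable (equivariantly movable) if there is a $G$-movable inverse $G$-$ANR$-system associated with $X$. *)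

(* Defs.v *)
From HB Require Import structures.
From mathcomp Require Import all_boot all_order all_algebra all_fingroup.
From mathcomp Require Import generic_quotient.
From mathcomp Require Import all_classical all_reals all_analysis.
From mathcomp Require Import complex.

Set Implicit Arguments.
Unset Strict Implicit.
Unset Printing Implicit Defensive.

Import Order.TTheory GRing.Theory Num.Theory.
Import numFieldNormedType.Exports.

Local Open Scope classical_set_scope.
Local Open Scope quotient_scope.
Local Open Scope ring_scope.

(* A finite group is given its discrete topology, so that it is a compact     *)
(* Hausdorff topological group; the trivial group gives ordinary topology.    *)
Record gspace (G : finGroupType) := GSpace {
  gcarrier :> topologicalType;
  gact : G -> gcarrier -> gcarrier;
  gact1 : forall x, gact 1%g x = x;
  gactM : forall g h x, gact (g * h)%g x = gact g (gact h x);
  gact_continuous :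
    continuous (fun p : discrete_topology G * gcarrier => gact p.1 p.2)
}.

Lemma discrete_act_continuous (G : finGroupType) (X : topologicalType)
    (act : G -> X -> X) :
  (forall g, continuous (act g)) ->
  continuous (fun p : discrete_topology G * X => act p.1 p.2).
Proof.
move=> cact [g x] U /= nU.
exists ([set g], act g @^-1` U) => /=.
  by split; [exact: (@discrete_set1 (discrete_topology G))|exact: cact].
by move=> [h y] /= [-> Uy].
Qed.

Lemma gact_continuous1 (G : finGroupType) (X : gspace G) (g : G) :
  continuous (@gact G X g).
Proof.
move=> x; apply: (@continuous_comp _ (discrete_topology G * X)%type _
  (fun y => (g, y)) (fun p => gact p.1 p.2)); last exact: gact_continuous.
by apply: (@cvg_pair _ _ _ (nbhs x) (nbhs (g : discrete_topology G)) (nbhs x));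
  [exact: cvg_cst|exact: cvg_id].
Qed.

Definition trivial_gspace (G : finGroupType) (X : topologicalType) : gspace G :=
  @GSpace G X (fun _ => id) (fun _ => erefl) (fun _ _ _ => erefl)
    (@discrete_act_continuous G X (fun _ => id) (fun _ x => cvg_id)).

Record gmap (G : finGroupType) (X Y : gspace G) := GMap {
  gmap_fun :> X -> Y;
  gmap_continuous : continuous gmap_fun;
  gmap_equivariant : forall g x, gmap_fun (gact g x) = gact g (gmap_fun x)
}.

Definition gmap_id (G : finGroupType) (X : gspace G) : gmap X X :=
  @GMap G X X id (fun x => cvg_id) (fun _ _ => erefl).

Lemma gmap_comp_continuous (G : finGroupType) (X Y Z : gspace G)
  (f : gmap Y Z) (h : gmap X Y) : continuous (f \o h).
Proof.
move=> x; apply: continuous_comp; first exact: gmap_continuous.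
exact: gmap_continuous.
Qed.

Lemma gmap_comp_equivariant (G : finGroupType) (X Y Z : gspace G)
  (f : gmap Y Z) (h : gmap X Y) g x : (f \o h) (gact g x) = gact g ((f \o h) x).
Proof. by rewrite /= !gmap_equivariant. Qed.

Definition gmap_comp (G : finGroupType) (X Y Z : gspace G)
    (f : gmap Y Z) (h : gmap X Y) : gmap X Z :=
  GMap (@gmap_comp_continuous G X Y Z f h) (@gmap_comp_equivariant G X Y Z f h).

Notation "f \og h" := (gmap_comp f h) (at level 50, format "f  \og  h").


Definition cinterval (R : realType) (a b : R) : topologicalType :=
  set_type [set` `[a, b]].

Section Shape.
Context (R : realType) (G : finGroupType).

Definition ghomotopic (X Y : gspace G) (f h : gmap X Y) : Prop :=
  exists H : (X * cinterval (0 : R) 1)%type -> Y,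
    [/\ continuous H,
        forall g x t, H (gact g x, t) = gact g (H (x, t)),
        forall x t, \val t = 0 -> H (x, t) = f x
      & forall x t, \val t = 1 -> H (x, t) = h x].

Definition perfect_map (X M : topologicalType) (q : X -> M) : Prop :=
  [/\ continuous q, set_surj setT setT q,
      forall A, closed A -> closed (q @` A)
    & forall y, compact (q @^-1` [set y])].

Definition p_paracompact (X : topologicalType) : Prop :=
  hausdorff_space X /\
  exists (M : metricType R) (q : X -> M), perfect_map q.

(* A closed invariant subset of Z, with the induced topology and action, is   *)
(* the same thing as the image of such an embedding.                          *)
Definition closed_gembedding (Y Z : gspace G) (i : gmap Y Z) : Prop :=
  injective i /\ forall A : set Y, closed A -> closed (i @` A).

Definition is_GANR (Y : gspace G) : Prop :=
  p_paracompact Y /\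
  forall (Z : gspace G) (i : gmap Y Z),
    p_paracompact Z -> closed_gembedding i ->
    exists (U : set Z) (r : set_type U -> Y),
      [/\ range i `<=` interior U,
          forall g z, U z -> U (gact g z),
          continuous r,
          forall g (u v : set_type U),
            \val v = gact g (\val u) -> r v = gact g (r u)
        & forall y (u : set_type U), \val u = i y -> r u = y].

(* The bonding G-homotopy classes are given by representatives.               *)
Record inverse_gsystem := InverseGSystem {
  sys_index : Type;
  sys_le : sys_index -> sys_index -> Prop;
  sys_inhabited : inhabited sys_index;
  sys_refl : forall a, sys_le a a;
  sys_trans : forall a b c, sys_le a b -> sys_le b c -> sys_le a c;
  sys_directed : forall a b, exists c, sys_le a c /\ sys_le b c;
  sys_term :> sys_index -> gspace G;
  bond : forall a a', sys_le a a' -> gmap (sys_term a') (sys_term a);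
  bond_id : forall a (aa : sys_le a a),
    ghomotopic (bond aa) (gmap_id (sys_term a));
  bond_comp : forall a a' a''
      (l : sys_le a a') (l' : sys_le a' a'') (l'' : sys_le a a''),
    ghomotopic (bond l \og bond l') (bond l'')
}.

Definition GANR_system (S : inverse_gsystem) : Prop :=
  forall a : sys_index S, is_GANR (S a).

Definition gmovable_system (S : inverse_gsystem) : Prop :=
  forall a : sys_index S, exists (a' : sys_index S) (l : sys_le a a'),
  forall (a'' : sys_index S) (l' : sys_le a a''),
  exists r : gmap (S a') (S a''), ghomotopic (bond l' \og r) (bond l).

Definition associated (X : gspace G) (S : inverse_gsystem) : Prop :=
  exists p : forall a : sys_index S, gmap X (S a),
    (forall a a' (l : sys_le a a'), ghomotopic (p a) (bond l \og p a')) /\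
    forall K : gspace G, is_GANR K ->
      (forall h : gmap X K, exists a (f : gmap (S a) K),
          ghomotopic h (f \og p a)) /\
      (forall a (f f' : gmap (S a) K), ghomotopic (f \og p a) (f' \og p a) ->
          exists a' (l : sys_le a a'),
            ghomotopic (f \og bond l) (f' \og bond l)).

Definition gmovable (X : gspace G) : Prop :=
  exists S, [/\ GANR_system S, associated X S & gmovable_system S].

(* Morphisms of the pro-category of the G-homotopy category; the index map    *)
(* need not be monotone.                                                      *)
Record system_map (S T : inverse_gsystem) := SystemMap {
  sm_index : sys_index T -> sys_index S;
  sm_map : forall b, gmap (S (sm_index b)) (T b);
  sm_coherent : forall b b' (l : sys_le b b'),
    exists a (l1 : sys_le (sm_index b) a) (l2 : sys_le (sm_index b') a),
      ghomotopic (sm_map b \og bond l1) (bond l \og (sm_map b' \og bond l2))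
}.

(* The composite of h followed by k is equivalent to the identity of S.       *)
Definition pro_retract (S T : inverse_gsystem)
    (h : system_map S T) (k : system_map T S) : Prop :=
  forall a : sys_index S,
  exists a' (l : sys_le a a') (l1 : sys_le (sm_index h (sm_index k a)) a'),
    ghomotopic (sm_map k a \og sm_map h (sm_index k a) \og bond l1) (bond l).

Definition pro_isomorphic (S T : inverse_gsystem) : Prop :=
  exists (h : system_map S T) (k : system_map T S),
    pro_retract h k /\ pro_retract k h.

Definition same_gshape (X Y : gspace G) : Prop :=
  exists S T, [/\ GANR_system S, associated X S,
    GANR_system T, associated Y T & pro_isomorphic S T].

End Shape.

(* Ordinary shape is G-shape for the trivial group G.                         *)
Definition trivial_shape (R : realType) (X : topologicalType) : Prop :=
  same_gshape R (trivial_gspace 'I_1 X)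
    (trivial_gspace 'I_1 (discrete_topology unit)).

Section Suspension.
Context (R : realType) (B : topologicalType).

Let cylinder : topologicalType := (B * cinterval (- 1 : R) 1)%type.

Definition susp_rel (p q : cylinder) : bool :=
  [|| p == q, (\val p.2 == 1) && (\val q.2 == 1)
    | (\val p.2 == - 1) && (\val q.2 == - 1)].

Lemma susp_rel_refl : reflexive susp_rel.
Proof. by move=> p; rewrite /susp_rel eqxx. Qed.

Lemma susp_rel_sym : symmetric susp_rel.
Proof. by move=> p q; rewrite /susp_rel eq_sym ![(\val p.2 == _) && _]andbC. Qed.

Lemma susp_rel_trans : transitive susp_rel.
Proof.
have neq : (1 == -1 :> R) = false.
  by apply/eqP => /eqP; rewrite -addr_eq0 -mulr2n pnatr_eq0.
move=> q p r /or3P[/eqP -> //|/andP[p1 q1]|/andP[p1 q1]].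
- move=> /or3P[/eqP <-|/andP[_ r1]|/andP[q2 _]].
  + by rewrite /susp_rel p1 q1 orbT.
  + by rewrite /susp_rel p1 r1 orbT.
  + by move: q2; rewrite (eqP q1) neq.
- move=> /or3P[/eqP <-|/andP[q2 _]|/andP[_ r1]].
  + by rewrite /susp_rel p1 q1 !orbT.
  + by move: q2; rewrite (eqP q1) eq_sym neq.
  + by rewrite /susp_rel p1 r1 !orbT.
Qed.

Canonical susp_equiv :=
  EquivRel susp_rel susp_rel_refl susp_rel_sym susp_rel_trans.

Definition susp : topologicalType := quotient_topology {eq_quot susp_equiv}.

(* The point [x, t] for p = (x, t).                                           *)
Definition susp_pt (p : cylinder) : susp := \pi_({eq_quot susp_equiv}) p.

Lemma susp_pt_eq p q : susp_pt p = susp_pt q <-> susp_rel p q.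
Proof. by split => [/eqmodP//|h]; apply/eqmodP. Qed.

Lemma susp_ptP (y : susp) : exists p, y = susp_pt p.
Proof. by exists (repr (y : {eq_quot susp_equiv})); rewrite /susp_pt reprK. Qed.

Lemma susp_pt_continuous : continuous susp_pt.
Proof. exact: pi_continuous. Qed.

Lemma itv_opp_subproof (t : cinterval (- 1 : R) 1) :
  - \val t \in [set` `[- 1 : R, 1]].
Proof.
case: t => t /=; rewrite !inE /= !in_itv /= => /andP[t1 t2].
by rewrite lerN2 t2 lerNl t1.
Qed.

Definition itv_opp (t : cinterval (- 1 : R) 1) : cinterval (- 1 : R) 1 :=
  exist _ (- \val t) (itv_opp_subproof t).

Lemma itv_oppK : involutive itv_opp.
Proof. by move=> t; apply: val_inj; rewrite /= opprK. Qed.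

Lemma itv_opp_continuous : continuous itv_opp.
Proof.
apply: continuous_comp_initial => t.
by apply: continuousN; exact: initial_continuous.
Qed.

(* [x, t] |-> [x, - t]                                                        *)
Definition susp_flip (y : susp) : susp :=
  let p := repr (y : {eq_quot susp_equiv}) in susp_pt (p.1, itv_opp p.2).

Lemma susp_flipE x t : susp_flip (susp_pt (x, t)) = susp_pt (x, itv_opp t).
Proof.
apply/susp_pt_eq.
have /susp_pt_eq : susp_pt (repr (susp_pt (x, t) : {eq_quot susp_equiv})) =
    susp_pt (x, t) by rewrite /susp_pt reprK.
move: (repr _) => [x' t'].
by rewrite /susp_rel/= => /or3P[/eqP[-> ->]|/andP[/eqP-> /eqP->]|/andP[/eqP-> /eqP->]];
  rewrite ?opprK !eqxx ?orbT.
Qed.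

Lemma susp_flipK : involutive susp_flip.
Proof.
move=> y; have [[x t] ->] := susp_ptP y.
by rewrite !susp_flipE itv_oppK.
Qed.

Lemma susp_flip_continuous : continuous susp_flip.
Proof.
apply/(@quotient_continuous _ {eq_quot susp_equiv} susp susp_flip).
have -> : susp_flip \o \pi_(quotient_topology {eq_quot susp_equiv}) =
    susp_pt \o (fun p => (p.1, itv_opp p.2)).
  by apply/funext => -[x t]; exact: susp_flipE.
move=> p; apply: continuous_comp; last exact: susp_pt_continuous.
apply: (@cvg_pair _ _ _ (nbhs p) (nbhs p.1) (nbhs (itv_opp p.2))).
  exact: cvg_fst.
by apply: continuous_comp; [exact: cvg_snd|exact: itv_opp_continuous].
Qed.

Definition susp_act (g : 'Z_2) (y : susp) : susp :=
  if g == 1%g then y else susp_flip y.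

Lemma susp_act1 y : susp_act 1%g y = y.
Proof. by rewrite /susp_act eqxx. Qed.

Lemma susp_actM (g h : 'Z_2) y :
  susp_act (g * h)%g y = susp_act g (susp_act h y).
Proof.
have Z2E (k : 'Z_2) : k = 1%g \/ k = 1 :> 'Z_2.
  by case: k => -[|[|//]] ?; [left|right]; apply: val_inj.
case: (Z2E g) (Z2E h) => -> [] ->;
  by rewrite /susp_act ?mulg1 ?mul1g ?eqxx //= susp_flipK.
Qed.

Lemma susp_act_continuous :
  continuous (fun p : discrete_topology 'Z_2 * susp => susp_act p.1 p.2).
Proof.
apply: discrete_act_continuous => g; rewrite /susp_act.
by case: (g == _); [move=> y; exact: cvg_id|exact: susp_flip_continuous].
Qed.

Definition susp_gspace : gspace 'Z_2 :=
  GSpace susp_act1 susp_actM susp_act_continuous.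

End Suspension.

Section SuspensionMap.
Context (R : realType) (A B : topologicalType) (f : A -> B).

Definition susp_map (y : susp R A) : susp R B :=
  let p := repr (y : {eq_quot susp_equiv R A}) in susp_pt (f p.1, p.2).

Lemma susp_mapE x (t : cinterval (- 1 : R) 1) :
  susp_map (susp_pt (x, t)) = susp_pt (f x, t).
Proof.
apply/susp_pt_eq.
have /susp_pt_eq : susp_pt (repr (susp_pt (x, t) : {eq_quot susp_equiv R A})) =
    susp_pt (x, t) by rewrite /susp_pt reprK.
move: (repr _) => [x' t'].
by rewrite /susp_rel/= => /or3P[/eqP[-> ->]|/andP[/eqP-> /eqP->]|
  /andP[/eqP-> /eqP->]]; rewrite !eqxx ?orbT.
Qed.

Lemma susp_map_equivariant (g : 'Z_2) (y : susp_gspace R A) :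
  susp_map (gact g y) = gact g (susp_map y : susp_gspace R B).
Proof.
rewrite /= /susp_act; case: (g == _) => //.
by have [[x t] ->] := susp_ptP y; rewrite susp_flipE !susp_mapE susp_flipE.
Qed.

End SuspensionMap.

Section InverseLimit.
Context (G : finGroupType) (X : nat -> gspace G).
Context (f : forall n, X n.+1 -> X n).
Context (fG : forall n g (x : X n.+1), @f n (gact g x) = gact g (@f n x)).

Definition invlim_set : set (prod_topology X) :=
  [set x | forall n, @f n (x n.+1) = x n].

Let invlim : topologicalType := set_type invlim_set.

Lemma invlim_act_subproof g (x : invlim) :
  (fun n => gact g (\val x n)) \in invlim_set.
Proof.
by apply/mem_set => n /=; rewrite fG; have /set_mem -> := valP x.
Qed.

Definition invlim_act g (x : invlim) : invlim :=
  exist _ (fun n => gact g (\val x n)) (invlim_act_subproof g x).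

Lemma invlim_act1 x : invlim_act 1%g x = x.
Proof. by apply: val_inj; apply: functional_extensionality_dep => n /=; rewrite gact1. Qed.

Lemma invlim_actM g h x : invlim_act (g * h)%g x = invlim_act g (invlim_act h x).
Proof. by apply: val_inj; apply: functional_extensionality_dep => n /=; rewrite gactM. Qed.

Lemma invlim_act_continuous :
  continuous (fun p : discrete_topology G * invlim => invlim_act p.1 p.2).
Proof.
apply: discrete_act_continuous => g.
apply: continuous_comp_initial => x.
apply/(cvg_sup _ _ (fmap_filter _ (nbhs_filter x))) => n.
have cn : continuous ((fun x : invlim => fun n => gact g (\val x n))
    : invlim -> initial_topology (fun y : prod_topology X => y n)).
  apply: continuous_comp_initial => y.
  have -> : (fun y : prod_topology X => y n) \o
    (fun (x : invlim) (n : nat) => gact g (\val x n)) =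
    gact g \o (@proj _ X n \o (\val : invlim -> prod_topology X)) by [].
  apply: continuous_comp; last exact: gact_continuous1.
  apply: continuous_comp; first exact: initial_continuous.
  exact: proj_continuous.
exact: cn.
Qed.

Definition invlim_gspace : gspace G :=
  GSpace invlim_act1 invlim_actM invlim_act_continuous.

End InverseLimit.

Section BouquetMap.
Context (R : realType).
Local Notation C := (R[i])^o.

Definition circle : set C := [set z | `|z| = 1].

Definition bouquet_set : set (C * C) :=
  (circle `*` [set 1]) `|` ([set 1] `*` circle).

Definition bouquet : topologicalType := set_type bouquet_set.

(* The argument of z in circle, normalized to [0, 2 pi[.                      *)
Definition arg (z : C) : R :=
  if 0 <= complex.Im z then acos (complex.Re z)
  else 2 * pi - acos (complex.Re z).

Lemma circle_sqr z : circle z -> complex.Re z ^+ 2 + complex.Im z ^+ 2 = 1.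
Proof.
case: z => a b /=; rewrite /circle /= normc_def /= => -[/(congr1 (@GRing.exp R ^~ 2%N))].
by rewrite sqr_sqrtr ?expr1n // addr_ge0 // sqr_ge0.
Qed.

Lemma arg_spec z : circle z ->
  [/\ 0 <= arg z, arg z < 2 * pi & z = (cos (arg z) +i* sin (arg z))%C].
Proof.
case: z => a b /circle_sqr /= ab1.
have a1 : -1 <= a <= 1.
  by rewrite -ler_norml -(expr_le1 (ltn0Sn 1)) // real_normK ?num_real //
    -ab1 lerDl sqr_ge0.
have sE : 1 - a ^+ 2 = b ^+ 2 by rewrite -ab1 addrAC subrr add0r.
rewrite /arg /=; case: ifP => b0.
  split; first exact: acos_ge0.
    by rewrite (le_lt_trans (acos_lepi a1)) // ltr_pMl ?pi_gt0 // ltr1n.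
  by rewrite acosK ?in_itv //= sin_acos // sE sqrtr_sqr ger0_norm.
have b_lt0 : b < 0 by rewrite ltNge b0.
have a_lt1 : a < 1.
  rewrite lt_neqAle (andP a1).2 andbT; apply: contraTneq b_lt0 => a1'.
  have : b ^+ 2 == 0 by rewrite -sE a1' expr1n subrr.
  by rewrite expf_eq0 /= => /eqP ->; rewrite ltxx.
split.
- rewrite subr_ge0 (le_trans (acos_lepi a1)) // ler_pMl ?pi_gt0 //.
  by rewrite ler1n.
- by rewrite ltrBlDr ltrDl acos_gt0 // (andP a1).1.
- rewrite addrC mulr_natl cosD2pi sinD2pi cosN sinN.
  by rewrite acosK ?in_itv //= sin_acos // sE sqrtr_sqr ltr0_norm // opprK.
Qed.

(* z |-> f (z, 1) and t |-> f (1, t), respectively.                           *)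
Definition bouquet_fun1 (z : C) : C * C :=
  if arg z <= pi / 2 then (z ^+ 4, 1)
  else if arg z <= pi then (1, z ^+ 4)
  else if arg z <= 3 * pi / 2 then (z ^- 4, 1)
  else (1, z ^- 4).

Definition bouquet_fun2 (t : C) : C * C :=
  if arg t <= pi / 2 then (t ^- 4, 1)
  else if arg t <= pi then (1, t ^- 4)
  else if arg t <= 3 * pi / 2 then (t ^+ 4, 1)
  else (1, t ^+ 4).

Definition bouquet_fun (p : C * C) : C * C :=
  if p.2 == 1 then bouquet_fun1 p.1 else bouquet_fun2 p.2.

Lemma circleX z n : circle z -> circle (z ^+ n).
Proof. by rewrite /circle /= normrX => ->; rewrite expr1n. Qed.

Lemma circleXN z n : circle z -> circle (z ^- n).
Proof. by move=> zS; rewrite /circle /= normfV circleX // invr1. Qed.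

Lemma bouquet_fun_subproof (p : bouquet) : bouquet_fun (\val p) \in bouquet_set.
Proof.
have circle1 : circle 1 by rewrite /circle /= normr1.
apply/mem_set; rewrite /bouquet_fun; have /set_mem := valP p.
case: (\val p) => z t /= zt.
have [t1|t1] := eqVneq t 1.
  have zS : circle z by case: zt => -[] //= ->.
  by rewrite /bouquet_fun1; do 3?[case: ifP => _]; rewrite /bouquet_set /=;
    [left|right|left|right]; split=> //=; [exact: circleX|exact: circleX|
      exact: circleXN|exact: circleXN].
have tS : circle t by case: zt => -[] //= _ /eqP; rewrite (negbTE t1).
by rewrite /bouquet_fun2; do 3?[case: ifP => _]; rewrite /bouquet_set /=;
  [left|right|left|right]; split=> //=; [exact: circleXN|exact: circleXN|
    exact: circleX|exact: circleX].
Qed.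

Definition bouquet_map (p : bouquet) : bouquet :=
  exist _ (bouquet_fun (\val p)) (bouquet_fun_subproof p).

(* The inverse limit of copies of the suspension of B along Sigma f.          *)
Definition SigmaP : gspace 'Z_2 :=
  @invlim_gspace 'Z_2 (fun _ => susp_gspace R bouquet)
    (fun _ => susp_map bouquet_map)
    (fun _ => @susp_map_equivariant R bouquet bouquet bouquet_map).

End BouquetMap.

(* Main.v *)
(* Shape: the inverse limit embeds in a countable power of a cube, and maps    *)
(* into ANRs extend to neighborhoods, so that homotopy classes of maps from    *)
(* the limit are those of the tower of suspensions. Each circle is mapped by   *)
(* f to a commutator, which dies after suspension: the suspension of f is      *)
(* null homotopic.                                                            *)
(* Movability: on fixed points an equivariant homotopy restricts to B, so     *)
(* movability would give a k such that, for every N, f^k is homotopic to a map *)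
(* factoring up to homotopy through f^N. On fundamental groups f acts by       *)
(* a |-> a b a^-1 b^-1, b |-> a^-1 b^-1 a b. Represent a, b by the matrices    *)
(* (1 3; 0 1), (1 0; 3 1): the N-th iterates are congruent to 1 modulo         *)
(* 3^(2^N), so the k-th iterate of a would be 1 modulo all these powers, but   *)
(* by a ping-pong argument it is not 1. The comparison is made combinatorially, *)
(* with a matrix valued cocycle evaluated on fine closed chains of points.     *)

From HB Require Import structures.
Require Import Defs.
From mathcomp Require Import all_boot all_order all_algebra fingroup.
From mathcomp Require Import generic_quotient wochoice.
From mathcomp Require Import all_classical all_reals all_analysis.
From mathcomp Require Import complex.
From mathcomp Require Import ring lra zify.

Set Implicit Arguments.
Unset Strict Implicit.
Unset Printing Implicit Defensive.

Import Order.TTheory GRing.Theory Num.Theory.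
Import numFieldNormedType.Exports.

Local Open Scope classical_set_scope.
Local Open Scope quotient_scope.
Local Open Scope ring_scope.

(** * Normality of paracompact p-spaces *)

(** Write F for the suspension of f. Both halves use a continuity principle for the limit of a tower
    with constant bonding map F: up to equivariant homotopy, a map from the limit to an ANR comes
    from a stage ([tower_factorization]), and two maps of a stage that agree on the limit agree
    after composition with a power of F ([tower_equalization]). The limit is a decreasing
    intersection of compact sets in a countable power of a cube, so both facts follow once
    equivariant maps from closed sets of a compact space to an ANR extend to neighborhoods
    ([neighborhood_extension]). That extension is a retraction of an adjunction space, which is
    shown to be a paracompact p-space.

    Shape. On each circle f runs along a commutator, so its two components have winding number zero
    and lift to real parameters [phi1], [phi2], which could be scaled to 0 if the two circles did
    not block each other at the wedge point. The suspension coordinate gives room to separate them,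
    so F is null homotopic ([susp_map_nullhomotopic]). Hence every map from the limit to an ANR is
    homotopic to a constant, and the one-point system is associated with the limit.

    Movability. It would provide a k such that, for every N, F^k factors up to equivariant homotopy
    through every ANR through which F^N factors ([movable_tower]). The ANRs used are invariant open
    sets of a linear representation whose fixed points are close to the graph of f^N
    ([test_space_GANR]). On the fixed set, the equator B, the loop f^k(a) becomes freely homotopic
    to a closed chain in the image of f^N ([fixed_homotopy]).

    On the free fundamental group f acts by a -> a b a^-1 b^-1 and b -> a^-1 b^-1 a b. Send a, b to
    integer shears congruent to 1 modulo 3. Commutators square the modulus, so whatever passes
    through f^N becomes 1 modulo 3^(2^N) ([comm_pair_one_mod]), whereas the fixed matrix of f^k(a)
    is not 1 by ping-pong ([ping_pong_iter]). A large N gives a contradiction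
    ([shear_iter_one_mod]). The fundamental group itself is replaced by a matrix cocycle on fine
    chains: homotopic closed chains have conjugate products ([holonomy_grid]), and f pulls the
    cocycle of a, b back to that of the commutators up to a gauge change ([gauge_holonomy]). *)

Section Separation.
Context {X : topologicalType}.
Hypothesis hX : hausdorff_space X.

(** Compactness is used as a near-covering property along the filter of small neighborhoods of [x],
    which yields one neighborhood good for all of [K] without extracting a finite subcover. *)
Lemma compact_point_separation (K : set X) (x : X) : compact K -> ~ K x ->
  exists2 U, nbhs x U & K `&` closure U = set0.
Proof.
move=> /compact_near_coveringP cK Kx.
have [|/= U [Us _ [V UV]] sub] := cK _ (powerset_filter_from (nbhs x))
    (fun U y => ~ closure U y) _.
  move=> y Ky; have xy : x != y by apply/eqP => xy; apply: Kx; rewrite xy.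
  move: hX; rewrite open_hausdorff => /(_ _ _ xy)[[A B] /=].
  rewrite !inE => -[Ax By] [oA oB AB0].
  exists (B, [set U | U `<=` A]) => /=.
    split; first exact: open_nbhs_nbhs.
    by apply: small_set_sub; exact: open_nbhs_nbhs.
  move=> [y' U] /= [By' UA] /(closureS UA).
  move=> /(_ B); case; first exact: open_nbhs_nbhs.
  by move=> z [Az Bz]; have : (A `&` B) z by []; rewrite AB0.
exists V; first exact: Us.
by rewrite -subset0 => y [Ky]; exact: (sub _ UV y Ky).
Qed.

Lemma compact_separation (A B : set X) : compact A -> compact B ->
  A `&` B = set0 ->
  exists U V, [/\ open U, open V, A `<=` U, B `<=` V & U `&` V = set0].
Proof.
move=> /compact_near_coveringP cA cB AB0.
have [->|/set0P B0] := eqVneq B set0.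
  by exists setT, set0; split; rewrite ?setI0//; [exact: openT|exact: open0].
have pB : ProperFilter (set_nbhs B) by exact: set_nbhs_pfilter.
have FB : Filter (powerset_filter_from (set_nbhs B)).
  exact: powerset_filter_from_filter.
have [|/= F [Fs _ [V FV]] sub] := cA _ (powerset_filter_from (set_nbhs B))
    (fun U y => ~ closure U y) FB.
  move=> x Ax; have nBx : ~ B x by move=> Bx; have : (A `&` B) x by []; rewrite AB0.
  have [U Ux BU0] := compact_point_separation cB nBx.
  exists (interior U, [set W | W `<=` ~` closure U]) => /=.
    split; first exact: nbhs_interior.
    apply: small_set_sub; apply/set_nbhsP; exists (~` closure U); split => //.
      exact/closed_openC/closed_closure.
    by apply/disjoints_subset.
  move=> [y' W] /= [Uy' WU] /(_ U Uy').
  move=> [z [/WU + Uz]]; apply.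
  exact: subset_closure.
have /set_nbhsP[W [oW BW WV]] := Fs _ FV.
exists (~` closure V), W; split => //.
- exact/closed_openC/closed_closure.
- exact: (sub _ FV).
- rewrite -subset0 => z [nV Wz]; apply: nV; apply: subset_closure; exact: WV.
Qed.

End Separation.

Lemma closed_map_nbhs (X M : topologicalType) (q : X -> M) (y : M) (O : set X) :
  (forall A, closed A -> closed (q @` A)) -> open O -> q @^-1` [set y] `<=` O ->
  exists W, [/\ open W, W y & q @^-1` W `<=` O].
Proof.
move=> clq oO qO; exists (~` (q @` (~` O))); split.
- exact/closed_openC/clq/open_closedC.
- by move=> [x nOx qx]; apply: nOx; exact: qO.
- by move=> x /= nx; apply: contrapT => nOx; apply: nx; exists x.
Qed.

(** Remove from each [G n] the closures of the [H i] with i <= n, and conversely. The rests still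
    cover, and a point common to both unions would have been removed from the set with the larger
    index. *)
Lemma countable_separation (R : realType) (X : topologicalType) :
  (forall A B : set X, closed A -> closed B -> A `&` B = set0 ->
    exists G : nat -> set X, [/\ forall n, open (G n), A `<=` \bigcup_n G n
      & forall n, closure (G n) `&` B = set0]) -> normal_space X.
Proof.
move=> sep; apply/(@normal_openP R) => A B cA cB AB0.
have [G [oG AG GB]] := sep _ _ cA cB AB0.
have [H [oH BH HA]] := sep _ _ cB cA (etrans (setIC _ _) AB0).
pose U n := G n `&` ~` \bigcup_(i in [set j | (j <= n)%N]) closure (H i).
pose V n := H n `&` ~` \bigcup_(i in [set j | (j <= n)%N]) closure (G i).
have cf (F : nat -> set X) n : closed (\bigcup_(i in [set j | (j <= n)%N]) closure (F i)).
  apply: closed_bigcup => [|i _]; last exact: closed_closure.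
  exact: (sub_finite_set (B := `I_n.+1)).
exists (\bigcup_n U n), (\bigcup_n V n); split.
- by apply: bigcup_open => n _; apply: openI => //; exact/closed_openC/cf.
- by apply: bigcup_open => n _; apply: openI => //; exact/closed_openC/cf.
- move=> x Ax; have [n _ Gx] := AG _ Ax; exists n => //; split => // -[i _ Hx].
  by have : (closure (H i) `&` A) x by []; rewrite HA.
- move=> x Bx; have [n _ Hx] := BH _ Bx; exists n => //; split => // -[i _ Gx].
  by have : (closure (G i) `&` B) x by []; rewrite GB.
- rewrite -subset0 => x [[n _ [Gx nH]] [m _ [Hx nG]]].
  have [nm|mn] := leqP n m.
    by apply: nG; exists n => //; exact: subset_closure.
  by apply: nH; exists m; [exact: ltnW|exact: subset_closure].
Qed.

(** The traces of [A] and [B] on a compact fibre have disjoint open neighborhoods, and since [q] is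
    closed these separate [A] from [B] over a neighborhood of the base point. The resulting open
    cover of [M] has a sigma-discrete refinement. On each discrete layer the local separations can
    be united, which gives the countable families of [countable_separation]. *)
Lemma perfect_metric_normal (R : realType) (X : topologicalType) (M : metricType R)
  (q : X -> M) : hausdorff_space X -> perfect_map q -> normal_space X.
Proof.
move=> hX [cq _ clq fq]; apply: (@countable_separation R) => A B cA cB AB0.
have /choice[T HT] : forall m : M, exists T : set X * set X * set M,
    [/\ [/\ open T.1.1, open T.1.2 & T.1.1 `&` T.1.2 = set0], open T.2, T.2 m,
      A `&` q @^-1` T.2 `<=` T.1.1 & B `&` q @^-1` T.2 `<=` T.1.2].
  move=> m.
  have [||| U [V [oU oV AU BV UV0]]] := @compact_separation _ hX
      (A `&` q @^-1` [set m]) (B `&` q @^-1` [set m]).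
  - by rewrite setIC; exact: compact_closedI.
  - by rewrite setIC; exact: compact_closedI.
  - by rewrite setIACA AB0 set0I.
  have [||W [oW Wm WO]] := @closed_map_nbhs _ _ q m
      ((~` A `|` U) `&` (~` B `|` V)) clq.
  - by apply: openI; apply: openU => //; exact: closed_openC.
  - move=> x qx; split.
      by have [Ax|] := pselect (A x); [right; apply: AU|left].
    by have [Bx|] := pselect (B x); [right; apply: BV|left].
  exists (U, V, W); split => //=.
  - by move=> x [Ax /WO[[]]].
  - by move=> x [Bx /WO[_ []]].
have [le wo] := well_ordering_principle M.
pose first m x := (T m).2 x /\ forall m', (T m').2 x -> le m m'.
have lexx x : le x x.
  have [|z [[]]] := wo (pred1 x); first by exists x; rewrite inE.
  by rewrite inE => /eqP -> /(_ x) + _; rewrite inE eqxx; apply.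
have le_anti : antisymmetric le.
  move=> x y /andP[xy yx]; have [|z [_ uz]] := wo (pred2 x y).
    by exists x; rewrite inE /= eqxx.
  have min w : w = x \/ w = y -> minimum_of le (pred2 x y) w.
    by move=> [] ->; split => [|v]; rewrite inE /= ?eqxx ?orbT// => /orP[]/eqP ->.
  by rewrite -(uz x) ?(uz y)//; apply: min; [right|left].
have firstP x : exists m, first m x.
  have [|m [[]]] := wo [pred m | `[< (T m).2 x >]].
    by exists x; apply/asboolP; have [_ _ + _ _] := HT x.
  move=> /asboolP Tm lb _; exists m; split; first exact: Tm.
  by move=> m' Tm'; apply: lb; exact/asboolP.
pose r n : R := n.+1%:R^-1.
have r0 n : 0 < r n by rewrite invr_gt0.
(* Stone's sigma-discrete refinement of the cover by the sets [(T m).2]. *)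
pose E n m := [set y | exists x, [/\ first m x,
  (forall z, mdist x z < 3 * r n -> (T m).2 z) & mdist x y < r n]].
have oE n m : open (E n m).
  rewrite openE => y [x [fx bx xy]]; rewrite /interior -nbhs_ballE.
  exists (r n - mdist x y) => /=; first by rewrite subr_gt0.
  rewrite ballEmdist => z /= yz; exists x; split => //.
  by rewrite (le_lt_trans (metric_triangle _ y _))// -ltrBrDl.
have ET n m y d : E n m y -> mdist y d < 2 * r n -> (T m).2 d.
  move=> [x [fx bx xy]] yd; apply: bx; rewrite (le_lt_trans (metric_triangle _ y _))//.
  by have -> : 3 * r n = r n + 2 * r n by [ring]; rewrite ltrD.
(* Centres at distance less than 3 [r n] lie in each other's cover set, so both indices would be the
   least one. Hence the [E n m] with distinct [m] are at distance at least [r n]. *)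
have Esep n m m' y y' : E n m y -> E n m' y' -> mdist y y' < r n -> m = m'.
  move=> [x [[Tx fx] bx xy]] [x' [[Tx' fx'] bx' xy']] yy'.
  have xx' : mdist x x' < 3 * r n.
    have := metric_triangle x y x'; have := metric_triangle y y' x'.
    rewrite (metric_sym y' x'); lra.
  apply: le_anti; apply/andP; split.
    by apply: fx; apply: bx'; rewrite metric_sym.
  by apply: fx'; apply: bx.
pose G n := \bigcup_m ((q @^-1` E n m) `&` (T m).1.1).
exists G; split.
- move=> n; apply: bigcup_open => m _; apply: openI; last by have [[]] := HT m.
  by apply: open_comp => // ? _; exact: cq.
- move=> x Ax; have [m mx] := firstP (q x).
  have [_ oW _ AU _] := HT m; have [Wx _] := mx.
  have : nbhs (q x) (T m).2 by exact: open_nbhs_nbhs.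
  rewrite -nbhs_ballE => -[e /= e0]; rewrite ballEmdist => eW.
  have [n ne] : exists n, 3 * r n < e.
    have e3 : 0 < e / 3 by rewrite divr_gt0.
    have [n _ /(_ n (leqnn n))] := near_infty_natSinv_lt (PosNum e3).
    by rewrite /= ltr_pdivlMr// mulrC => ?; exists n.
  exists n => //; exists m => //; split; last exact: AU.
  exists (q x); split => //; last by rewrite mdistxx.
  by move=> z zx; apply: eW => /=; apply: lt_trans ne.
- move=> n; rewrite -subset0 => b [clGb Bb].
  pose N := q @^-1` [set y | mdist (q b) y < r n / 2].
  have nN : nbhs b N.
    apply: cq; rewrite -nbhs_ballE; exists (r n / 2) => /=; first by rewrite divr_gt0.
    by rewrite ballEmdist.
  (* A first point of [G n] near [b] identifies the only index [m0] active there. A second one,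
     taken inside the open set that [m0] assigns to [B], must have the same index, which is
     absurd. *)
  have [g0 [[m0 _ [Eg0 _]] Ng0]] := clGb _ nN.
  have Wb : (T m0).2 (q b).
    apply: ET Eg0 _; rewrite metric_sym; apply: lt_trans Ng0 _.
    by have := r0 n; lra.
  have [[_ oV UV0] _ _ _ BV] := HT m0.
  have Vb : (T m0).1.2 b by apply: BV.
  have [g [[m _ [Eg Ug]] [Ng Vg]]] := clGb _ (filterI nN (open_nbhs_nbhs (conj oV Vb))).
  have mm0 : m = m0.
    apply: Esep Eg Eg0 _; have := metric_triangle (q g) (q b) (q g0).
    rewrite (metric_sym (q g) (q b)); move: Ng Ng0; rewrite /N /=; lra.
  by rewrite mm0 in Ug; have : ((T m0).1.1 `&` (T m0).1.2) g by []; rewrite UV0.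
Qed.

Lemma p_paracompact_normal (R : realType) (X : topologicalType) :
  p_paracompact R X -> normal_space X.
Proof. by move=> [hX [M [q pq]]]; exact: perfect_metric_normal pq. Qed.

(** * Extension of equivariant maps to neighborhoods *)

(** The image filter clusters at some c in [C]. If no point over c were a cluster point, compactness
    of the fibre would give a member of the filter whose closure misses the fibre, and closedness of
    [q] would make it miss the preimage of a neighborhood of c. *)
Lemma perfect_preimage_compact (X M : topologicalType) (q : X -> M) (C : set M) :
  perfect_map q -> compact C -> compact (q @^-1` C).
Proof.
move=> [cq _ clq fq] cC F PF FC.
have [c [Cc cF]] := cC (q @ F) _ FC.
have [//|nF] := pselect (exists x, q x = c /\ cluster F x).
  by case=> x [qx Fx]; exists x; split => //=; rewrite qx.
have /compact_near_coveringP cf := fq c.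
have FB : Filter (powerset_filter_from F) by exact: powerset_filter_from_filter.
have [|/= G [Gs _ [V GV]] sub] := cf _ _ (fun U y => ~ closure U y) FB.
  move=> x /= qx.
  have [A [B [FA nB AB]]] : exists A B, [/\ F A, nbhs x B & A `&` B = set0].
    apply: contrapT => nAB; apply: nF; exists x; split => // A B FA nB.
    by apply/set0P/eqP => AB0; apply: nAB; exists A, B.
  exists (interior B, [set U | U `<=` A]) => /=.
    by split; [exact: nbhs_interior|exact: small_set_sub].
  move=> [y U] /= [By UA] /(_ B By) [z [/UA Az Bz]].
  by have : (A `&` B) z by []; rewrite AB.
have [||W [oW Wc qW]] := @closed_map_nbhs _ _ q c (~` closure V) clq.
- exact/closed_openC/closed_closure.
- exact: sub.
have [_ [[x Vx <-] Wx]] : q @` V `&` W !=set0.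
  apply: cF; last exact: open_nbhs_nbhs.
  by apply: (@filterS _ F _ V); [move=> x Vx; exists x|exact: Gs].
by have := qW x Wx; case; exact: subset_closure.
Qed.

(* The quotient M / C, with C represented by its point c0. *)
Definition collapse (R : realType) (M : metricType R) (C : set M) (c0 : M)
  (cC : compact C) (Cc0 : C c0) : Type := set_type [set m | ~ C m \/ m = c0].

(** * The metric quotient by a compact set *)

Section Collapse.
Context (R : realType) (M : metricType R) (C : set M).
Hypothesis cC : compact C.

Definition set_dist (m : M) : R := inf [set mdist m c | c in C].

Context (c0 : M) (Cc0 : C c0).

Lemma set_dist_ge0 m : 0 <= set_dist m.
Proof.
apply: lb_le_inf; first by exists (mdist m c0), c0.
by move=> _ [c _ <-]; exact: mdist_ge0.
Qed.

Lemma set_dist_le m c : C c -> set_dist m <= mdist m c.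
Proof.
move=> Cc; apply: ge_inf; last by exists c.
by exists 0 => _ [c' _ <-]; exact: mdist_ge0.
Qed.

Lemma set_dist_lip m n : set_dist m <= mdist m n + set_dist n.
Proof.
rewrite -lerBlDl; apply: lb_le_inf; first by exists (mdist n c0), c0.
move=> _ [c Cc <-]; rewrite lerBlDl.
by rewrite (le_trans (set_dist_le _ Cc))// metric_triangle.
Qed.

Lemma set_dist_in m : C m -> set_dist m = 0.
Proof.
move=> Cm; apply/eqP; rewrite eq_le set_dist_ge0 andbT.
by rewrite (le_trans (set_dist_le _ Cm))// mdistxx.
Qed.

Lemma set_dist_closed (F : set M) : closed F -> C `&` F = set0 ->
  exists2 e, 0 < e & forall m, F m -> e <= set_dist m.
Proof.
move=> cF CF0; have /compact_near_coveringP cv := cC.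
have nr : \forall e \near 0^'+, C `<=` (fun c => forall m, F m -> (e : R) <= mdist m c).
  apply: cv => c Cc; have : nbhs c (~` F).
    apply: open_nbhs_nbhs; split; first exact: closed_openC.
    by move=> Fc; have : (C `&` F) c by []; rewrite CF0.
  rewrite -nbhs_ballE => -[e /= e0]; rewrite ballEmdist => eF.
  exists ([set y | mdist c y < e / 2], [set r | r <= e / 2]) => /=.
    split; last by apply: nbhs_right_le; rewrite divr_gt0.
    by rewrite -nbhs_ballE; exists (e / 2); rewrite /= ?divr_gt0// ballEmdist.
  move=> [y r] /= [cy re] m Fm; apply: (le_trans re); rewrite leNgt; apply/negP => my.
  apply: (eF m) => //=; rewrite (le_lt_trans (metric_triangle _ y _))//.
  by rewrite [ltRHS]splitr ltrD// metric_sym.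
have [d [d0 sub]] := filter_ex (filterI (nbhs_right_gt (0 : R)) nr).
exists d => // m Fm; apply: lb_le_inf; first by exists (mdist m c0), c0.
by move=> _ [c Cc <-]; exact: sub.
Qed.

Lemma set_dist_gt0 m : ~ C m -> 0 < set_dist m.
Proof.
move=> nCm; have [||e e0 em] := @set_dist_closed [set m].
- by apply: accessible_closed_set1; apply: hausdorff_accessible; exact: metric_hausdorff.
- by rewrite -subset0 => x [Cx xm]; apply: nCm; rewrite -xm.
- exact: lt_le_trans (em _ erefl).
Qed.

(** The quotient pseudometric: go directly, or through [C], where travel is free. *)
Let pd m n := Num.min (mdist m n) (set_dist m + set_dist n).

Let pdxx m : pd m m = 0.
Proof. by rewrite /pd mdistxx; apply/min_idPl; rewrite addr_ge0 ?set_dist_ge0. Qed.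

Let pd_sym m n : pd m n = pd n m.
Proof. by rewrite /pd metric_sym addrC. Qed.

Let pd_triangle n m k : pd m k <= pd m n + pd n k.
Proof.
have := metric_triangle m n k; have := set_dist_lip m n; have := set_dist_lip k n.
rewrite (metric_sym k n); have := set_dist_ge0 n; have := @mdist_ge0 _ _ m k.
by rewrite /pd /Num.min; do 3?case: ifPn; rewrite -?leNgt; lra.
Qed.

Let pd_C m n : C m -> pd m n = set_dist n.
Proof.
move=> Cm; rewrite /pd (set_dist_in Cm) add0r; apply/min_idPr.
by rewrite metric_sym set_dist_le.
Qed.

Local Notation collapse := (collapse cC Cc0).

HB.instance Definition _ :=
  Choice.copy collapse (set_type [set m | ~ C m \/ m = c0]).

Let cval (a : collapse) : M := \val (a : set_type [set m | ~ C m \/ m = c0]).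

Let cd (a b : collapse) := pd (cval a) (cval b).

Let cd_positivity a b : cd a b = 0 -> a = b.
Proof.
case: a b => [a Ha] [b Hb]; rewrite /cd /cval /pd /= => ab.
apply: val_inj => /=; have [/eqP|nab] := eqVneq (mdist a b) 0.
  by move=> /eqP; exact: mdist_positivity.
have abC : set_dist a + set_dist b = 0 by move: ab; rewrite /Num.min;
  case: ifP => // _ /eqP; rewrite (negbTE nab).
have Cz x y : set_dist x + set_dist y = 0 -> C x.
  move=> xy; apply: contrapT => /set_dist_gt0; have := set_dist_ge0 y; lra.
move: Ha Hb; rewrite !inE => -[/(_ (Cz _ _ abC))//|->] [|-> //].
by move=> /(_ (Cz _ _ (etrans (addrC _ _) abC))).
Qed.

HB.instance Definition _ := @isMetric.Build R collapse cd
  (fun a => pdxx (cval a)) cd_positivity (fun a b => pd_sym (cval a) (cval b))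
  (fun a b c => pd_triangle (cval a) (cval b) (cval c)).

Let rep m := if pselect (C m) then c0 else m.

Let rep_in m : C m -> rep m = c0. Proof. by rewrite /rep; case: pselect. Qed.

Let rep_notin m : ~ C m -> rep m = m. Proof. by rewrite /rep; case: pselect. Qed.

Lemma collapse_subproof m : rep m \in [set m | ~ C m \/ m = c0].
Proof. by rewrite inE /rep; case: pselect => ?; [right|left]. Qed.

Definition collapse_proj m : collapse :=
  exist (fun x : M => x \in [set m | ~ C m \/ m = c0]) _ (collapse_subproof m).

Definition collapse_pt : collapse := collapse_proj c0.

Lemma collapse_proj_in m : C m -> collapse_proj m = collapse_pt.
Proof. by move=> Cm; apply: val_inj; rewrite /= !rep_in. Qed.

Lemma collapse_proj_eq m n : ~ C m -> collapse_proj n = collapse_proj m -> n = m.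
Proof.
move=> nCm /(congr1 cval); rewrite /cval /= (rep_notin nCm).
have [Cn|nCn] := pselect (C n); last by rewrite rep_notin.
by rewrite rep_in// => mE; case: nCm; rewrite -mE.
Qed.

Let pd_proj m : pd (cval (collapse_proj m)) m = 0.
Proof.
rewrite /cval /=; have [Cm|nCm] := pselect (C m); last by rewrite rep_notin.
by rewrite rep_in// pd_C// set_dist_in.
Qed.

Lemma collapse_mdist m n : mdist (collapse_proj m) (collapse_proj n) = pd m n.
Proof.
rewrite /mdist /= /cd.
have := pd_triangle m (cval (collapse_proj m)) (cval (collapse_proj n)).
have := pd_triangle n m (cval (collapse_proj n)).
have := pd_triangle (cval (collapse_proj m)) m n.
have := pd_triangle (cval (collapse_proj n)) (cval (collapse_proj m)) n.
rewrite (pd_sym m (cval _)) (pd_sym n (cval _)) !pd_proj /=.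
by move=> ? ? ? ?; apply/eqP; rewrite eq_le; apply/andP; split; lra.
Qed.

Lemma collapse_proj_continuous : continuous collapse_proj.
Proof.
move=> m U; rewrite /= -nbhs_ballE => -[e /= e0]; rewrite ballEmdist => eU.
rewrite /= -nbhs_ballE; exists e => //; rewrite ballEmdist => n /= mn.
by apply: eU; rewrite /= collapse_mdist /pd gt_min mn.
Qed.

Lemma collapse_projP a : exists2 m, a = collapse_proj m & C m -> a = collapse_pt.
Proof.
case: a => a Ha; have /set_mem := Ha; rewrite /= => Ha'.
have aE : exist _ a Ha = collapse_proj a.
  by apply: val_inj => /=; case: Ha' => [/rep_notin ->//|aE]; rewrite rep_in ?aE.
by exists a => // Ca; rewrite aE; exact: collapse_proj_in.
Qed.

(** A point outside the image is at positive distance from it. At the collapsed point this is the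
    positive distance between the compact [C] and the closed [F]; elsewhere it is the smaller of a
    radius in [M] and the distance to [C]. *)
Lemma collapse_proj_closed (F : set M) : closed F -> closed (collapse_proj @` F).
Proof.
move=> cF; rewrite -[X in closed X]setCK; apply: open_closedC.
rewrite openE => a na; have [m am _] := collapse_projP a.
suff [e e0 eF] : exists2 e, 0 < e & forall n, F n -> e <= pd m n.
  rewrite /interior -nbhs_ballE; exists e => //=; rewrite ballEmdist => b /= ab [n Fn nb].
  by move: ab; rewrite -nb am collapse_mdist ltNge eF.
have [Cm|nCm] := pselect (C m).
  have [//||e e0 eF] := @set_dist_closed F.
    rewrite -subset0 => n [Cn Fn]; apply: na; exists n => //.
    by rewrite am !collapse_proj_in.
  by exists e => // n Fn; rewrite pd_C// eF.
have : nbhs m (~` F).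
  apply: open_nbhs_nbhs; split; first exact: closed_openC.
  by move=> Fm; apply: na; exists m.
rewrite -nbhs_ballE => -[e /= e0]; rewrite ballEmdist => eF.
exists (Num.min e (set_dist m)); first by rewrite lt_min e0 set_dist_gt0.
move=> n Fn; rewrite /pd le_min; apply/andP; split.
  by rewrite ge_min leNgt; apply/orP; left; apply/negP => /eF.
by rewrite ge_min lerDl set_dist_ge0 orbT.
Qed.

End Collapse.

Lemma within_closed (T K : topologicalType) (A : set T) (h : T -> K) (F : set K) :
  closed A -> {within A, continuous h} -> closed F -> closed (A `&` h @^-1` F).
Proof.
move=> cA /continuous_closedP ch cF; rewrite closed_setSI//; exact: ch.
Qed.

Lemma within_open (T K : topologicalType) (A : set T) (h : T -> K) (O : set K) :
  {within A, continuous h} -> open O ->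
  exists2 V, open V & A `&` h @^-1` O = A `&` V.
Proof.
move=> /continuousP ch /ch /open_subspaceP[V oV VO]; exists V => //.
by rewrite setIC -VO setIC.
Qed.

(* The adjunction space of T and K along h : A -> K; the parameter h only      *)
(* matters for the topology, which is final for adj_base and adj_target.       *)
Definition adjunction (T K : topologicalType) (A : set T) (h : T -> K) : Type :=
  (set_type (~` A) + K)%type.

(** * Adjunction spaces *)

Section Adjunction.
Context (T K : topologicalType) (A : set T) (h : T -> K).
Local Notation adj := (adjunction A h).

HB.instance Definition _ := Choice.copy adj (set_type (~` A) + K)%type.

Definition adj_base (t : T) : adj :=
  match pselect (A t) with
  | left _ => inr (h t)
  | right n => inl (exist (fun t => t \in ~` A) t (mem_set n))
  end.

Definition adj_target (k : K) : adj := inr k.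

Lemma adj_base_in t : A t -> adj_base t = adj_target (h t).
Proof. by rewrite /adj_base; case: pselect. Qed.

Lemma adj_base_val (u : set_type (~` A)) : adj_base (\val u) = inl u.
Proof.
case: u => u uA; have /set_mem := uA; rewrite /adj_base /=.
by case: pselect => // nAu _; congr inl; apply: val_inj.
Qed.

Lemma adj_base_notin t k : ~ A t -> adj_base t <> adj_target k.
Proof. by rewrite /adj_base; case: pselect. Qed.

Lemma adj_base_inj t u : ~ A t -> adj_base u = adj_base t -> u = t.
Proof. by rewrite /adj_base; do 2!case: pselect => //; move=> ? ? _ []. Qed.

Let adj_open (O : set adj) := open (adj_base @^-1` O) /\ open (adj_target @^-1` O).

Let adj_openT : adj_open setT. Proof. by split; rewrite preimage_setT; exact: openT. Qed.

Let adj_openI N1 N2 : adj_open N1 -> adj_open N2 -> adj_open (N1 `&` N2).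
Proof. by move=> [? ?] [? ?]; split; rewrite preimage_setI; exact: openI. Qed.

Let adj_open_bigU (I : Type) (F : I -> set adj) :
  (forall i, adj_open (F i)) -> adj_open (\bigcup_i F i).
Proof.
by move=> oF; split; rewrite preimage_bigcup; apply: bigcup_open => i _; case: (oF i).
Qed.

HB.instance Definition _ :=
  isOpenTopological.Build adj adj_openT adj_openI adj_open_bigU.

Lemma adj_openP (O : set adj) :
  open O <-> open (adj_base @^-1` O) /\ open (adj_target @^-1` O).
Proof. by []. Qed.

Lemma adj_closedP (F : set adj) :
  closed F <-> closed (adj_base @^-1` F) /\ closed (adj_target @^-1` F).
Proof.
split=> [/closed_openC/adj_openP[ob ot]|[cb ct]].
  by split; rewrite -[X in closed X]setCK; apply: open_closedC.
rewrite -[X in closed X]setCK; apply: open_closedC; apply/adj_openP.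
by split; [exact: closed_openC cb|exact: closed_openC ct].
Qed.

Lemma adj_base_continuous : continuous adj_base.
Proof. by apply/continuousP => O /adj_openP[]. Qed.

Lemma adj_target_continuous : continuous adj_target.
Proof. by apply/continuousP => O /adj_openP[]. Qed.

Lemma adj_continuous (Y : topologicalType) (g : adj -> Y) :
  continuous (g \o adj_base) -> continuous (g \o adj_target) -> continuous g.
Proof.
move=> /continuousP cb /continuousP ct; apply/continuousP => O oO.
by apply/adj_openP; split; [exact: cb|exact: ct].
Qed.

Hypothesis clA : closed A.
Hypothesis cth : {within A, continuous h}.

Lemma adj_target_closed (F : set K) : closed F -> closed (adj_target @` F).
Proof.
move=> cF; apply/adj_closedP; split.
  have -> : adj_base @^-1` (adj_target @` F) = A `&` h @^-1` F.
    apply/seteqP; split => t /=.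
      move=> [k Fk kt]; have At : A t by apply: contrapT => /adj_base_notin/(_ (esym kt)).
      by move: kt; rewrite adj_base_in// => -[<-].
    by move=> [At Ft]; exists (h t) => //; rewrite adj_base_in.
  exact: within_closed.
suff -> : adj_target @^-1` (adj_target @` F) = F by [].
by apply/seteqP; split => [k [k' Fk' [<-]]//|k Fk]; exists k.
Qed.

Hypothesis cT : compact [set: T].
Hypothesis hT : hausdorff_space T.
Hypothesis hK : hausdorff_space K.

Let adjT_open_in (O : set K) : open O -> exists2 V, open V & A `&` h @^-1` O = A `&` V.
Proof. exact: within_open. Qed.

(** Points outside [A] have neighborhoods in [T] that are separated from [A] and from each other.
    For two points of [K], neighborhoods must be thickened into [T]: their preimages under [h] are
    disjoint compact sets, and disjoint open sets around these give the room. *)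
Lemma adj_hausdorff : hausdorff_space adj.
Proof.
have sep k t : ~ A t -> exists U V, [/\ open U, open V, U (adj_target k), V (adj_base t)
  & U `&` V = set0].
  move=> nAt; have [|||U [V [oU oV AU tV UV0]]] := compact_separation hT (A := A) (B :=
    [set t]).
  - exact: subclosed_compact cT _.
  - exact: compact_set1.
  - by rewrite -subset0 => x [Ax xt]; apply: nAt; rewrite -xt.
  have VA x : V x -> ~ A x by move=> Vx /AU Ux; have : (U `&` V) x by []; rewrite UV0.
  have dis : adj_base @` V `&` (adj_base @` U `|` range adj_target) = set0.
    rewrite -subset0 => _ [[x Vx <-] []]; last first.
      by move=> [k' _ /esym]; apply: adj_base_notin; exact: VA.
    move=> [y Uy /adj_base_inj]; move=> /(_ (VA _ Vx)) yx.
    have : (U `&` V) x by split => //; rewrite -yx.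
    by rewrite UV0.
  exists (adj_base @` U `|` range adj_target), (adj_base @` V); split.
  - apply/adj_openP; split.
      suff -> : adj_base @^-1` (adj_base @` U `|` range adj_target) = U by [].
      apply/seteqP; split => [x|x Ux]; last by left; exists x.
      have [/AU//|nAx [[y Uy /(adj_base_inj nAx) <-//]|[k' _ /esym]]] := pselect (A x).
      by move=> /(adj_base_notin nAx).
    suff -> : adj_target @^-1` (adj_base @` U `|` range adj_target) = setT by exact: openT.
    by apply/seteqP; split => // k' _; right; exists k'.
  - apply/adj_openP; split.
      suff -> : adj_base @^-1` (adj_base @` V) = V by [].
      apply/seteqP; split => [x [y Vy /esym]|x Vx]; last by exists x.
      by move=> /(adj_base_inj (VA _ Vy)) ->.
    suff -> : adj_target @^-1` (adj_base @` V) = set0 by exact: open0.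
    by rewrite -subset0 => k' [x /VA/adj_base_notin]; apply.
  - by right; exists k.
  - by exists t => //; exact: tV.
  - by rewrite setIC.
rewrite open_hausdorff => -[u|k] [v|l] uv.
- have Au : ~ A (\val u) by case: u {uv} => u /= /set_mem.
  have Av : ~ A (\val v) by case: v {uv} => v /= /set_mem.
  have nuv : \val u != \val v by apply: contraNneq uv => /val_inj ->.
  move: (hT); rewrite open_hausdorff => /(_ _ _ nuv) [[U V] /=].
  rewrite !inE => -[Uu Vv] [oU oV UV0].
  have op (W : set T) : open W -> open (adj_base @` (W `&` ~` A)).
    move=> oW; apply/adj_openP; split.
      suff -> : adj_base @^-1` (adj_base @` (W `&` ~` A)) = W `&` ~` A.
        by apply: openI => //; exact: closed_openC.
      apply/seteqP; split => [x [y [Wy nAy] /esym]|x Wx]; last by exists x.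
      by move=> /(adj_base_inj nAy) ->.
    suff -> : adj_target @^-1` (adj_base @` (W `&` ~` A)) = set0 by exact: open0.
    by rewrite -subset0 => k' [x [Wx /adj_base_notin]]; apply.
  exists (adj_base @` (U `&` ~` A), adj_base @` (V `&` ~` A)) => /=.
    by rewrite !inE -!adj_base_val; split; [exists (\val u)|exists (\val v)].
  split; [exact: op|exact: op|]; apply/eqP.
  rewrite -subset0 => _ [[x [Ux nAx] <-] [y [Vy nAy] /(adj_base_inj nAx) yx]].
  have : (U `&` V) x by split => //; rewrite -yx.
    by rewrite UV0.
- have [|U [V [oU oV Ul Vu UV0]]] := sep l (\val u).
    by case: u {uv} => u /= /set_mem.
  rewrite adj_base_val in Vu.
  by exists (V, U); rewrite /= ?inE//; split => //; rewrite setIC.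
- have [|U [V [oU oV Ul Vu UV0]]] := sep k (\val v).
    by case: v {uv} => v /= /set_mem.
  rewrite adj_base_val in Vu.
  by exists (U, V); rewrite /= ?inE//; split => //.
- have kl : k != l by apply: contraNneq uv => ->.
  move: (hK); rewrite open_hausdorff => /(_ _ _ kl) [[U V] /=].
  rewrite !inE => -[Uk Vl] [oU oV UV0].
  have ck m : compact (A `&` h @^-1` [set m]).
    apply: (subclosed_compact _ cT) => //; apply: within_closed => //.
    exact: (accessible_closed_set1 (hausdorff_accessible hK)).
  have [|P [Q [oP oQ kP lQ PQ0]]] := compact_separation hT (ck k) (ck l).
    rewrite -subset0 => x [[_ xk] [_ xl]]; move: kl.
    by rewrite -xk -xl eqxx.
  (* The image of the part of [A] outside [P'] is compact and misses [m]. Removing it from [U']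
     forces the preimage of the new neighborhood into [P'], and that preimage is the trace of an
     open set of [T]. *)
  have nb (m : K) (P' : set T) (U' : set K) : open P' -> A `&` h @^-1` [set m] `<=` P' ->
      open U' -> U' m -> exists O : set adj,
      [/\ open O, O (adj_target m), adj_target @^-1` O `<=` U' & adj_base @^-1` O `<=` P'].
    move=> oP' mP oU' Um.
    have cl : closed (h @` (A `&` ~` P')).
      apply: compact_closed => //; apply: (@continuous_compact T).
        apply: continuous_subspaceW cth; exact: subIsetl.
      apply: (subclosed_compact _ cT) => //.
      by apply: closedI => //; exact: open_closedC.
    pose U'' := U' `&` ~` (h @` (A `&` ~` P')).
    have oU'' : open U'' by apply: openI => //; exact: closed_openC.
    have [V' oV' hV'] := adjT_open_in oU''.
    exists (adj_target @` U'' `|` adj_base @` (V' `&` P' `&` ~` A)); split.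
    + apply/adj_openP; split.
        suff -> : adj_base @^-1` (adj_target @` U'' `|` adj_base @` (V' `&` P' `&` ~` A))
          = V' `&` P'.
          exact: openI.
        apply/seteqP; split => x.
          move=> [[k' Uk' kx]|[y [[Vy Py] nAy] /esym/(adj_base_inj nAy) ->//]].
            have Ax : A x by apply: contrapT => /adj_base_notin/(_ (esym kx)).
            move: kx; rewrite adj_base_in// => -[kh].
            have : (A `&` h @^-1` U'') x by split => //=; rewrite -kh.
            rewrite hV' => -[_ Vx]; split => //; apply: contrapT => nPx.
            by case: Uk' => _; apply; exists x.
        move=> [Vx Px]; have [Ax|nAx] := pselect (A x); last by right; exists x.
        left; exists (h x); last by rewrite adj_base_in.
        by have : (A `&` V') x by []; rewrite -hV' => -[].
      suff -> : adj_target @^-1` (adj_target @` U'' `|` adj_base @` (V' `&` P' `&` ~` A))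
        = U'' by [].
      apply/seteqP; split => [k' [[k'' ? [<-]]//|[x [_ /adj_base_notin/[apply]//]]]|k' ?].
      by left; exists k'.
    + left; exists m => //; split => // -[x [Ax nPx] xm]; apply: nPx; exact: mP.
    + by move=> k' [[k'' [? _] [<-]]//|[x [_ /adj_base_notin/[apply]]]].
    + move=> x [[k' Uk' kx]|[y [[Vy Py] nAy] /esym/(adj_base_inj nAy) ->//]].
      have Ax : A x by apply: contrapT => /adj_base_notin/(_ (esym kx)).
      move: kx; rewrite adj_base_in// => -[kh]; apply: contrapT => nPx.
      by case: Uk' => _; apply; exists x.
  have [N1 [oN1 O1k O1U O1P]] := nb k P U oP kP oU Uk.
  have [N2 [oN2 O2l O2V O2Q]] := nb l Q V oQ lQ oV Vl.
  exists (N1, N2); rewrite /= ?inE//; split => //.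
  rewrite -subset0 => -[x|m] [xO1 xO2].
    rewrite -adj_base_val in xO1 xO2.
    have : (P `&` Q) (\val x) by split; [exact: O1P|exact: O2Q].
    by rewrite PQ0.
  have : (U `&` V) m by split; [exact: O1U|exact: O2V].
  by rewrite UV0.
Qed.

End Adjunction.

Lemma pconst_closed (X M : topologicalType) (F : set X) (c : M) :
  hausdorff_space M -> closed ((fun=> c) @` F).
Proof.
move=> hM; have [->|/set0P[x Fx]] := eqVneq F set0; first by rewrite image_set0;
  exact: closed0.
suff -> : (fun=> c) @` F = [set c].
  exact: (accessible_closed_set1 (hausdorff_accessible hM)).
by apply/seteqP; split => [_ [y _ <-]//|_ ->]; exists x.
Qed.

Section AdjunctionPerfect.
Context (R : realType) (T K : topologicalType) (A : set T) (h : T -> K).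
Hypotheses (clA : closed A) (cth : {within A, continuous h}).
Hypotheses (cT : compact [set: T]) (hT : hausdorff_space T) (A0 : A !=set0).

(** Collapse in [M] the compact set q(h(A)) and send all of [T] to the resulting point. This map
    extends [q] and is perfect: the special fibre is the image of the compact [T] together with the
    preimage of a compact set, and the others are fibres of [q]. *)
Lemma adj_p_paracompact : p_paracompact R K -> p_paracompact R (adjunction A h).
Proof.
move=> [hK [M [q pq]]]; have [cq sq clq fq] := pq.
split; first exact: adj_hausdorff.
have [a0 Aa0] := A0.
pose C := q @` (h @` A).
have cC : compact C.
  apply: continuous_compact; first by apply: continuous_subspaceT.
  by apply: continuous_compact => //; exact: subclosed_compact cT _.
have Cc0 : C (q (h a0)) by exists (h a0) => //; exists a0.
pose M' := collapse cC Cc0; pose pr := collapse_proj cC Cc0.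
pose pt := collapse_pt cC Cc0.
pose Q (z : adjunction A h) : M' := match z with inl _ => pt | inr k => pr (q k) end.
have hM' : hausdorff_space M' by exact: metric_hausdorff.
have QbE t : Q (adj_base A h t) = pt.
  rewrite /adj_base; case: pselect => //= At; apply: collapse_proj_in.
  by exists (h t) => //; exists t.
exists M', Q; split.
- apply: adj_continuous.
    suff -> : Q \o adj_base A h = fun=> pt by move=> t; exact: cvg_cst.
    by apply/funext => t; exact: QbE.
  move=> k; apply: (@continuous_comp _ _ _ q pr); first exact: cq.
  exact: collapse_proj_continuous.
- move=> a _; have [m -> _] := collapse_projP a.
  by have [k _ <-] := sq m I; exists (inr k).
- move=> F /adj_closedP[cFb cFt].
  suff -> : Q @` F = (fun=> pt) @` (adj_base A h @^-1` F) `|`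
      pr @` (q @` (@adj_target T K A h @^-1` F)).
    apply: closedU; first exact: pconst_closed.
    by apply: collapse_proj_closed; exact: clq.
  apply/seteqP; split => a.
    move=> [[u|k] Fz <-]; last by right; exists (q k) => //; exists k.
    by left; exists (\val u) => //=; rewrite adj_base_val.
  move=> [[t Ft <-]|[_ [k Fk <-] <-]]; last by exists (inr k).
  by exists (adj_base A h t) => //; exact: QbE.
- move=> a; have [m -> _] := collapse_projP a.
  have [Cm|nCm] := pselect (C m).
    have -> : collapse_proj cC Cc0 m = pt by exact: collapse_proj_in.
    have <- : adj_base A h @` setT `|` @adj_target T K A h @` (q @^-1` C) = Q @^-1` [set pt].
      apply/seteqP; split => [_ [[t _ <-]|[k Ck <-]]|]; first exact: QbE.
        exact: collapse_proj_in.
      move=> [u _|k Qk]; first by left; exists (\val u) => //; rewrite adj_base_val.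
      right; exists k => //; apply: contrapT => nCk.
      by apply: (nCk); rewrite /= -(collapse_proj_eq nCk (esym Qk)).
    apply: compactU; apply: continuous_compact.
    + by apply: continuous_subspaceT; exact: adj_base_continuous.
    + exact: cT.
    + by apply: continuous_subspaceT; exact: adj_target_continuous.
    + exact: perfect_preimage_compact.
  have -> : Q @^-1` [set collapse_proj cC Cc0 m] = @adj_target T K A h @` (q @^-1` [set m]).
    apply/seteqP; split => [[u /= /(collapse_proj_eq nCm) um|k Qk]|_ [k <- <-]//].
      by case: nCm; rewrite -um.
    by exists k => //; exact: collapse_proj_eq Qk.
  apply: continuous_compact; last exact: fq.
  by apply: continuous_subspaceT; exact: adj_target_continuous.
Qed.

End AdjunctionPerfect.

(** * Neighborhood extension of equivariant maps *)

Section NeighborhoodExtension.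
Context (R : realType) (G : finGroupType) (T K : gspace G) (A : set T) (h : T -> K).
Hypotheses (clA : closed A) (cth : {within A, continuous h}).
Hypotheses (cT : compact [set: T]) (hT : hausdorff_space T) (A0 : A !=set0).
Hypothesis invA : forall g t, A t -> A (gact g t).
Hypothesis eqvh : forall g t, A t -> h (gact g t) = gact g (h t).
Hypothesis anrK : is_GANR R K.

Let b := adj_base A h.

Let act (g : G) (z : adjunction A h) : adjunction A h :=
  match z with inl u => b (gact g (\val u)) | inr k => inr (gact g k) end.

Let actE g t : act g (b t) = b (gact g t).
Proof.
have [At|nAt] := pselect (A t).
  by rewrite /b !adj_base_in//=; [rewrite eqvh|exact: invA].
rewrite {1}/b /adj_base; case: pselect => //.
Qed.

Let act1 z : act 1%g z = z.
Proof. by case: z => [u|k] /=; rewrite gact1// /b adj_base_val. Qed.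

Let actM g g' z : act (g * g')%g z = act g (act g' z).
Proof. by case: z => [u|k] /=; rewrite ?actE gactM. Qed.

Let act_continuous :
  continuous (fun p : discrete_topology G * adjunction A h => act p.1 p.2).
Proof.
apply: discrete_act_continuous => g; apply: adj_continuous.
  rewrite (_ : _ \o _ = b \o gact g); last by apply/funext => t; exact: actE.
  move=> t; apply: continuous_comp; first exact: gact_continuous1.
  exact: adj_base_continuous.
move=> k; apply: (@continuous_comp _ _ _ (gact g) (@adj_target T K A h)).
  exact: gact_continuous1.
exact: adj_target_continuous.
Qed.

Let Z : gspace G := GSpace act1 actM act_continuous.

(** [K] is closed and invariant in the adjunction space [Z], so some invariant neighborhood retracts
    onto it. Composing this retraction with the map from [T] to [Z] extends [h], because that map is
    [h] on [A]. *)
Lemma neighborhood_extension : exists (U : set T) (r : T -> K),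
  [/\ open U, A `<=` U,
      forall t, U t -> {for t, continuous r},
      forall g t, U t -> r (gact g t) = gact g (r t)
    & forall t, A t -> r t = h t].
Proof.
have [pK extK] := anrK; have [hK _] := pK; have [a0 Aa0] := A0.
pose i : gmap K Z := @GMap G K Z (@adj_target T K A h)
  (@adj_target_continuous T K A h) (fun _ _ => erefl).
have [||U [r [iU invU cr eqr ri]]] := extK Z i.
- exact: adj_p_paracompact.
- by split; [move=> k l []|exact: adj_target_closed].
(* The value [h a0] is a default outside [U]; continuity is claimed only on the interior of [U]. *)
pose g (z : Z) : K := if pselect (U z) is left p then r (exist (fun z => z \in U) z
  (mem_set p)) else h a0.
have gE (u : set_type U) : g (\val u) = r u.
  case: u => u uU; rewrite /g /=; case: pselect => [p|].
    by congr r; apply: val_inj.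
  by move/set_mem: (uU).
have cg z : interior U z -> {for z, continuous g}.
  have : {within U, continuous g}.
    apply/subspace_sigL_continuousP; rewrite (_ : sigL U g = r) //.
    by apply/funext => u; exact: gE.
  move=> /(continuous_subspaceW (@interior_subset _ U)).
  rewrite continuous_open_subspace; last exact: open_interior.
  by move=> + Uz; apply; exact: mem_set.
have geq k z : U z -> g (gact k z) = gact k (g z).
  move=> Uz; have Uk := invU k z Uz.
  have := gE (exist (fun z => z \in U) _ (mem_set Uz)).
  have := gE (exist (fun z => z \in U) _ (mem_set Uk)) => /= -> ->.
  by apply: eqr.
exists (b @^-1` interior U), (g \o b); split.
- apply: open_comp; last exact: open_interior.
  by move=> *; exact: adj_base_continuous.
- by move=> t At /=; rewrite /b adj_base_in//; apply: iU; exists (h t).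
- move=> t Ut; apply: continuous_comp; first exact: adj_base_continuous.
  exact: cg.
- move=> k t Ut /=; rewrite -actE; apply: (geq k).
  exact: interior_subset.
- move=> t At /=; rewrite /b adj_base_in//.
  have Uh : U (adj_target A h (h t)).
    by apply: interior_subset; apply: iU; exists (h t).
  have := gE (exist (fun z => z \in U) _ (mem_set Uh)) => /= ->.
  exact: ri.
Qed.

End NeighborhoodExtension.

(** * Intervals, products and compact embeddings *)

Section Interval.
Context (R : realType) (a b : R) (ab : a <= b).

Lemma clamp_subproof (r : R) : Num.max a (Num.min b r) \in [set` `[a, b]].
Proof.
by rewrite inE /= in_itv /= le_max lexx /= ge_max ab ge_min lexx.
Qed.

Definition clamp (r : R) : cinterval a b :=
  exist (fun r => r \in [set` `[a, b]]) _ (clamp_subproof r).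

Lemma clamp_continuous : continuous clamp.
Proof.
apply: continuous_comp_initial => r.
apply: (@continuous_max R R (fun=> a) (fun r => Num.min b r)); first exact: cvg_cst.
by apply: (@continuous_min R R (fun=> b) id); [exact: cvg_cst|exact: cvg_id].
Qed.

Lemma val_clamp r : a <= r <= b -> \val (clamp r) = r.
Proof.
by move=> /andP[ar rb] /=; rewrite (min_idPr rb) (max_idPr ar).
Qed.

Lemma cinterval_val_continuous : continuous (\val : cinterval a b -> R).
Proof. exact: initial_continuous. Qed.

Lemma cinterval_bounds (t : cinterval a b) : a <= \val t <= b.
Proof. by case: t => t /= /set_mem; rewrite /= in_itv. Qed.

Lemma clampK (t : cinterval a b) : clamp (\val t) = t.
Proof. by apply: val_inj; exact/val_clamp/cinterval_bounds. Qed.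

Lemma cinterval_compact : compact [set: cinterval a b].
Proof.
have -> : [set: cinterval a b] = clamp @` `[a, b].
  apply/seteqP; split => // t _; exists (\val t); last exact: clampK.
  by rewrite /= in_itv /= cinterval_bounds.
apply: continuous_compact; last exact: segment_compact.
by apply: continuous_subspaceT; exact: clamp_continuous.
Qed.

Lemma cinterval_hausdorff : hausdorff_space (cinterval a b).
Proof.
move=> s t st; apply: val_inj; apply: (@Rhausdorff R) => A B nA nB.
have [z [Az Bz]] := st _ _ (@cinterval_val_continuous s _ nA)
  (@cinterval_val_continuous t _ nB).
by exists (\val z).
Qed.

End Interval.

Lemma initial_hausdorff (X Y : topologicalType) (f : X -> Y) :
  hausdorff_space Y -> continuous f -> injective f -> hausdorff_space X.
Proof.
move=> hY cf fI x y xy; apply: fI; apply: hY => A B nA nB.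
have [z [Az Bz]] := xy _ _ (cf x _ nA) (cf y _ nB).
by exists (f z).
Qed.

Lemma prod_hausdorff (X Y : topologicalType) :
  hausdorff_space X -> hausdorff_space Y -> hausdorff_space (X * Y)%type.
Proof.
move=> hX hY [x y] [x' y'] xy; congr (_, _).
  apply: hX => A B nA nB.
  have [||z [Az Bz]] := xy (fst @^-1` A) (fst @^-1` B).
  - exact: (@cvg_fst X Y (nbhs x) (nbhs y) _ A nA).
  - exact: (@cvg_fst X Y (nbhs x') (nbhs y') _ B nB).
  by exists z.1.
apply: hY => A B nA nB.
have [||z [Az Bz]] := xy (snd @^-1` A) (snd @^-1` B).
- exact: (@cvg_snd X Y (nbhs x) (nbhs y) _ A nA).
- exact: (@cvg_snd X Y (nbhs x') (nbhs y') _ B nB).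
by exists z.2.
Qed.

Lemma fst_continuous (X Y : topologicalType) : continuous (@fst X Y).
Proof. by move=> [x y]; exact: cvg_fst. Qed.

Lemma snd_continuous (X Y : topologicalType) : continuous (@snd X Y).
Proof. by move=> [x y]; exact: cvg_snd. Qed.

Lemma pair_continuous (X Y Z : topologicalType) (f : X -> Y) (g : X -> Z) :
  continuous f -> continuous g -> continuous (fun x => (f x, g x)).
Proof. by move=> cf cg x; apply: cvg_pair; [exact: cf|exact: cg]. Qed.

Lemma comp_continuous (X Y Z : topologicalType) (f : X -> Y) (g : Y -> Z) :
  continuous f -> continuous g -> continuous (fun x => g (f x)).
Proof. by move=> cf cg x; apply: (@continuous_comp _ _ _ f g); [exact: cf|exact: cg]. Qed.

Lemma prod_topology_continuous (X : topologicalType) (I : Type)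
    (K : I -> topologicalType) (f : X -> prod_topology K) :
  (forall i, continuous (fun x => f x i)) -> continuous f.
Proof.
move=> cf x; apply/(cvg_sup _ _ (fmap_filter _ (nbhs_filter x))) => i.
have ci : continuous (f : X -> initial_topology (fun y : prod_topology K => y i)).
  by apply: continuous_comp_initial; exact: cf.
exact: ci.
Qed.

Lemma within_comp (X Y Z : topologicalType) (A : set X) (B : set Y)
    (f : X -> Y) (g : Y -> Z) :
  {within A, continuous f} -> {within B, continuous g} ->
  (forall x, A x -> B (f x)) -> {within A, continuous (fun x => g (f x))}.
Proof.
move=> /subspace_sigL_continuousP cf /subspace_sigL_continuousP cg AB.
apply/subspace_sigL_continuousP.
have fB (u : set_type A) : f (\val u) \in B.
  by apply/mem_set/AB; case: u => u /= /set_mem.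
pose f' (u : set_type A) : set_type B := exist (fun y => y \in B) _ (fB u).
have cf' : continuous f' by apply: continuous_comp_initial; exact: cf.
have -> : sigL A (fun x => g (f x)) = sigL B g \o f' by [].
by move=> u; apply: continuous_comp; [exact: cf'|exact: cg].
Qed.

Lemma nested_compact (T : topologicalType) (N : nat -> set T) (U : set T) :
  compact [set: T] -> (forall n, closed (N n)) ->
  (forall m n, (m <= n)%N -> N n `<=` N m) -> open U ->
  \bigcap_n N n `<=` U -> exists n, N n `<=` U.
Proof.
move=> /compact_near_coveringP cT cN dN oU NU.
have [|n _ nU] := cT _ \oo (fun n t => N n t -> U t) _.
  move=> t _; have [Ut|nUt] := pselect (U t).
    exists (U, setT) => /=; last by move=> [t' n] /= [].
    by split; [exact: open_nbhs_nbhs|exact: filterT].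
  have [n nNt] : exists n, ~ N n t.
    by apply: contrapT => h; apply/nUt/NU => n _; apply: contrapT => ?; apply: h; exists n.
  exists (~` N n, [set m | (n <= m)%N]) => /=.
    split; last by exists n.
    by apply: open_nbhs_nbhs; split => //; exact: closed_openC.
  by move=> [t' m] /= [nN nm] /(dN _ _ nm).
by exists n => t Nt; apply: (nU n) => //=.
Qed.

(** [s] is only a set-theoretic left inverse of [e], but on the range of [e] it is continuous since
    [e] is a closed map. *)
Lemma compact_embedding_within (X T Z : topologicalType) (e : X -> T) (h : X -> Z) (s : T
  -> X) :
  compact [set: X] -> hausdorff_space T -> continuous e -> cancel e s ->
  continuous h -> {within range e, continuous (h \o s)}.
Proof.
move=> cX hT ce es ch; apply/continuous_closedP => F cF.
apply/closed_subspaceP; exists (e @` (h @^-1` F)).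
  apply: compact_closed => //; apply: continuous_compact.
    exact: continuous_subspaceT.
  apply: (subclosed_compact _ cX) => //.
  by apply: preimage_closed => // x _; exact: ch.
apply/seteqP; split => t.
  move=> [[x Fx <-] _]; split; last by exists x.
  by change (F (h (s (e x)))); rewrite es.
move=> [Ft [x _ xt]]; have {Ft} : F (h (s t)) by [].
by rewrite -xt es => Fx; split; exists x.
Qed.

(** This allows maps into the suspension to be given by formulas in a vector space. *)
Lemma compact_embedding_lift (D X T : topologicalType) (e : X -> T) (g : D -> X) :
  compact [set: X] -> hausdorff_space T -> continuous e -> injective e ->
  continuous (e \o g) -> continuous g.
Proof.
move=> cX hT ce eI cg; have [D0|/set0P[d _]] := eqVneq [set: D] set0.
  by move=> x; have : [set: D] x by []; rewrite D0.
pose s t := xget (g d) [set x | e x = t].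
have es : cancel e s by move=> x; apply: eI;
  exact: (@xgetPex _ _ [set y | e y = e x] (ex_intro _ x erefl)).
have := @compact_embedding_within _ _ _ e id s cX hT ce es (fun x => cvg_id).
move=> cs; apply/continuous_subspace_setT.
have -> : g = (fun x => (id \o s) ((e \o g) x)) by apply/funext => x /=; rewrite es.
by apply: (within_comp _ cs) => [|x _]; [exact: continuous_subspaceT|exists (g x)].
Qed.

Section RealContinuity.
Context (R : realType) (X : topologicalType).
Implicit Types f g : X -> R.

Lemma continuous_cst (Y : topologicalType) (c : Y) : continuous (fun _ : X => c).
Proof. by move=> x; exact: cvg_cst. Qed.

Lemma continuous_addr f g :
  continuous f -> continuous g -> continuous (fun x => f x + g x).
Proof. by move=> cf cg x; apply: (@cvgD _ R^o); [exact: cf|exact: cg]. Qed.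

Lemma continuous_oppr f : continuous f -> continuous (fun x => - f x).
Proof. by move=> cf x; apply: (@cvgN _ R^o); exact: cf. Qed.

Lemma continuous_subr f g :
  continuous f -> continuous g -> continuous (fun x => f x - g x).
Proof. by move=> cf cg x; apply: (@cvgB _ R^o); [exact: cf|exact: cg]. Qed.

Lemma continuous_mulr f g :
  continuous f -> continuous g -> continuous (fun x => f x * g x).
Proof. by move=> cf cg x; apply: cvgM; [exact: cf|exact: cg]. Qed.

Lemma continuous_normr f : continuous f -> continuous (fun x => `|f x|).
Proof. by move=> cf x; apply: (@cvg_norm _ R^o); exact: cf. Qed.

Lemma continuous_maxr f g :
  continuous f -> continuous g -> continuous (fun x => Num.max (f x) (g x)).
Proof. by move=> cf cg x; apply: continuous_max; [exact: cf|exact: cg]. Qed.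

Lemma continuous_minr f g :
  continuous f -> continuous g -> continuous (fun x => Num.min (f x) (g x)).
Proof. by move=> cf cg x; apply: continuous_min; [exact: cf|exact: cg]. Qed.

Lemma continuous_sqrtr f : continuous f -> continuous (fun x => Num.sqrt (f x)).
Proof. by move=> cf x; apply: continuous_comp; [exact: cf|exact: sqrt_continuous]. Qed.

End RealContinuity.

(** * Equivariant homotopies and towers *)

Section Homotopy.
Context (R : realType) (G : finGroupType).
Implicit Types X Y Z : gspace G.
Local Notation I01 := (cinterval (0 : R) 1).
Local Notation homotopic := (@ghomotopic R G _ _).

Let I01_continuous (f : R -> R) : continuous f ->
  continuous (fun t : I01 => clamp (ler01 : 0 <= 1 :> R) (f (\val t))).
Proof.
move=> cf; apply: (comp_continuous (f := fun t : I01 => f (\val t))).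
  by apply: comp_continuous cf; exact: cinterval_val_continuous.
exact: clamp_continuous.
Qed.

Lemma ghomotopic_ext X Y (f h : gmap X Y) : f =1 h -> homotopic f h.
Proof.
move=> fh; exists (fun p => f p.1); split => //.
- exact: (comp_continuous (@fst_continuous _ _) (@gmap_continuous _ _ _ _)).
- by move=> g x t /=; exact: gmap_equivariant.
Qed.

Lemma ghomotopic_refl X Y (f : gmap X Y) : homotopic f f.
Proof. exact: ghomotopic_ext. Qed.

Lemma ghomotopic_sym X Y (f h : gmap X Y) : homotopic f h -> homotopic h f.
Proof.
move=> [H [cH eH H0 H1]].
exists (fun p => H (p.1, clamp ler01 (1 - \val p.2))); split.
- apply: comp_continuous cH; apply: pair_continuous; first exact: fst_continuous.
  apply: (comp_continuous (g := fun t : I01 => clamp ler01 (1 - \val t))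
    (@snd_continuous X I01)).
  apply: (@I01_continuous (fun r => 1 - r)).
  by apply: continuous_subr; [exact: continuous_cst|move=> r; exact: cvg_id].
- by move=> g x t; exact: eH.
- by move=> x t t0; apply: H1; rewrite val_clamp /= ?t0 ?subr0// lexx ler01.
- by move=> x t t1; apply: H0; rewrite val_clamp /= ?t1 ?subrr// lexx ler01.
Qed.

Lemma ghomotopic_trans X Y (f h k : gmap X Y) :
  homotopic f h -> homotopic h k -> homotopic f k.
Proof.
move=> [H [cH eH H0 H1]] [H' [cH' eH' H0' H1']].
pose A := [set p : X * I01 | \val p.2 <= 1/2]; pose B := [set p : X * I01 | 1/2 <= \val p.2].
pose a (t : I01) := clamp (ler01 : 0 <= 1 :> R) (2 * \val t).
pose b (t : I01) := clamp (ler01 : 0 <= 1 :> R) (2 * \val t - 1).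
have ca : continuous a.
  apply: (@I01_continuous (fun r => 2 * r)).
  by apply: continuous_mulr; [exact: continuous_cst|move=> r; exact: cvg_id].
have cb : continuous b.
  apply: (@I01_continuous (fun r => 2 * r - 1)).
  apply: continuous_subr; last exact: continuous_cst.
  by apply: continuous_mulr; [exact: continuous_cst|move=> r; exact: cvg_id].
have cval : continuous (fun p : X * I01 => \val p.2).
  exact: (comp_continuous (@snd_continuous X I01) (@cinterval_val_continuous R 0 1)).
pose K (p : X * I01) := if \val p.2 <= 1/2 then H (p.1, a p.2) else H' (p.1, b p.2).
exists K; split.
- apply/continuous_subspace_setT.
  have -> : [set: X * I01] = A `|` B.
    by apply/seteqP; split => // p _; case: (leP (\val p.2) (1/2)) => ?; [left|right;
      exact: ltW].
  apply: withinU_continuous.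
  + by apply: (@preimage_closed _ _ (fun p : X * I01 => \val p.2) [set x | x <= 1/2]) =>
    [p _|]; [exact: cval|exact: closed_le].
  + by apply: (@preimage_closed _ _ (fun p : X * I01 => \val p.2) [set x | 1/2 <= x]) =>
    [p _|]; [exact: cval|exact: closed_ge].
  + apply: (subspace_eq_continuous (f := fun p => H (p.1, a p.2))).
      by move=> p /set_mem Ap; rewrite /from_subspace /K Ap.
    apply: continuous_subspaceT; apply: comp_continuous cH.
    apply: pair_continuous; first exact: fst_continuous.
    exact: (comp_continuous (@snd_continuous X I01) ca).
  + apply: (subspace_eq_continuous (f := fun p => H' (p.1, b p.2))).
      move=> p /set_mem Bp; rewrite /from_subspace /K; case: ifP => // Ap.
      have t12 : \val p.2 = 1/2 by apply/eqP; rewrite eq_le Ap.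
      rewrite (H0' p.1) ?(H1 p.1)//.
        by rewrite /b val_clamp t12; lra.
      by rewrite /a val_clamp t12; lra.
    apply: continuous_subspaceT; apply: comp_continuous cH'.
    apply: pair_continuous; first exact: fst_continuous.
    exact: (comp_continuous (@snd_continuous X I01) cb).
- by move=> g x t; rewrite /K /=; case: ifP => _; [exact: eH|exact: eH'].
- move=> x t t0; rewrite /K /= t0 ifT; last by lra.
  by apply: H0; rewrite val_clamp t0; lra.
- move=> x t t1; rewrite /K /= t1 ifF; last by apply/negbTE; lra.
  by apply: H1'; rewrite val_clamp t1; lra.
Qed.

Lemma ghomotopic_compl X Y Z (k : gmap Y Z) (f h : gmap X Y) :
  homotopic f h -> homotopic (k \og f) (k \og h).
Proof.
move=> [H [cH eH H0 H1]]; exists (fun p => k (H p)); split.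
- by apply: comp_continuous cH _; exact: gmap_continuous.
- by move=> g x t; rewrite eH gmap_equivariant.
- by move=> x t t0 /=; rewrite H0.
- by move=> x t t1 /=; rewrite H1.
Qed.

Lemma ghomotopic_compr X Y Z (k : gmap X Y) (f h : gmap Y Z) :
  homotopic f h -> homotopic (f \og k) (h \og k).
Proof.
move=> [H [cH eH H0 H1]]; exists (fun p => H (k p.1, p.2)); split.
- apply: comp_continuous cH; apply: pair_continuous; last exact: snd_continuous.
  exact: (comp_continuous (@fst_continuous _ _) (@gmap_continuous _ _ _ _)).
- by move=> g x t /=; rewrite gmap_equivariant eH.
- by move=> x t t0 /=; rewrite H0.
- by move=> x t t1 /=; rewrite H1.
Qed.

Lemma gmap_iter_continuous Y (F : gmap Y Y) n : continuous (iter n F).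
Proof.
elim: n => [x|n IH]; first exact: cvg_id.
by apply: (comp_continuous IH); exact: gmap_continuous.
Qed.

Lemma gmap_iter_equivariant Y (F : gmap Y Y) n g y :
  iter n F (gact g y) = gact g (iter n F y).
Proof. by elim: n => //= n ->; exact: gmap_equivariant. Qed.

Definition gmap_iter Y (F : gmap Y Y) n : gmap Y Y :=
  GMap (@gmap_iter_continuous Y F n) (@gmap_iter_equivariant Y F n).

End Homotopy.

Section ProductSpaces.
Context (R : realType) (G : finGroupType).

Section Power.
Context (Q : gspace G).
Local Notation T := (prod_topology (fun _ : nat => gcarrier Q)).

Definition gpower_act (g : G) (v : T) : T := fun n => gact g (v n).

Lemma gpower_act1 v : gpower_act 1%g v = v.
Proof. by apply/funext => n; exact: gact1. Qed.

Lemma gpower_actM g h v : gpower_act (g * h)%g v = gpower_act g (gpower_act h v).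
Proof. by apply/funext => n; exact: gactM. Qed.

Lemma gpower_act_continuous :
  continuous (fun p : discrete_topology G * T => gpower_act p.1 p.2).
Proof.
apply: discrete_act_continuous => g; apply: prod_topology_continuous => n.
apply: (comp_continuous (f := fun v : T => v n)); last exact: gact_continuous1.
exact: (@proj_continuous _ (fun _ : nat => gcarrier Q) n).
Qed.

Definition gpower : gspace G := GSpace gpower_act1 gpower_actM gpower_act_continuous.

End Power.

Section Cylinder.
Context (X : gspace G).
Local Notation T := (X * cinterval (0 : R) 1)%type.

Definition gcyl_act (g : G) (p : T) : T := (gact g p.1, p.2).

Lemma gcyl_act1 p : gcyl_act 1%g p = p.
Proof. by case: p => x t; rewrite /gcyl_act gact1. Qed.

Lemma gcyl_actM g h p : gcyl_act (g * h)%g p = gcyl_act g (gcyl_act h p).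
Proof. by rewrite /gcyl_act gactM. Qed.

Lemma gcyl_act_continuous :
  continuous (fun p : discrete_topology G * T => gcyl_act p.1 p.2).
Proof.
apply: discrete_act_continuous => g; apply: pair_continuous; last exact: snd_continuous.
exact: (comp_continuous (@fst_continuous _ _) (@gact_continuous1 G X g)).
Qed.

Definition gcyl : gspace G := GSpace gcyl_act1 gcyl_actM gcyl_act_continuous.

End Cylinder.
End ProductSpaces.

(** * Maps from the limit of an iterated map *)

Section Tower.
Context (R : realType) (G : finGroupType) (X Y Q : gspace G).
Context (F : gmap Y Y) (p : nat -> gmap X Y) (e : gmap Y Q).
Context (c : Q * cinterval (0 : R) 1 -> Q) (q0 : Q).
Local Notation I01 := (cinterval (0 : R) 1).
Hypotheses (cY : compact [set: Y]) (cQ : compact [set: Q]) (hQ : hausdorff_space Q).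
Hypothesis eI : injective e.
Hypotheses (pF : forall n x, F (p n.+1 x) = p n x)
  (pI : forall x x', (forall n, p n x = p n x') -> x = x')
  (pS : forall y : nat -> Y, (forall n, F (y n.+1) = y n) ->
    exists x, forall n, p n x = y n).
Hypotheses (cX : compact [set: X]) (X0 : [set: X] !=set0).
Hypotheses (cc : continuous c)
  (c0 : forall q t, \val t = 0 -> c (q, t) = q)
  (c1 : forall q t, \val t = 1 -> c (q, t) = q0)
  (ceq : forall g q t, c (gact g q, t) = gact g (c (q, t))).

Let T := gpower Q.

Let i0 : I01 := clamp ler01 0.
Let i1 : I01 := clamp ler01 1.
Let val_i0 : \val i0 = 0. Proof. by rewrite val_clamp// lexx ler01. Qed.
Let val_i1 : \val i1 = 1. Proof. by rewrite val_clamp// lexx ler01. Qed.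

Let q0_fixed g : gact g q0 = q0.
Proof. by rewrite -(c1 q0 val_i1) -ceq !c1. Qed.

Let cT : compact [set: T].
Proof.
rewrite (_ : [set: T] = [set v : T | forall n, [set: Q] (v n)]); last first.
  by apply/seteqP; split.
exact: (@tychonoff nat (fun=> gcarrier Q) (fun=> setT) (fun=> cQ)).
Qed.

Let hT : hausdorff_space T.
Proof. exact: (@hausdorff_product nat (fun=> gcarrier Q) (fun=> hQ)). Qed.

Let emb (x : X) : T := fun n => e (p n x).

Let emb_continuous : continuous emb.
Proof.
apply: prod_topology_continuous => n.
by apply: comp_continuous; exact: gmap_continuous.
Qed.

Let embI : injective emb.
Proof. by move=> x x' xx'; apply: pI => n; apply: eI; rewrite -/(emb x n) xx'. Qed.

(* X is the decreasing intersection of these closed subsets of T. *)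
Let N n : set T := [set v | forall i, (i < n)%N ->
  exists y, v i.+1 = e y /\ v i = e (F y)].

Let N_closed n : closed (N n).
Proof.
have -> : N n = \bigcap_(i in `I_n) [set v | exists y, v i.+1 = e y /\ v i = e (F y)].
  by apply/seteqP; split => v Nv i; exact: Nv.
apply: closed_bigI => i _.
have -> : [set v : T | exists y, v i.+1 = e y /\ v i = e (F y)] =
    (fun v : T => (v i.+1, v i)) @^-1` range (fun y => (e y, e (F y))).
  apply/seteqP; split => v.
    by move=> [y [vy vFy]]; exists y; rewrite // vy vFy.
  by move=> [y _ [vy vFy]]; exists y.
apply: preimage_closed => [v _|].
  have cpr j : continuous (fun v : T => v j).
    exact: (@proj_continuous _ (fun _ : nat => gcarrier Q) j).
  exact: (pair_continuous (cpr i.+1) (cpr i)).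
apply: compact_closed; first exact: prod_hausdorff.
apply: continuous_compact; last exact: cY.
apply: continuous_subspaceT; apply: pair_continuous; first exact: gmap_continuous.
by apply: comp_continuous; exact: gmap_continuous.
Qed.

Let N_decr m n : (m <= n)%N -> N n `<=` N m.
Proof. by move=> mn v Nv i im; apply: Nv; exact: leq_trans mn. Qed.

Let N_bigcap : \bigcap_n N n `<=` range emb.
Proof.
move=> v Nv; have /choice[y Hy] : forall i, exists y, v i.+1 = e y /\ v i = e (F y).
  by move=> i; exact: (Nv i.+1 I i).
have yF n : F (y n.+1) = y n by apply: eI; rewrite -(Hy n.+1).2 (Hy n).1.
have [x xE] := pS (y := fun n => F (y n)) (fun n => congr1 F (yF n)).
by exists x => //; apply/funext => n; rewrite /emb xE (Hy n).2.
Qed.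

(** Coordinates beyond [n] are filled with the fixed point [q0]. As [N n] constrains only the
    coordinates up to [n], this maps [Y] equivariantly into an arbitrarily small neighborhood of the
    limit. *)
Let stage n (y : Y) : T := fun i => if (i <= n)%N then e (iter (n - i) F y) else q0.

Let stage_continuous n : continuous (stage n).
Proof.
apply: prod_topology_continuous => i; rewrite /stage; case: (i <= n)%N.
  apply: (comp_continuous (f := gmap_iter F (n - i))); exact: gmap_continuous.
exact: continuous_cst.
Qed.

Let stage_N n y : N n (stage n y).
Proof.
move=> i i_n; rewrite /stage i_n (ltnW i_n); exists (iter (n - i.+1) F y).
by rewrite -iterS subnSK.
Qed.

Let stage_equivariant n g y : stage n (gact g y) = gact g (stage n y).
Proof.
apply/funext => i; rewrite /stage /= /gpower_act; case: (i <= n)%N.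
  by rewrite gmap_iter_equivariant gmap_equivariant.
by rewrite q0_fixed.
Qed.

Let p_iter n i x : (i <= n)%N -> iter (n - i) F (p n x) = p i x.
Proof.
move=> i_n; rewrite -[in p n](subnK i_n).
by elim: (n - i)%N => // k IH; rewrite iterSr addSn pF.
Qed.

Let emb_inv (v : T) : X := xget (sval (cid X0)) [set x | emb x = v].
Let e_inv (q : Q) : Y := xget (p 0 (sval (cid X0))) [set y | e y = q].

Let embK : cancel emb emb_inv.
Proof.
move=> x; apply: embI.
exact: (@xgetPex _ _ [set y | emb y = emb x] (ex_intro _ x erefl)).
Qed.

Let eK : cancel e e_inv.
Proof.
move=> y; apply: eI.
exact: (@xgetPex _ _ [set y' | e y' = e y] (ex_intro _ y erefl)).
Qed.

(** Extend [h] to a neighborhood of the limit in the power of [Q]. By compactness it contains some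
    [N n], and the extension composed with [stage n] is the required map on [Y]. *)
Lemma tower_factorization (K : gspace G) (h : gmap X K) : is_GANR R K ->
  exists n (q : gmap Y K), ghomotopic R h (q \og p n).
Proof.
move=> anrK.
have [||||||||U [r [oU embU cr eqr rh]]] :=
    @neighborhood_extension R G T K (range emb) (h \o emb_inv).
- by apply: compact_closed => //; apply: continuous_compact => //; exact: continuous_subspaceT.
- by apply: (compact_embedding_within (e := emb)) => //; exact: gmap_continuous.
- exact: cT.
- exact: hT.
- by exists (emb (sval (cid X0))), (sval (cid X0)).
- move=> g _ [x _ <-]; exists (gact g x) => //; apply/funext => n.
  by rewrite /emb !gmap_equivariant.
- move=> g _ [x _ <-].
  have -> : gact g (emb x) = emb (gact g x).
    by apply/funext => n; rewrite /emb !gmap_equivariant.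
  by rewrite /= !embK gmap_equivariant.
- exact: anrK.
have [n NU] := nested_compact cT N_closed N_decr oU (subset_trans N_bigcap embU).
have cq : continuous (r \o stage n).
  move=> y; apply: continuous_comp; first exact: stage_continuous.
  by apply: cr; apply: NU; exact: stage_N.
have eqq g y : (r \o stage n) (gact g y) = gact g ((r \o stage n) y).
  by rewrite /= stage_equivariant eqr//; apply: NU; exact: stage_N.
exists n, (GMap cq eqq).
(* From the embedding of the limit to [stage n] after [p n]: the tail coordinates contract to [q0]
   while the first ones stay, so the homotopy remains in [N n]. *)
pose H (xt : X * I01) : T := fun i =>
  if (i <= n)%N then e (p i xt.1) else c (e (p i xt.1), xt.2).
have cH : continuous H.
  apply: prod_topology_continuous => i; rewrite /H.
  have cp : continuous (fun xt : X * I01 => e (p i xt.1)).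
    have cpi : continuous (fun x => e (p i x)).
      by apply: comp_continuous; exact: gmap_continuous.
    exact: (comp_continuous (@fst_continuous X I01) cpi).
  case: (i <= n)%N => //; apply: comp_continuous cc.
  by apply: pair_continuous => //; exact: snd_continuous.
have NH xt : N n (H xt).
  by move=> i i_n; rewrite /H i_n (ltnW i_n); exists (p i.+1 xt.1); rewrite pF.
exists (r \o H); split.
- move=> xt; apply: continuous_comp; first exact: cH.
  by apply: cr; exact: NU.
- move=> g x t /=; rewrite -eqr; last exact: NU.
  congr r; apply/funext => i; rewrite /H /= /gpower_act !gmap_equivariant.
  by case: (i <= n)%N; rewrite ?ceq.
- move=> x t t0 /=; have -> : H (x, t) = emb x.
    by apply/funext => i; rewrite /H /=; case: (i <= n)%N; rewrite ?c0.
  by rewrite rh /=; [rewrite embK|exists x].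
- move=> x t t1 /=; congr r; apply/funext => i; rewrite /H /stage /=.
  by case: leqP => i_n; [rewrite p_iter|rewrite c1].
Qed.

(** The homotopy over the limit, together with [q] and [q'] at the two ends, is an equivariant map
    on a closed subset of the cylinder over the power of [Q]. Its extension to a neighborhood,
    restricted to a late stage, is a homotopy on [Y]. *)
Lemma tower_equalization (K : gspace G) (n : nat) (q q' : gmap Y K) : is_GANR R K ->
  ghomotopic R (q \og p n) (q' \og p n) ->
  exists m, ghomotopic R (q \og gmap_iter F m) (q' \og gmap_iter F m).
Proof.
move=> anrK [H [cH eH H0 H1]].
pose S := gcyl R T.
(* Membership in [N n.+1] puts the [n]-th coordinate in the image of [e], where [e_inv] is
   continuous; [N n] would impose nothing when [n] is 0. *)
pose A0 : set S := N n.+1 `*` [set i0]; pose A1 : set S := N n.+1 `*` [set i1].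
pose emb2 (xt : X * I01) : S := (emb xt.1, xt.2).
pose A : set S := range emb2 `|` A0 `|` A1.
pose h (vt : S) : K := if \val vt.2 == 0 then q (e_inv (vt.1 n))
  else if \val vt.2 == 1 then q' (e_inv (vt.1 n)) else H (emb_inv vt.1, vt.2).
have hI : hausdorff_space I01 by exact: cinterval_hausdorff.
have cI : compact [set: I01] by exact: (cinterval_compact ler01).
have hS : hausdorff_space S by exact: prod_hausdorff.
have cS : compact [set: S] by rewrite -setXTT; exact: compact_setX.
have cXI : compact [set: X * I01] by rewrite -setXTT; exact: compact_setX.
have cemb2 : continuous emb2.
  apply: pair_continuous; last exact: snd_continuous.
  exact: (comp_continuous (@fst_continuous X I01) emb_continuous).
have cl_slice (t : I01) : closed (N n.+1 `*` [set t]).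
  have -> : N n.+1 `*` [set t] = fst @^-1` N n.+1 `&` snd @^-1` [set t] by [].
  apply: closedI; apply: preimage_closed => [? _|].
  - exact: fst_continuous.
  - exact: N_closed.
  - exact: snd_continuous.
  - exact: (accessible_closed_set1 (hausdorff_accessible hI)).
have cl2 : closed (range emb2).
  by apply: compact_closed => //; apply: continuous_compact => //; exact: continuous_subspaceT.
have cA : closed A by do 2?apply: closedU => //; exact: cl_slice.
have slice_cont (t : I01) (k : gmap Y K) :
    {within N n.+1 `*` [set t], continuous (fun vt : S => k (e_inv (vt.1 n)))}.
  apply: (@within_comp _ _ _ _ (range e) (fun vt : S => vt.1 n) (k \o e_inv)).
  - apply: continuous_subspaceT.
    apply: (comp_continuous (@fst_continuous T I01) (g := fun v : T => v n)).
    exact: (@proj_continuous _ (fun _ : nat => gcarrier Q) n).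
  - by apply: (compact_embedding_within cY) => //; exact: gmap_continuous.
  - by move=> [v s] [/(_ n (ltnSn n))[y [_ vy]] _] /=; exists (F y).
have h_emb2 xt : h (emb2 xt) = H xt.
  case: xt => x t; rewrite /h /emb2 /=; case: eqP => [t0|_].
    by rewrite /emb eK H0.
  by case: eqP => [t1|_]; rewrite ?embK// /emb eK H1.
have h_at0 v t : \val t = 0 -> h (v, t) = q (e_inv (v n)).
  by rewrite /h /= => ->; rewrite eqxx.
have h_at1 v t : \val t = 1 -> h (v, t) = q' (e_inv (v n)).
  by rewrite /h /= => ->; rewrite oner_eq0 eqxx.
have ch : {within A, continuous h}.
  apply: withinU_continuous; [by apply: closedU => //; exact: cl_slice|exact: cl_slice| |].
    apply: withinU_continuous; [exact: cl2|exact: cl_slice| |].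
      apply: (subspace_eq_continuous (f := H \o (fun vt : S => (emb_inv vt.1, vt.2)))).
        move=> _ /set_mem [[x t] _ <-]; rewrite /from_subspace h_emb2 /=.
        by rewrite embK.
      apply: (compact_embedding_within cXI hS cemb2) => //.
      by move=> [x t]; rewrite /emb2 /= embK.
    apply: (subspace_eq_continuous (f := fun vt : S => q (e_inv (vt.1 n)))).
      by move=> [v t] /set_mem [_ /= ->]; rewrite /from_subspace h_at0.
    exact: slice_cont.
  apply: (subspace_eq_continuous (f := fun vt : S => q' (e_inv (vt.1 n)))).
    by move=> [v t] /set_mem [_ /= ->]; rewrite /from_subspace h_at1.
  exact: slice_cont.
have invN g v : N n.+1 v -> N n.+1 (gact g v).
  move=> Nv i i_n; have [y [vy vFy]] := Nv i i_n; exists (gact g y).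
  by rewrite !gmap_equivariant -vy -vFy.
have e_invE g v : N n.+1 v -> e_inv (gact g (v n)) = gact g (e_inv (v n)).
  move=> /(_ n (ltnSn n))[y [_ ->]].
  by rewrite -gmap_equivariant !eK.
have emb2_eq g xt : gact g (emb2 xt) = emb2 (gact g xt.1, xt.2).
  congr (_, _); apply/funext => i; by rewrite /emb !gmap_equivariant.
have [||||||||U [r [oU AU cr eqr rh]]] := @neighborhood_extension R G S K A h.
- exact: cA.
- exact: ch.
- exact: cS.
- exact: hS.
- by exists (emb2 (sval (cid X0), i0)); left; left; exists (sval (cid X0), i0).
- move=> g vt [[[[x t] _ <-]|[Nv ti]]|[Nv ti]].
  + by left; left; rewrite emb2_eq; exists (gact g x, t).
  + by left; right; split => //; exact: invN.
  + by right; split => //; exact: invN.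
- move=> g vt [[[[x t] _ <-]|Hvt]|Hvt].
  + by rewrite emb2_eq !h_emb2 eH.
  + case: vt Hvt => v s [Nv /= ->]; rewrite (h_at0 _ _ val_i0) (h_at0 _ _ val_i0).
    by rewrite e_invE// gmap_equivariant.
  + case: vt Hvt => v s [Nv /= ->]; rewrite (h_at1 _ _ val_i1) (h_at1 _ _ val_i1).
    by rewrite e_invE// gmap_equivariant.
- exact: anrK.
have [|||m0 mU] := @nested_compact S (fun m => fst @^-1` N m) U cS _ _ oU.
- by move=> m; apply: preimage_closed => [? _|]; [exact: fst_continuous|exact: N_closed].
- by move=> m k mk vt; exact: N_decr.
- move=> [v t] Nv; apply: AU; left; left.
  have [x _ xv] : range emb v by apply: N_bigcap => k _; exact: (Nv k I).
  by exists (x, t); rewrite // /emb2 /= xv.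
(* Being at least [n.+1], [m] also places [stage m] in the two end slices, where the extension is
   known. *)
pose m := maxn m0 n.+1.
have mN y t : U (stage m y, t).
  by apply: mU => /=; apply: (N_decr (leq_maxl m0 n.+1)); exact: stage_N.
have nm : (n <= m)%N by exact: leq_trans (leqnSn n) (leq_maxr _ _).
exists (m - n)%N, (fun yt => r (stage m yt.1, yt.2)); split.
- move=> yt; apply: (@continuous_comp _ _ _ (fun yt : Y * I01 => (stage m yt.1, yt.2) :
  S) r); last exact: cr.
  apply: pair_continuous; last exact: snd_continuous.
  exact: (comp_continuous (@fst_continuous Y I01) (@stage_continuous m)).
- move=> g y t /=; rewrite -eqr//; congr r; by rewrite stage_equivariant.
- move=> y t t0 /=; rewrite rh.
    by rewrite h_at0// /stage nm eK.
  left; right; split => /=; last by apply: val_inj; rewrite t0 val_i0.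
  by apply: (N_decr (leq_maxr m0 n.+1)); exact: stage_N.
- move=> y t t1 /=; rewrite rh.
    by rewrite h_at1// /stage nm eK.
  right; split => /=; last by apply: val_inj; rewrite t1 val_i1.
  by apply: (N_decr (leq_maxr m0 n.+1)); exact: stage_N.
Qed.

End Tower.

(** * The bouquet and its suspension *)

Section BouquetCoordinates.
Context (R : realType).
Local Notation C := (R[i])^o.
Local Notation B := (bouquet R).

Lemma continuous_dist (X : topologicalType) (f : X -> R) :
  (forall x e, 0 < e -> \forall y \near x, `|f x - f y| < e) -> continuous f.
Proof. by move=> cf x; apply/(@cvgrPdist_lt R R^o X (nbhs x)) => e e0; exact: cf. Qed.

Lemma Re_continuous : continuous (fun z : C => complex.Re z).
Proof.
apply: continuous_dist => z eps e0; apply/nbhs_normP.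
exists (eps%:C)%C; first by rewrite /= ltcR.
move=> w /= zw; rewrite -(ltcR (`|_|)); apply: le_lt_trans zw.
by have := normc_ge_Re (z - w); case: z w => a b [a' b'].
Qed.

Lemma Im_continuous : continuous (fun z : C => complex.Im z).
Proof.
apply: continuous_dist => z eps e0; apply/nbhs_normP.
exists (eps%:C)%C; first by rewrite /= ltcR.
move=> w /= zw; rewrite -(ltcR (`|_|)); apply: le_lt_trans zw.
case: z w => a b [a' b']; rewrite normc_def /= lecR -sqrtr_sqr.
by rewrite ler_wsqrtr// lerDr sqr_ge0.
Qed.

Lemma Complex_continuous (X : topologicalType) (f g : X -> R) :
  continuous f -> continuous g -> continuous (fun x => (f x +i* g x)%C : C).
Proof.
move=> cf cg x; apply/cvgrPdist_lt => -[e e'].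
rewrite ltcE /= => /andP[/eqP -> e0].
have e2 : 0 < e / 2 by rewrite divr_gt0.
have := cf x; move=> /(@cvgrPdist_lt _ R^o)/(_ _ e2) nf.
have := cg x; move=> /(@cvgrPdist_lt _ R^o)/(_ _ e2) ng.
near=> y.
have fy : `|f x - f y| < e / 2 by near: y.
have gy : `|g x - g y| < e / 2 by near: y.
have -> : ((f x +i* g x) - (f y +i* g y) = (f x - f y) +i* (g x - g y))%C by [].
rewrite normc_def /= ltcR.
rewrite -[ltRHS]ger0_norm ?ltW// -sqrtr_sqr ltr_sqrt; last by rewrite exprn_gt0.
rewrite -!(real_normK (num_real (_ - _))).
have := normr_ge0 (f x - f y); have := normr_ge0 (g x - g y).
by move: `|_| `|_| fy gy => u v; nra.
Unshelve. all: by end_near. Qed.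

Definition xA (b : B) : R := complex.Re (\val b).1.
Definition yA (b : B) : R := complex.Im (\val b).1.
Definition xB (b : B) : R := complex.Re (\val b).2.
Definition yB (b : B) : R := complex.Im (\val b).2.

Lemma bouquet_val_continuous : continuous (\val : B -> C * C).
Proof. exact: initial_continuous. Qed.

Let c1 : continuous (fun b : B => (\val b).1).
Proof. exact: (comp_continuous bouquet_val_continuous (@fst_continuous _ _)). Qed.

Let c2 : continuous (fun b : B => (\val b).2).
Proof. exact: (comp_continuous bouquet_val_continuous (@snd_continuous _ _)). Qed.

Lemma xA_continuous : continuous xA. Proof. exact: (comp_continuous c1 Re_continuous). Qed.
Lemma yA_continuous : continuous yA. Proof. exact: (comp_continuous c1 Im_continuous). Qed.
Lemma xB_continuous : continuous xB. Proof. exact: (comp_continuous c2 Re_continuous). Qed.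
Lemma yB_continuous : continuous yB. Proof. exact: (comp_continuous c2 Im_continuous). Qed.

Lemma circle_sqrP (z : C) : circle z <-> complex.Re z ^+ 2 + complex.Im z ^+ 2 = 1.
Proof.
split; first exact: circle_sqr.
by case: z => a b /= ab; rewrite /circle /= normc_def /= ab sqrtr1.
Qed.

Lemma bouquetP (b : B) : [/\ xA b ^+ 2 + yA b ^+ 2 = 1, xB b ^+ 2 + yB b ^+ 2 = 1 &
  (xA b = 1 /\ yA b = 0) \/ (xB b = 1 /\ yB b = 0)].
Proof.
rewrite /xA /yA /xB /yB; case: b => -[z t] /= /set_mem.
have k1 : circle (1 : C) by rewrite /circle /= normr1.
by case=> -[/= H1 H2]; [rewrite H2|rewrite H1]; split => //;
  [exact/circle_sqrP|exact/circle_sqrP|right|exact/circle_sqrP|exact/circle_sqrP|left].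
Qed.

Lemma bouquet_eq (b b' : B) : xA b = xA b' -> yA b = yA b' ->
  xB b = xB b' -> yB b = yB b' -> b = b'.
Proof.
rewrite /xA /yA /xB /yB => e1 e2 e3 e4; apply: val_inj.
case: (\val b) (\val b') e1 e2 e3 e4 => -[a1 a2] [a3 a4] [[b1 b2] [b3 b4]] /=.
by move=> -> -> -> ->.
Qed.

Lemma bouquet_mk_subproof (x y x' y' : R) : x ^+ 2 + y ^+ 2 = 1 ->
  x' ^+ 2 + y' ^+ 2 = 1 -> (x = 1 /\ y = 0) \/ (x' = 1 /\ y' = 0) ->
  (((x +i* y)%C : C, (x' +i* y')%C : C) \in @bouquet_set R).
Proof.
move=> h h' H; apply/mem_set; case: H => -[-> ->]; [right|left]; split => //=;
  exact/circle_sqrP.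
Qed.

Definition bouquet_mk (x y x' y' : R) h h' H : B :=
  exist (fun p => p \in @bouquet_set R) _ (@bouquet_mk_subproof x y x' y' h h' H).

Lemma bouquet_compact : compact [set: B].
Proof.
have h1 (t : R) : cos t ^+ 2 + sin t ^+ 2 = 1 by exact: cos2Dsin2.
have h0 : (1 : R) ^+ 2 + 0 ^+ 2 = 1 by rewrite expr1n expr0n addr0.
pose cA (t : R) := bouquet_mk (h1 t) h0 (or_intror (conj erefl erefl)).
pose cB (t : R) := bouquet_mk h0 (h1 t) (or_introl (conj erefl erefl)).
have cc : continuous (fun t : R => (cos t +i* sin t)%C : C).
  by apply: Complex_continuous; [exact: continuous_cos|exact: continuous_sin].
have cst1 : continuous (fun t : R => (1 +i* 0)%C : C) by exact: continuous_cst.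
have ccA : continuous cA by apply: continuous_comp_initial; exact: (pair_continuous cc cst1).
have ccB : continuous cB by apply: continuous_comp_initial; exact: (pair_continuous cst1 cc).
have -> : [set: B] = cA @` `[0, 2 * pi] `|` cB @` `[0, 2 * pi].
  apply/seteqP; split => // b _.
  have /set_mem bB := valP b.
  case: bB => -[/= H1 H2]; [left|right].
    have [a0 a1 zE] := arg_spec H1; exists (arg (\val b).1);
      first by rewrite /= in_itv /= a0 ltW.
    apply: val_inj => /=; rewrite -zE; move: H2; by case: (\val b) => ? ? /= ->.
  have [a0 a1 zE] := arg_spec H2; exists (arg (\val b).2);
    first by rewrite /= in_itv /= a0 ltW.
  apply: val_inj => /=; rewrite -zE; move: H1; by case: (\val b) => ? ? /= ->.
by apply: compactU; apply: continuous_compact; try exact: segment_compact;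
  exact: continuous_subspaceT.
Qed.

(* At [p = sin^2 x], [0 <= x <= pi/2], this is (cos 4x, sin 4x): on each quarter
   of a circle the map f becomes polynomial in the coordinates. *)
Definition loopx (p : R) : R := 1 - 8 * `|p| * (1 - `|p|).
Definition loopy (p : R) : R :=
  4 * (Num.sqrt (Num.max p 0) - Num.sqrt (Num.max (- p) 0)) * Num.sqrt (1 - `|p|)
  * (1 - 2 * `|p|).

Lemma loopx_continuous (X : topologicalType) (p : X -> R) : continuous p ->
  continuous (fun x => loopx (p x)).
Proof.
move=> cp; have cn := continuous_normr cp.
apply: continuous_subr; first exact: continuous_cst.
apply: continuous_mulr; first by apply: continuous_mulr => //; exact: continuous_cst.
by apply: continuous_subr => //; exact: continuous_cst.
Qed.

Lemma loopy_continuous (X : topologicalType) (p : X -> R) : continuous p ->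
  continuous (fun x => loopy (p x)).
Proof.
move=> cp; have cn := continuous_normr cp.
have c k : continuous (fun _ : X => k : R) by exact: continuous_cst.
apply: continuous_mulr; last first.
  by apply: continuous_subr => //; exact: continuous_mulr.
apply: continuous_mulr; last by apply: continuous_sqrtr; exact: continuous_subr.
apply: continuous_mulr => //; apply: continuous_subr.
  by apply: continuous_sqrtr; exact: continuous_maxr.
by apply: continuous_sqrtr; apply: continuous_maxr => //; exact: continuous_oppr.
Qed.

Lemma loop_circle (p : R) : `|p| <= 1 -> loopx p ^+ 2 + loopy p ^+ 2 = 1.
Proof.
rewrite /loopx /loopy.
have [p0|p0] := leP 0 p.
  rewrite ger0_norm// => p1; rewrite (_ : Num.max (- p) 0 = 0) ?sqrtr0 ?subr0; last first.
    by apply/max_idPr; lra.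
  rewrite !exprMn sqr_sqrtr// sqr_sqrtr ?subr_ge0//; ring.
rewrite ltr0_norm// => p1; rewrite sqrtr0 sub0r.
rewrite (max_idPl _); last by lra.
rewrite !exprMn sqrrN sqr_sqrtr; last by lra.
rewrite sqr_sqrtr; [ring|lra].
Qed.

Lemma loopxN p : loopx (- p) = loopx p.
Proof. by rewrite /loopx normrN. Qed.

Lemma loopyN p : loopy (- p) = - loopy p.
Proof. rewrite /loopy normrN opprK; ring. Qed.

Lemma loop0 : loopx 0 = 1 /\ loopy 0 = 0.
Proof. by rewrite /loopx /loopy normr0 oppr0 !maxxx sqrtr0; split; ring. Qed.

Lemma loop1 : loopx 1 = 1 /\ loopy 1 = 0.
Proof. by rewrite /loopx /loopy normr1 subrr sqrtr0; split; ring. Qed.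

(** Along the four quarters of the unit circle [quarter1] rises from 0 to 1, stays at 1, falls to 0
    and stays at 0; [quarter2] does the same one quarter later. Together they trace the boundary of
    the unit square, which is the commutator path. *)
Definition quarter1 (x y : R) := Num.max y 0 ^+ 2 + Num.max (- x) 0 ^+ 2.
Definition quarter2 (x y : R) := Num.max (- x) 0 ^+ 2 + Num.max (- y) 0 ^+ 2.

(** Real lifts of the two components of f. On the second circle f takes the inverse values, hence
    the minus sign; each term vanishes at the base point of its circle. *)
Definition phi1 (b : B) := quarter1 (xA b) (yA b) - quarter1 (xB b) (yB b).
Definition phi2 (b : B) := quarter2 (xA b) (yA b) - quarter2 (xB b) (yB b).

Lemma quarter_continuous (X : topologicalType) (f g : X -> R) : continuous f ->
  continuous g -> continuous (fun x => Num.max (f x) 0 ^+ 2 + Num.max (g x) 0 ^+ 2).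
Proof.
move=> cf cg; have c0 : continuous (fun _ : X => 0 : R) by exact: continuous_cst.
by apply: continuous_addr; under eq_fun do rewrite expr2;
  apply: continuous_mulr; exact: continuous_maxr.
Qed.

Lemma phi1_continuous : continuous phi1.
Proof.
apply: continuous_subr; apply: quarter_continuous; try (apply: continuous_oppr);
  try exact: xA_continuous; try exact: yA_continuous; try exact: xB_continuous;
  exact: yB_continuous.
Qed.

Lemma phi2_continuous : continuous phi2.
Proof.
apply: continuous_subr; apply: quarter_continuous; apply: continuous_oppr;
  try exact: xA_continuous; try exact: yA_continuous; try exact: xB_continuous;
  exact: yB_continuous.
Qed.

Lemma quarterP (u v : R) : u ^+ 2 + v ^+ 2 = 1 ->
  [\/ [/\ 0 <= u, 0 <= v, quarter1 u v = v ^+ 2 & quarter2 u v = 0],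
      [/\ u < 0, 0 <= v, quarter1 u v = 1 & quarter2 u v = u ^+ 2],
      [/\ u < 0, v < 0, quarter1 u v = u ^+ 2 & quarter2 u v = 1] |
      [/\ 0 <= u, v < 0, quarter1 u v = 0 & quarter2 u v = v ^+ 2]].
Proof.
move=> uv; rewrite /quarter1 /quarter2.
have [v0|v0] := leP 0 v; have [u0|u0] := leP 0 u.
- apply: Or41; split=> //; rewrite ?(max_idPr (_ : - u <= 0)) ?(max_idPr (_ : - v <= 0))
  ?oppr_le0 ?(max_idPl v0)//; ring.
- apply: Or42; split=> //; rewrite ?(max_idPl (_ : 0 <= - u)) ?(max_idPr (_ : - v <= 0))
  ?oppr_le0 ?(max_idPl v0) ?oppr_ge0 ?(ltW u0)//; rewrite -?uv; ring.
- apply: Or44; split=> //; rewrite ?(max_idPr (_ : - u <= 0)) ?(max_idPl (_ : 0 <= - v))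
  ?oppr_le0 ?(max_idPr (ltW v0)) ?oppr_ge0 ?(ltW v0)//; ring.
- apply: Or43; split=> //; rewrite ?(max_idPl (_ : 0 <= - u)) ?(max_idPl (_ : 0 <= - v))
  ?oppr_le0 ?(max_idPr (ltW v0)) ?oppr_ge0 ?(ltW v0) ?(ltW u0)//; rewrite -?uv; ring.
Qed.

Lemma quarter_base : quarter1 1 0 = 0 :> R /\ quarter2 1 0 = 0 :> R.
Proof.
have := @quarterP 1 0; rewrite expr1n expr0n addr0 => /(_ erefl).
by case=> -[h h' e1 e2] //; rewrite ?ltr10 ?ltxx// in h h'.
Qed.

Definition upper (x : B) := (0 <= yA x) && (0 <= yB x).

(* [s] is the sign with which the circle carrying [x] enters [phi1], [phi2].   *)
Lemma bouquet_branch (x : B) : exists u v s : R, [/\ u ^+ 2 + v ^+ 2 = 1,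
  phi1 x = s * quarter1 u v, phi2 x = s * quarter2 u v, upper x = (0 <= v) &
  (s = 1 /\ [/\ xA x = u, yA x = v, xB x = 1 & yB x = 0]) \/
  (s = - 1 /\ [/\ xA x = 1, yA x = 0, xB x = u & yB x = v])].
Proof.
have [q1 q2] := quarter_base; rewrite /phi1 /phi2 /upper.
have [a1 b1 [[-> ->]|[-> ->]]] := bouquetP x.
  exists (xB x), (yB x), (-1); split=> //; rewrite ?q1 ?q2 ?lexx//; [ring|ring|by right].
exists (xA x), (yA x), 1; split=> //; rewrite ?q1 ?q2 ?lexx ?andbT//; [ring|ring|by left].
Qed.

End BouquetCoordinates.

(** * The map f in coordinates *)

Section BouquetMapCoordinates.
Context (R : realType).
Local Notation C := (R[i])^o.
Local Notation B := (bouquet R).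
Local Notation Re := (@complex.Re R).
Local Notation Im := (@complex.Im R).

Lemma quadrant (z : C) : circle z ->
  (arg z <= pi / 2 /\ 0 <= Re z /\ 0 <= Im z) \/
  (pi / 2 < arg z <= pi /\ Re z <= 0 /\ 0 <= Im z) \/
  (pi < arg z <= 3 * pi / 2 /\ Re z <= 0 /\ Im z <= 0) \/
  (3 * pi / 2 < arg z /\ 0 <= Re z /\ Im z <= 0).
Proof.
move=> cz; have [a0 a2 zE] := arg_spec cz.
have -> : Re z = cos (arg z) by rewrite {1}zE.
have -> : Im z = sin (arg z) by rewrite {1}zE.
move: (arg z) a0 a2 => t a0 a2; have pi0 := pi_gt0 R.
have cB s : cos s = - cos (s - pi) by rewrite -{1}(subrK pi s) cosDpi.
have sB s : sin s = - sin (s - pi) by rewrite -{1}(subrK pi s) sinDpi.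
have [t1|t1] := leP t (pi / 2).
  left; split => //; split; [apply: cos_ge0_pihalf|apply: sin_ge0_pi]; apply/andP; split; lra.
right; have [t2|t2] := leP t pi.
  left; split => //; split; last by apply: sin_ge0_pi; apply/andP; split; lra.
  by rewrite cB oppr_le0; apply: cos_ge0_pihalf; apply/andP; split; lra.
right; have [t3|t3] := leP t (3 * pi / 2).
  left; split => //; split.
    by rewrite cB oppr_le0; apply: cos_ge0_pihalf; apply/andP; split; lra.
  by rewrite sB oppr_le0; apply: sin_ge0_pi; apply/andP; split; lra.
right; split => //; split.
  by rewrite cB cB opprK; apply: cos_ge0_pihalf; apply/andP; split; lra.
by rewrite sB oppr_le0; apply: sin_ge0_pi; apply/andP; split; lra.
Qed.

Lemma Re_mul (z w : C) : Re (z * w) = Re z * Re w - Im z * Im w.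
Proof. by case: z w => a b [a' b']. Qed.

Lemma Im_mul (z w : C) : Im (z * w) = Re z * Im w + Im z * Re w.
Proof. by case: z w => a b [a' b']. Qed.

Lemma Re_pow4 (z : C) :
  Re (z ^+ 4) = (Re z ^+ 2 - Im z ^+ 2) ^+ 2 - (2 * Re z * Im z) ^+ 2.
Proof. rewrite !exprS expr0 mulr1 !(Re_mul, Im_mul); ring. Qed.

Lemma Im_pow4 (z : C) :
  Im (z ^+ 4) = 4 * Re z * Im z * (Re z ^+ 2 - Im z ^+ 2).
Proof. rewrite !exprS expr0 mulr1 !(Re_mul, Im_mul); ring. Qed.

Lemma Re_inv (z : C) : circle z -> Re (z^-1) = Re z.
Proof. by move=> /circle_sqrP; case: z => a b /= ->; rewrite divr1. Qed.

Lemma Im_inv (z : C) : circle z -> Im (z^-1) = - Im z.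
Proof. by move=> /circle_sqrP; case: z => a b /= ->; rewrite ?divr1 ?invr1 ?mulr1. Qed.

(** With u = sin x and v = cos x these are the formulas for cos 4x and sin 4x. *)
Lemma loop_sqr (u v : R) : 0 <= u -> 0 <= v -> u ^+ 2 + v ^+ 2 = 1 ->
  loopx (u ^+ 2) = 1 - 8 * u ^+ 2 * v ^+ 2 /\
  loopy (u ^+ 2) = 4 * u * v * (1 - 2 * u ^+ 2).
Proof.
move=> u0 v0 uv; have v2 : 1 - u ^+ 2 = v ^+ 2 by rewrite -uv; ring.
have uu : 0 <= u ^+ 2 by rewrite sqr_ge0.
rewrite /loopx /loopy ger0_norm// v2 !sqrtr_sqr (max_idPl uu).
rewrite (_ : Num.max (- u ^+ 2) 0 = 0); last by apply/max_idPr; lra.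
by rewrite sqrtr0 subr0 sqrtr_sqr !ger0_norm.
Qed.

Let pow4 (x y : R) : x ^+ 2 + y ^+ 2 = 1 ->
  (x ^+ 2 - y ^+ 2) ^+ 2 - (2 * x * y) ^+ 2 = 1 - 8 * x ^+ 2 * y ^+ 2.
Proof.
move=> xy; have -> : x ^+ 2 = 1 - y ^+ 2 by rewrite -xy; ring.
rewrite exprMn exprMn; have -> : x ^+ 2 = 1 - y ^+ 2 by rewrite -xy; ring.
ring.
Qed.

Let sq0 : (0 : R) ^+ 2 = 0. Proof. by rewrite expr0n. Qed.
Let maxp (r : R) : 0 <= r -> Num.max r 0 = r. Proof. by move=> r0; apply/max_idPl. Qed.
Let maxn (r : R) : r <= 0 -> Num.max r 0 = 0. Proof. by move=> r0; apply/max_idPr. Qed.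

Lemma bouquet_fun1E (z : C) : circle z ->
  let w := bouquet_fun1 z in let p := quarter1 (Re z) (Im z) in
  let q := quarter2 (Re z) (Im z) in
  [/\ Re w.1 = loopx p, Im w.1 = loopy p, Re w.2 = loopx q & Im w.2 = loopy q].
Proof.
move=> cz /=; have xy := circle_sqr cz.
have [lx0 ly0] := loop0 R; have [lx1 ly1] := loop1 R.
have c4 := circleX 4 cz.
have x2 : Re z ^+ 2 = 1 - Im z ^+ 2 by rewrite -xy; ring.
rewrite /bouquet_fun1 /quarter1 /quarter2.
case: (quadrant cz) => [[a1 [x0 y0]]|[[/andP[a1 a2] [x0 y0]]|[[/andP[a1 a2] [x0 y0]]|[a1
  [x0 y0]]]]].
- rewrite a1 /= (maxp y0) !(maxn (_ : - _ <= 0)) ?oppr_le0// sq0 ?addr0 lx0 ly0.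
  have [|-> ->] := loop_sqr y0 x0; first by rewrite addrC.
  rewrite Re_pow4 Im_pow4 pow4//; split => //; [ring|rewrite x2; ring].
- rewrite leNgt a1 a2 /= (maxp y0) (maxn (_ : - Im z <= 0)) ?oppr_le0//.
  rewrite (maxp (_ : 0 <= - Re z)) ?oppr_ge0// sqrrN sq0 ?addr0 (addrC (Im z ^+ 2)) xy lx1 ly1.
  have [||e1 e2] := @loop_sqr (- Re z) (Im z) _ y0; rewrite ?oppr_ge0 ?sqrrN//.
  rewrite sqrrN in e1 e2; rewrite e1 e2.
  rewrite Re_pow4 Im_pow4 pow4//; split => //; rewrite x2; ring.
- have pi0 := pi_gt0 R.
  rewrite ifF; last by apply/negbTE; rewrite -ltNge; lra.
  rewrite ifF; last by apply/negbTE; rewrite -ltNge; lra.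
  rewrite a2 /= (maxn y0) (maxp (_ : 0 <= - Im z)) ?oppr_ge0//.
  rewrite (maxp (_ : 0 <= - Re z)) ?oppr_ge0// !sqrrN sq0 ?add0r xy lx1 ly1.
  have [|||e1 e2] := @loop_sqr (- Re z) (- Im z); rewrite ?oppr_ge0 ?sqrrN//.
  rewrite !sqrrN in e1 e2; rewrite e1 e2.
  rewrite Re_inv// Im_inv// Re_pow4 Im_pow4 pow4//; split => //; rewrite x2; ring.
- have pi0 := pi_gt0 R.
  do 3![rewrite ifF; last by apply/negbTE; rewrite -ltNge; lra].
  rewrite (maxn y0) (maxp (_ : 0 <= - Im z)) ?oppr_ge0//.
  rewrite (maxn (_ : - Re z <= 0)) ?oppr_le0// !sqrrN sq0 !add0r lx0 ly0.
  have [||e1 e2] := @loop_sqr (- Im z) (Re z) _ x0; rewrite ?oppr_ge0 ?sqrrN// 1?addrC//.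
  rewrite !sqrrN in e1 e2; rewrite e1 e2.
  rewrite Re_inv// Im_inv// Re_pow4 Im_pow4 pow4//; split => //; rewrite ?x2; ring.
Qed.

Lemma bouquet_fun2E (t : C) : circle t ->
  let w := bouquet_fun2 t in let p := - quarter1 (Re t) (Im t) in
  let q := - quarter2 (Re t) (Im t) in
  [/\ Re w.1 = loopx p, Im w.1 = loopy p, Re w.2 = loopx q & Im w.2 = loopy q].
Proof.
move=> ct /=; have c4 := circleX 4 ct; rewrite !loopxN !loopyN.
have c14 : circle (t ^- 4 : C) by exact: circleXN.
have [<- <- <- <-] := bouquet_fun1E ct.
rewrite /bouquet_fun1 /bouquet_fun2.
case: ifP => _ /=; first by rewrite Re_inv// Im_inv// oppr0.
case: ifP => _ /=; first by rewrite Re_inv// Im_inv// oppr0.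
by case: ifP => _ /=; rewrite Re_inv// Im_inv// oppr0 opprK.
Qed.

(** The eight branches of f become one continuous formula, from which the continuity of f and all
    later estimates are drawn. *)
Lemma bouquet_mapE (b : B) : [/\ xA (bouquet_map b) = loopx (phi1 b),
  yA (bouquet_map b) = loopy (phi1 b), xB (bouquet_map b) = loopx (phi2 b)
  & yB (bouquet_map b) = loopy (phi2 b)].
Proof.
have [q10 q20] := quarter_base R.
case: b => -[z t] zt'; have /set_mem zt := zt'.
rewrite /xA /yA /xB /yB /= /phi1 /phi2 /xA /yA /xB /yB /bouquet_fun /= in zt *.
have [t1|t1] := eqVneq t 1.
  have zS : circle z by case: zt => -[] //= -> _; rewrite /circle /= normr1.
  by rewrite t1 /= q10 q20 !subr0; exact: bouquet_fun1E.
have [z1 tS] : z = 1 /\ circle t by case: zt => -[] //= _ /eqP; rewrite (negbTE t1).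
by rewrite z1 /= q10 q20 !sub0r; exact: bouquet_fun2E.
Qed.

Lemma bouquet_lift (D : topologicalType) (g : D -> B) :
  continuous (fun d => xA (g d)) -> continuous (fun d => yA (g d)) ->
  continuous (fun d => xB (g d)) -> continuous (fun d => yB (g d)) -> continuous g.
Proof.
move=> c1 c2 c3 c4; apply: continuous_comp_initial.
have -> : \val \o g = fun d => ((xA (g d) +i* yA (g d))%C : C, (xB (g d) +i* yB (g d))%C : C).
  by apply/funext => d; rewrite /xA /yA /xB /yB /=; case: (\val (g d)) => -[? ?] [? ?].
by apply: pair_continuous; exact: Complex_continuous.
Qed.

Lemma bouquet_map_continuous : continuous (@bouquet_map R).
Proof.
apply: bouquet_lift.
- rewrite (_ : (fun b => _) = fun b => loopx (phi1 b)).
    by apply: loopx_continuous; exact: phi1_continuous.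
  by apply/funext => b; case: (bouquet_mapE b).
- rewrite (_ : (fun b => _) = fun b => loopy (phi1 b)).
    by apply: loopy_continuous; exact: phi1_continuous.
  by apply/funext => b; case: (bouquet_mapE b).
- rewrite (_ : (fun b => _) = fun b => loopx (phi2 b)).
    by apply: loopx_continuous; exact: phi2_continuous.
  by apply/funext => b; case: (bouquet_mapE b).
- rewrite (_ : (fun b => _) = fun b => loopy (phi2 b)).
    by apply: loopy_continuous; exact: phi2_continuous.
  by apply/funext => b; case: (bouquet_mapE b).
Qed.

End BouquetMapCoordinates.

Lemma set_type_compact (X : topologicalType) (A : set X) :
  compact A -> compact [set: set_type A].
Proof.
move=> /compact_near_coveringP cA; apply/compact_near_coveringP => I F P FF nP.
pose P' i x := forall h : x \in A, P i (exist (fun x => x \in A) x h).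
suff : \forall i \near F, A `<=` P' i.
  apply: filterS => i AP [x xA] _; apply: AP; exact: set_mem.
apply: cA => x Ax; pose x' : set_type A := exist (fun x => x \in A) x (mem_set Ax).
have [[U W] /= [nU FW] UWP] := nP x' Logic.I.
have [V [[V' oV' <-] V'x] V'U] := nU.
exists (V', W) => /=; first by split => //; exact: open_nbhs_nbhs.
by move=> [y i] /= [Vy Wi] h; apply: (UWP (_, i)); split => //=; exact: V'U.
Qed.

(** A continuous surjection from a compact space to a Hausdorff space is closed, hence a quotient
    map. *)
Lemma compact_quotient_continuous (C D Z : topologicalType) (q : C -> D) (g : D -> Z) :
  compact [set: C] -> hausdorff_space D -> continuous q -> set_surj setT setT q ->
  continuous (fun x => g (q x)) -> continuous g.
Proof.
move=> cC hD cq sq cg; apply/continuous_closedP => F cF.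
have -> : g @^-1` F = q @` ((fun x => g (q x)) @^-1` F).
  apply/seteqP; split => [d Fd|_ [x Fx <-]//].
  by have [x _ xd] := sq d I; exists x; rewrite //= xd.
apply: compact_closed => //; apply: continuous_compact; first exact: continuous_subspaceT.
apply: (subclosed_compact _ cC) => //; apply: preimage_closed => // x _; exact: cg.
Qed.

(** * The suspension as a double cone *)

Section SuspensionTopology.
Context (R : realType) (B : topologicalType).
Local Notation J := (cinterval (- 1 : R) 1).
Local Notation SB := (susp R B).

Lemma susp_continuous (Z : topologicalType) (g : SB -> Z) :
  continuous (fun p => g (susp_pt p)) -> continuous g.
Proof.
by move=> cg; apply/(@quotient_continuous _ {eq_quot susp_equiv R B} Z g).
Qed.

Lemma susp_compact : compact [set: B] -> compact [set: SB].
Proof.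
move=> cB; have -> : [set: SB] = @susp_pt R B @` setT.
  by apply/seteqP; split => // y _; have [p ->] := susp_ptP y; exists p.
apply: continuous_compact; first by apply: continuous_subspaceT; exact: susp_pt_continuous.
rewrite -setXTT; apply: compact_setX => //; apply: cinterval_compact; lra.
Qed.

Section Cone.
Context (E : normedModType R) (eps : B -> E).

(** The double cone over the image of [eps] with apexes (0, 1) and (0, -1), a concrete model of the
    quotient in which the involution becomes linear. *)
Definition susp_emb (y : SB) : E * R :=
  let p := repr (y : {eq_quot susp_equiv R B}) in
  ((1 - `|\val p.2|) *: eps p.1, \val p.2).

Lemma susp_embE x t : susp_emb (susp_pt (x, t)) = ((1 - `|\val t|) *: eps x, \val t).
Proof.
rewrite /susp_emb; have /susp_pt_eq : susp_pt (repr (susp_pt (x, t) : {eq_quot susp_equiv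
  R B})) =
  susp_pt (x, t) by rewrite /susp_pt reprK.
move: (repr _) => [x' t'].
rewrite /susp_rel /= => /or3P[/eqP[-> ->]//|/andP[/eqP-> /eqP->]|/andP[/eqP-> /eqP->]].
  by rewrite normr1 subrr !scale0r.
by rewrite normrN normr1 subrr !scale0r.
Qed.

Lemma susp_emb_continuous : continuous eps -> continuous susp_emb.
Proof.
move=> ce; apply: susp_continuous.
have -> : (fun p => susp_emb (susp_pt p)) =
    fun p : B * J => ((1 - `|\val p.2|) *: eps p.1, \val p.2).
  by apply/funext => -[x t]; rewrite susp_embE.
have ct : continuous (fun p : B * J => \val p.2).
  exact: (comp_continuous (@snd_continuous B J) (@cinterval_val_continuous R _ _)).
apply: pair_continuous => //.
have c1 : continuous (fun p : B * J => 1 - `|\val p.2| : R).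
  by apply: continuous_subr; [exact: continuous_cst|exact: continuous_normr].
have c2 := comp_continuous (@fst_continuous B J) ce.
by move=> p; apply: cvgZ; [exact: c1|exact: c2].
Qed.

Lemma susp_emb_inj : injective eps -> injective susp_emb.
Proof.
move=> eI y y'; have [[x t] ->] := susp_ptP y; have [[x' t'] ->] := susp_ptP y'.
rewrite !susp_embE => -[xx' tt']; apply/susp_pt_eq; rewrite /susp_rel /=.
have {}tt' : t = t' by exact: val_inj.
rewrite -{}tt' in xx' *.
have [_|t1] := eqVneq (\val t) 1; first by rewrite orbT.
have [_|t2] := eqVneq (\val t) (-1); first by rewrite !orbT.
rewrite (_ : x = x') ?eqxx//; apply: eI.
apply: (scalerI _ xx'); rewrite subr_eq0 eq_sym.
by rewrite eqr_norml (negbTE t1) (negbTE t2).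
Qed.

Lemma susp_emb_flip y : susp_emb (susp_flip y) = ((susp_emb y).1, - (susp_emb y).2).
Proof.
have [[x t] ->] := susp_ptP y; rewrite susp_flipE !susp_embE /=.
by rewrite normrN.
Qed.

Lemma susp_emb_norm y : (forall x, `|eps x| <= 1) -> `|susp_emb y| <= 1.
Proof.
move=> e1; have [[x t] ->] := susp_ptP y; rewrite susp_embE.
have /andP[t1 t2] := cinterval_bounds t; have tn : `|\val t| <= 1 by rewrite ler_norml t1.
rewrite prod_normE /= ge_max tn andbT normrZ ger0_norm ?subr_ge0//.
rewrite -[leRHS]mulr1; apply: ler_pM => //; first by rewrite subr_ge0.
Qed.

End Cone.

Lemma susp_hausdorff (E : normedModType R) (eps : B -> E) :
  continuous eps -> injective eps -> hausdorff_space SB.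
Proof.
move=> ce eI; apply: (initial_hausdorff _ (susp_emb_continuous ce) (susp_emb_inj eI)).
exact: norm_hausdorff.
Qed.

(** Homotopies on the suspension may be defined on the cylinder: by compactness the product of the
    quotient map with an interval is again a quotient map. *)
Lemma susp_cylinder_continuous (Z : topologicalType) (g : SB * cinterval (0 : R) 1 -> Z) :
  compact [set: B] -> hausdorff_space SB ->
  continuous (fun p : (B * J) * cinterval (0 : R) 1 => g (susp_pt p.1, p.2)) ->
  continuous g.
Proof.
move=> cB hS cg.
have cI : compact [set: cinterval (0 : R) 1] by exact: (cinterval_compact ler01).
have cJ : compact [set: J] by apply: cinterval_compact; lra.
apply: (@compact_quotient_continuous _ _ _
  (fun p : (B * J) * cinterval (0 : R) 1 => (susp_pt p.1, p.2))) => //.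
- by rewrite -!setXTT; do 2!apply: compact_setX => //.
- by apply: prod_hausdorff => //; exact: cinterval_hausdorff.
- apply: pair_continuous; last exact: snd_continuous.
  exact: (comp_continuous (@fst_continuous _ _) (@susp_pt_continuous R B)).
- by move=> [y s] _; have [p ->] := susp_ptP y; exists (p, s).
Qed.

End SuspensionTopology.

Lemma susp_map_continuous (R : realType) (A B : topologicalType) (f : A -> B) :
  continuous f -> continuous (@susp_map R A B f).
Proof.
move=> cf; apply: susp_continuous.
have -> : (fun p => susp_map f (susp_pt p)) = fun p : A * cinterval (- 1 : R) 1 =>
  susp_pt (f p.1, p.2).
  by apply/funext => -[x t]; rewrite susp_mapE.
apply: comp_continuous (@susp_pt_continuous R B); apply: pair_continuous;
  last exact: snd_continuous.
exact: (comp_continuous (@fst_continuous _ _) cf).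
Qed.

Section BouquetEmbedding.
Context (R : realType).
Local Notation B := (bouquet R).
Local Notation E4 := ((R * R) * (R * R))%type.

Definition bouquet_emb (b : B) : E4 := ((xA b, yA b), (xB b, yB b)).

Lemma bouquet_emb_continuous : continuous bouquet_emb.
Proof.
by apply: pair_continuous; apply: pair_continuous; [exact: xA_continuous|exact: yA_continuous|
  exact: xB_continuous|exact: yB_continuous].
Qed.

Lemma bouquet_emb_inj : injective bouquet_emb.
Proof. by move=> b b' [? ? ? ?]; exact: bouquet_eq. Qed.

Lemma bouquet_emb_norm b : `|bouquet_emb b| <= 1.
Proof.
have [h1 h2 _] := bouquetP b.
have le1 (x y : R) : x ^+ 2 + y ^+ 2 = 1 -> `|x| <= 1.
  by move=> xy; rewrite -(expr_le1 (ltn0Sn 1)) // real_normK ?num_real// -xy lerDl sqr_ge0.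
rewrite !prod_normE /= !ge_max.
by rewrite (le1 _ _ h1) (le1 _ _ h2) (le1 _ _ (etrans (addrC _ _) h1)) (le1 _ _ (etrans
  (addrC _ _) h2)).
Qed.

Lemma susp_bouquet_compact : compact [set: susp R B].
Proof. exact: susp_compact (@bouquet_compact R). Qed.

Lemma susp_bouquet_hausdorff : hausdorff_space (susp R B).
Proof. exact: susp_hausdorff bouquet_emb_continuous bouquet_emb_inj. Qed.

End BouquetEmbedding.

Section Involution.
Context (X : topologicalType) (s : X -> X).
Hypotheses (sK : involutive s) (cs : continuous s).

Definition invol_act (g : 'Z_2) (x : X) : X := if g == 1%g then x else s x.

Lemma invol_act1 x : invol_act 1%g x = x.
Proof. by rewrite /invol_act eqxx. Qed.

Lemma invol_actM (g h : 'Z_2) x : invol_act (g * h)%g x = invol_act g (invol_act h x).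
Proof.
have Z2E (k : 'Z_2) : k = 1%g \/ k = 1 :> 'Z_2.
  by case: k => -[|[|//]] ?; [left|right]; apply: val_inj.
case: (Z2E g) (Z2E h) => -> [] ->;
  by rewrite /invol_act ?mulg1 ?mul1g ?eqxx //= sK.
Qed.

Lemma invol_act_continuous :
  continuous (fun p : discrete_topology 'Z_2 * X => invol_act p.1 p.2).
Proof.
apply: discrete_act_continuous => g; rewrite /invol_act.
by case: (g == _); [move=> y; exact: cvg_id|exact: cs].
Qed.

Definition invol_gspace : gspace 'Z_2 :=
  GSpace invol_act1 invol_actM invol_act_continuous.

End Involution.

(** * A contractible compact space around the suspension *)

Section Cube.
Context (R : realType).
Local Notation V := (((R * R) * (R * R)) * R)%type.
Local Notation B := (bouquet R).
Local Notation SB := (susp R B).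
Local Notation I01 := (cinterval (0 : R) 1).

(** Plays the role of [Q] in the tower: it contains the suspension, is invariant under the
    involution, and contracts equivariantly to the origin by scaling. *)
Definition cube : topologicalType := set_type [set v : V | `|v| <= 1].

Lemma cube_compact : compact [set: cube].
Proof.
apply: set_type_compact.
pose S := [set` `[-1 : R, 1]].
have cS : compact S by exact: segment_compact.
apply: (@subclosed_compact _ _ (((S `*` S) `*` (S `*` S)) `*` S)).
- apply: (@preimage_closed V R (fun v => `|v|) [set r | r <= 1]); last exact: closed_le.
  by move=> v _; exact: (@norm_continuous _ V).
- by do 2!apply: compact_setX => //; apply: compact_setX.
- move=> [[[a b] [c d]] t]; rewrite /= !prod_normE /= !ge_max !ler_norml /S /= !in_itv /=.
  by move=> /andP[/andP[/andP[? ?] /andP[? ?]] ?].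
Qed.

Lemma cube_hausdorff : hausdorff_space cube.
Proof.
apply: (@initial_hausdorff _ V (\val : cube -> V)); last exact: val_inj.
  exact: norm_hausdorff.
exact: initial_continuous.
Qed.

Definition cube_emb (y : SB) : cube :=
  exist (fun v : V => v \in [set v : V | `|v| <= 1]) _
    (mem_set (susp_emb_norm y (@bouquet_emb_norm R))).

Lemma cube_emb_continuous : continuous cube_emb.
Proof.
apply: continuous_comp_initial; apply: susp_emb_continuous; exact: bouquet_emb_continuous.
Qed.

Lemma cube_emb_inj : injective cube_emb.
Proof. by move=> y y' /(congr1 val); exact: (susp_emb_inj (@bouquet_emb_inj R)). Qed.

Lemma cube_contraction_subproof (p : cube * I01) :
  `|(1 - \val p.2) *: (\val p.1 : V)| <= 1.
Proof.
have /andP[t0 t1] := cinterval_bounds p.2; have v1 := set_mem (valP p.1).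
rewrite normrZ ger0_norm ?subr_ge0// -[leRHS]mulr1; apply: ler_pM => //.
  by rewrite subr_ge0.
by rewrite gerBl.
Qed.

Definition cube_contraction (p : cube * I01) : cube :=
  exist (fun v : V => v \in [set v : V | `|v| <= 1]) _ (mem_set (cube_contraction_subproof p)).

Lemma cube_contraction_continuous : continuous cube_contraction.
Proof.
apply: continuous_comp_initial => p; apply: cvgZ.
  apply: (@continuous_subr R _ (fun=> 1) (fun p : cube * I01 => \val p.2));
    first exact: continuous_cst.
  exact: (comp_continuous (@snd_continuous _ _) (@cinterval_val_continuous R _ _)).
have cv : continuous (\val : cube -> V) by exact: initial_continuous.
exact: (comp_continuous (@fst_continuous cube I01) cv).
Qed.

Lemma cube_flip_subproof (v : cube) : `|((\val v).1, - (\val v).2) : V| <= 1.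
Proof.
by have /= := set_mem (valP v); rewrite !prod_normE /= normrN.
Qed.

Definition cube_flip (v : cube) : cube :=
  exist (fun v : V => v \in [set v : V | `|v| <= 1]) _ (mem_set (cube_flip_subproof v)).

Lemma cube_flipK : involutive cube_flip.
Proof. by move=> v; apply: val_inj => /=; rewrite opprK; case: (\val v). Qed.

Lemma cube_flip_continuous : continuous cube_flip.
Proof.
apply: continuous_comp_initial.
have cv : continuous (\val : cube -> V) by exact: initial_continuous.
apply: (@pair_continuous cube _ _ (fun v => (\val v).1) (fun v => - (\val v).2)).
  exact: (comp_continuous cv (@fst_continuous _ _)).
by apply: continuous_oppr; exact: (comp_continuous cv (@snd_continuous _ _)).
Qed.

Lemma cube_origin_subproof : `|0 : V| <= 1. Proof. by rewrite normr0 ler01. Qed.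

Definition cube_origin : cube :=
  exist (fun v : V => v \in [set v : V | `|v| <= 1]) 0
    (mem_set cube_origin_subproof).

End Cube.

(** * The tower of suspensions and its limit *)

Section SolenoidTower.
Context (R : realType).
Local Notation B := (bouquet R).
Local Notation SB := (susp R B).
Local Notation f := (@bouquet_map R).
Local Notation I01 := (cinterval (0 : R) 1).

Definition SP_proj (n : nat) (x : SigmaP R) : SB := \val x n.

Lemma SP_proj_continuous n : continuous (SP_proj n).
Proof.
apply: (@comp_continuous _ _ _ (\val : SigmaP R -> prod_topology (fun _ : nat => SB))
  (fun v => v n)).
  exact: initial_continuous.
exact: (@proj_continuous _ (fun _ : nat => SB) n).
Qed.

Lemma SP_projF n x : susp_map f (SP_proj n.+1 x) = SP_proj n x.
Proof. by have /set_mem -> := valP x. Qed.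

Lemma SP_projI x x' : (forall n, SP_proj n x = SP_proj n x') -> x = x'.
Proof. by move=> xx'; apply: val_inj; apply: functional_extensionality_dep. Qed.

Lemma SP_projS (y : nat -> SB) : (forall n, susp_map f (y n.+1) = y n) ->
  exists x, forall n, SP_proj n x = y n.
Proof. by move=> yF; exists (exist (fun v : prod_topology (fun _ => SB) =>
  v \in invlim_set (X := fun _ => susp_gspace R B) (fun _ => susp_map f)) y (mem_set yF)). Qed.

Lemma SP_compact : compact [set: SigmaP R].
Proof.
apply: set_type_compact.
have cT : compact [set: prod_topology (fun _ : nat => SB)].
  rewrite (_ : [set: _] = [set v : prod_topology (fun _ : nat => SB) | forall n, [set:
    SB] (v n)]); last first.
    by apply/seteqP; split.
  exact: (@tychonoff nat (fun=> SB) (fun=> setT) (fun=> @susp_bouquet_compact R)).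
apply: (subclosed_compact _ cT) => //.
have -> : invlim_set (X := fun _ => susp_gspace R B) (fun _ => susp_map f) =
    \bigcap_n [set x : prod_topology (fun _ : nat => SB) | susp_map f (x n.+1) = x n].
  by apply/seteqP; split => x h n; [move=> _|]; exact: h.
apply: closed_bigI => n _.
have cp k : continuous (fun x : prod_topology (fun _ : nat => SB) => x k).
  exact: (@proj_continuous _ (fun _ : nat => SB) k).
pose V := (((R * R) * (R * R)) * R)%type.
pose u : SB -> V := susp_emb (@bouquet_emb R).
have cu : continuous u by apply: susp_emb_continuous; exact: bouquet_emb_continuous.
have -> : [set x : prod_topology (fun _ : nat => SB) | susp_map f (x n.+1) = x n] =
    (fun x => u (susp_map f (x n.+1)) - u (x n)) @^-1` [set 0].
  apply/seteqP; split => x /=; first by move=> ->; rewrite subrr.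
  by move=> /eqP; rewrite subr_eq0 => /eqP; exact: (susp_emb_inj (@bouquet_emb_inj R)).
apply: preimage_closed; last first.
  exact: (accessible_closed_set1 (hausdorff_accessible (@norm_hausdorff _ V))).
have c1 : continuous (fun x : prod_topology (fun _ : nat => SB) => u (susp_map f (x n.+1))).
  apply: (comp_continuous (cp n.+1) (g := fun y => u (susp_map f y))).
  exact: (comp_continuous (susp_map_continuous (@bouquet_map_continuous R)) cu).
have c2 : continuous (fun x : prod_topology (fun _ : nat => SB) => u (x n)).
  exact: (comp_continuous (cp n) cu).
by move=> x _; exact: (cvgB (c1 x) (c2 x)).
Qed.

Lemma origin_subproof : ((1 : (R[i])^o), (1 : (R[i])^o)) \in @bouquet_set R.
Proof. by apply/mem_set; left; split => //=; rewrite /circle /= normr1. Qed.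

Definition bouquet_center : B := exist (fun p => p \in @bouquet_set R) _ origin_subproof.

Lemma bouquet_map_center : f bouquet_center = bouquet_center.
Proof.
have [a1 a2 a3 a4] := bouquet_mapE bouquet_center.
have [lx ly] := loop0 R.
have [p0 q0] : phi1 bouquet_center = 0 /\ phi2 bouquet_center = 0.
  by rewrite /phi1 /phi2 /xA /yA /xB /yB /= !subrr.
by apply: bouquet_eq; rewrite ?a1 ?a2 ?a3 ?a4 ?p0 ?q0 ?lx ?ly.
Qed.

Lemma SP_nonempty : [set: SigmaP R] !=set0.
Proof.
have m11 : -1 <= 1 :> R by lra.
have [|x _] := @SP_projS (fun _ => susp_pt (bouquet_center, clamp m11 0)); last by exists x.
by move=> _; rewrite susp_mapE bouquet_map_center.
Qed.

Section Trivial.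
Local Notation I1 := ('I_1 : finGroupType).
Local Notation Y1 := (trivial_gspace 'I_1 SB).
Local Notation X1 := (trivial_gspace 'I_1 (SigmaP R)).

Definition trivial_gmap (A D : topologicalType) (g : A -> D) (cg : continuous g) :
  gmap (trivial_gspace 'I_1 A) (trivial_gspace 'I_1 D) :=
  @GMap 'I_1 (trivial_gspace 'I_1 A) (trivial_gspace 'I_1 D) g cg (fun _ _ => erefl).

Lemma trivial_factorization (K : gspace 'I_1) (h : gmap X1 K) : is_GANR R K ->
  exists n (q : gmap Y1 K), ghomotopic R h (q \og trivial_gmap (@SP_proj_continuous n)).
Proof.
move=> aK; apply: (@tower_factorization R _ X1 Y1 (trivial_gspace 'I_1 (cube R))
  (trivial_gmap (susp_map_continuous (@bouquet_map_continuous R)))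
  (fun n => trivial_gmap (@SP_proj_continuous n)) (trivial_gmap (@cube_emb_continuous R))
  (@cube_contraction R) (@cube_origin R)) => //.
- exact: susp_bouquet_compact.
- exact: cube_compact.
- exact: cube_hausdorff.
- exact: cube_emb_inj.
- exact: SP_projF.
- exact: SP_projI.
- exact: SP_projS.
- exact: SP_compact.
- exact: SP_nonempty.
- exact: cube_contraction_continuous.
- by move=> q t t0; apply: val_inj; rewrite /= t0 subr0 scale1r.
- by move=> q t t1; apply: val_inj; rewrite /= t1 subrr scale0r.
Qed.

End Trivial.

Section Z2.
Local Notation Y2 := (susp_gspace R B).
Local Notation X2 := (SigmaP R).

Definition susp_gmap : gmap Y2 Y2 :=
  @GMap 'Z_2 Y2 Y2 (susp_map f) (susp_map_continuous (@bouquet_map_continuous R))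
    (@susp_map_equivariant R B B f).

Definition SP_gproj n : gmap X2 Y2 :=
  @GMap 'Z_2 X2 Y2 (SP_proj n) (@SP_proj_continuous n) (fun _ _ => erefl).

Definition cube_gspace : gspace 'Z_2 := invol_gspace (@cube_flipK R) (@cube_flip_continuous R).

Lemma cube_emb_equivariant (g : 'Z_2) (y : Y2) :
  cube_emb (gact g y) = gact g (cube_emb y : cube_gspace).
Proof.
rewrite /gact /= /susp_act /invol_act; case: (g == _) => //.
by apply: val_inj; exact: susp_emb_flip.
Qed.

Definition cube_gemb : gmap Y2 cube_gspace :=
  @GMap 'Z_2 Y2 cube_gspace (@cube_emb R) (@cube_emb_continuous R) cube_emb_equivariant.

Let c0 (q : cube R) (t : I01) : \val t = 0 -> cube_contraction (q, t) = q.
Proof. by move=> t0; apply: val_inj; rewrite /= t0 subr0 scale1r. Qed.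

Let c1 (q : cube R) (t : I01) : \val t = 1 -> cube_contraction (q, t) = cube_origin R.
Proof. by move=> t1; apply: val_inj; rewrite /= t1 subrr scale0r. Qed.

Let ceq (g : 'Z_2) (q : cube_gspace) (t : I01) :
  cube_contraction (gact g q, t) = gact g (cube_contraction (q, t) : cube_gspace).
Proof.
rewrite /gact /= /invol_act; case: (g == _) => //; apply: val_inj => /=.
by congr (_, _) => /=; rewrite /GRing.scale /= mulrN.
Qed.

Lemma Z2_factorization (K : gspace 'Z_2) (h : gmap X2 K) : is_GANR R K ->
  exists n (q : gmap Y2 K), ghomotopic R h (q \og SP_gproj n).
Proof.
exact: (@tower_factorization R _ X2 Y2 cube_gspace susp_gmap SP_gproj cube_gemb
  (@cube_contraction R) (@cube_origin R) (@susp_bouquet_compact R) (@cube_compact R)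
  (@cube_hausdorff R) (@cube_emb_inj R) SP_projF SP_projI SP_projS SP_compact SP_nonempty
  (@cube_contraction_continuous R) c0 c1 ceq).
Qed.

Lemma Z2_equalization (K : gspace 'Z_2) (n : nat) (q q' : gmap Y2 K) : is_GANR R K ->
  ghomotopic R (q \og SP_gproj n) (q' \og SP_gproj n) ->
  exists m, ghomotopic R (q \og gmap_iter susp_gmap m) (q' \og gmap_iter susp_gmap m).
Proof.
move=> aK; apply: (@tower_equalization R _ X2 Y2 cube_gspace susp_gmap SP_gproj cube_gemb
  (@cube_contraction R) (@cube_origin R) (@susp_bouquet_compact R) (@cube_compact R)
  (@cube_hausdorff R) (@cube_emb_inj R) SP_projI SP_projS SP_compact SP_nonempty
  c1 ceq) => //.
Qed.

End Z2.
End SolenoidTower.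

(** * Triviality of the shape *)

Section NullHomotopy.
Context (R : realType).
Local Notation B := (bouquet R).
Local Notation SB := (susp R B).
Local Notation J := (cinterval (- 1 : R) 1).
Local Notation I01 := (cinterval (0 : R) 1).
Local Notation V := (((R * R) * (R * R)) * R)%type.
Implicit Types (p q s t a : R).

Definition unit_loop p := loopx p = 1 /\ loopy p = 0.

Definition clip1 (x : R) := Num.max (-1) (Num.min 1 x).
Definition clip0 (x : R) := Num.max 0 (Num.min 1 x).

Lemma clip1_cases (x : R) :
  (x <= -1 /\ clip1 x = -1) \/ (-1 <= x <= 1 /\ clip1 x = x) \/ (1 <= x /\ clip1 x = 1).
Proof.
rewrite /clip1; have [x1|x1] := leP 1 x.
  by right; right; split => //; apply/max_idPr; lra.
have [x2|x2] := leP (-1) x; last by left; split => //; exact: ltW.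
by right; left; split => //; rewrite ltW.
Qed.

Lemma clip1_high (x : R) : 1 <= x -> clip1 x = 1.
Proof. by have := clip1_cases x; lra. Qed.

Lemma clip1_low (x : R) : x <= -1 -> clip1 x = -1.
Proof. by have := clip1_cases x; lra. Qed.

Lemma clip1_bound (x : R) : -1 <= clip1 x <= 1.
Proof. by have := clip1_cases x; lra. Qed.

Lemma clip0_cases (x : R) :
  (x <= 0 /\ clip0 x = 0) \/ (0 <= x <= 1 /\ clip0 x = x) \/ (1 <= x /\ clip0 x = 1).
Proof.
rewrite /clip0; have [x1|x1] := leP 1 x.
  by right; right; split => //; apply/max_idPr; lra.
have [x2|x2] := leP 0 x; last by left; split => //; exact: ltW.
by right; left; split => //; rewrite ltW.
Qed.

Lemma clip1_continuous (X : topologicalType) (f : X -> R) :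
  continuous f -> continuous (fun x => clip1 (f x)).
Proof.
by move=> cf; apply: continuous_maxr;
  [exact: continuous_cst|apply: continuous_minr => //; exact: continuous_cst].
Qed.

Lemma clip0_continuous (X : topologicalType) (f : X -> R) :
  continuous f -> continuous (fun x => clip0 (f x)).
Proof.
by move=> cf; apply: continuous_maxr;
  [exact: continuous_cst|apply: continuous_minr => //; exact: continuous_cst].
Qed.

(* At height [a] the two circles of the bouquet are scaled separately, by [A]
   and [A'], around the same base point. *)
Definition cone_pt (a A A' p q : R) : V :=
  (((1 - `|a| + A * (loopx p - 1), A * loopy p),
    (1 - `|a| + A' * (loopx q - 1), A' * loopy q)), a).

Let u : SB -> V := susp_emb (@bouquet_emb R).

(** The point lies on the double cone as soon as every circle that is away from the base point,
    except possibly one, has radius 0, and the exceptional one has the radius 1 - |a| belonging to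
    its height. *)
Definition cone_valid (a A A' p q : R) :=
  [/\ -1 <= a <= 1, `|p| <= 1, `|q| <= 1 &
  [\/ (unit_loop p \/ A = 0) /\ (unit_loop q \/ A' = 0),
      A = 1 - `|a| /\ (unit_loop q \/ A' = 0)
    | A' = 1 - `|a| /\ (unit_loop p \/ A = 0)]].

Lemma cone_validP (a A A' p q : R) : cone_valid a A A' p q ->
  exists y : SB, u y = cone_pt a A A' p q.
Proof.
move=> [a1 p1 q1 H]; have m11 : -1 <= 1 :> R by lra.
have va : \val (clamp m11 a) = a by exact: val_clamp.
have triv (r A0 : R) : unit_loop r \/ A0 = 0 ->
    A0 * (loopx r - 1) = 0 /\ A0 * loopy r = 0.
  by case=> [[-> ->]| ->]; rewrite ?subrr ?mulr0 ?mul0r.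
have l1 : (1 : R) ^+ 2 + 0 ^+ 2 = 1 by rewrite expr1n expr0n addr0.
have mulE (k x : R) : k *: x = k * x by [].
case: H => [[/triv[e1 e2] /triv[e3 e4]]|[e /triv[e3 e4]]|[e /triv[e1 e2]]].
- exists (susp_pt (bouquet_center R, clamp m11 a)); rewrite /u susp_embE va.
  by rewrite /cone_pt e1 e2 e3 e4 !addr0 /bouquet_emb /xA /yA /xB /yB /=;
    congr (((_, _), (_, _)), _); rewrite ?mulE /= ?mulr1 ?mulr0.
- exists (susp_pt (bouquet_mk (loop_circle p1) l1 (or_intror (conj erefl erefl)), clamp
  m11 a)).
  rewrite /u susp_embE va /cone_pt e3 e4 e /bouquet_emb /xA /yA /xB /yB /=.
  by congr (((_, _), (_, _)), _); rewrite mulE /=; ring.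
- exists (susp_pt (bouquet_mk l1 (loop_circle q1) (or_introl (conj erefl erefl)), clamp
  m11 a)).
  rewrite /u susp_embE va /cone_pt e1 e2 e /bouquet_emb /xA /yA /xB /yB /=.
  by congr (((_, _), (_, _)), _); rewrite mulE /=; ring.
Qed.

(** [collar] is constant for |p| <= 1/4 and for |p| >= 3/4 on each side, so the loop moves only for
    1/4 < |p| < 3/4; there [bump] is 1. At p = 0, 1, -1 [bump] vanishes. *)
Definition collar p := clip0 (2 * p - 1 / 2) - clip0 (- 2 * p - 1 / 2).
Definition bump p := clip0 (Num.min (4 * `|p|) (4 * (1 - `|p|))).
(** On the three thirds of [-1, 1] this runs from -1 to 1, back to -1, and to 1 again. The first
    circle is kept on the first pass and the second circle on the last. *)
Definition zigzag t := clip1 (3 * t + 2) + clip1 (- 3 * t) + clip1 (3 * t - 2).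

Lemma zigzag_low t : t <= - 1 / 3 -> zigzag t = clip1 (3 * t + 2).
Proof. by move=> h; rewrite /zigzag (@clip1_high (- 3 * t)) ?(@clip1_low (3 * t - 2));
  lra. Qed.

Lemma zigzag_high t : 1 / 3 <= t -> zigzag t = clip1 (3 * t - 2).
Proof. by move=> h; rewrite /zigzag (@clip1_low (- 3 * t)) ?(@clip1_high (3 * t + 2));
  lra. Qed.

Lemma zigzag_bound t : -1 <= zigzag t <= 1.
Proof.
have [h|h] := leP t (- 1 / 3); first by rewrite zigzag_low// clip1_bound.
have [h'|h'] := leP (1 / 3) t; first by rewrite zigzag_high// clip1_bound.
rewrite /zigzag (@clip1_high (3 * t + 2)) ?(@clip1_low (3 * t - 2)); try lra.
by have := clip1_bound (- 3 * t); lra.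
Qed.

Lemma unit_loop_int p : p = 0 \/ p = 1 \/ p = -1 -> unit_loop p.
Proof.
case=> [->|[->|->]]; first exact: loop0.
  exact: loop1.
by rewrite /unit_loop loopxN loopyN; have [-> ->] := loop1 R; rewrite oppr0.
Qed.

Lemma collar_int p : p = 0 \/ p = 1 \/ p = -1 -> collar p = p /\ bump p = 0.
Proof.
rewrite /collar /bump => -[->|[->|->]]; rewrite ?normr0 ?normrN ?normr1.
- rewrite !mulr0 subr0 mulr1 (min_idPl _); last by lra.
  by have := clip0_cases (0 - 1/2); have := clip0_cases 0; lra.
- rewrite subrr mulr0 (min_idPr _); last by lra.
  have := clip0_cases (2 * 1 - 1/2); have := clip0_cases (- 2 * 1 - 1/2);
    have := clip0_cases 0; lra.
- rewrite subrr mulr0 (min_idPr _); last by lra.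
  have := clip0_cases (2 * - 1 - 1/2); have := clip0_cases (- 2 * - 1 - 1/2);
    have := clip0_cases 0; lra.
Qed.

Lemma collar_norm p : `|p| <= 1 -> `|collar p| <= 1.
Proof.
rewrite /collar !ler_norml => /andP[? ?]; apply/andP.
have := clip0_cases (2 * p - 1/2); have := clip0_cases (- 2 * p - 1/2); split; lra.
Qed.

Lemma collar_bump p : `|p| <= 1 -> unit_loop (collar p) \/ bump p = 1.
Proof.
move=> p1; rewrite /bump.
have h1 := clip0_cases (2 * p - 1/2); have h2 := clip0_cases (- 2 * p - 1/2).
have big : 1/4 <= `|p| <= 3/4 -> clip0 (Num.min (4 * `|p|) (4 * (1 - `|p|))) = 1.
  move=> /andP[? ?]; have : 1 <= Num.min (4 * `|p|) (4 * (1 - `|p|)).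
    by rewrite le_min; apply/andP; split; lra.
  by have := clip0_cases (Num.min (4 * `|p|) (4 * (1 - `|p|))); lra.
move: p1 big; have [p0|p0] := leP 0 p => p1 big.
  have [e|[e|e]] : p <= 1/4 \/ 3/4 <= p \/ 1/4 <= p <= 3/4 by lra.
  - by left; apply: unit_loop_int; left; rewrite /collar; lra.
  - by left; apply: unit_loop_int; right; left; rewrite /collar; lra.
  - by right; apply: big; rewrite ger0_norm.
have [e|[e|e]] : - p <= 1/4 \/ 3/4 <= - p \/ 1/4 <= - p <= 3/4 by lra.
- by left; apply: unit_loop_int; left; rewrite /collar; lra.
- by left; apply: unit_loop_int; right; right; rewrite /collar; lra.
- by right; apply: big; rewrite ltr0_norm.
Qed.

Section Data.
Context (p q t s : R).

Definition stage_time (i : R) := clip0 (5 * s - i).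
Local Notation s1 := (stage_time 0).
Local Notation s2 := (stage_time 1).
Local Notation s3 := (stage_time 2).
Local Notation s4 := (stage_time 3).
Local Notation s5 := (stage_time 4).

(* The homotopy has five stages. The loop parameters become constant near their
   integral values; the cones over the two circles move to the heights where
   [3 t + 2], resp. [3 t - 2], lies between -1 and 1; the height follows a
   zigzag along which each circle meets only its own range; the loops, which no
   longer interact, are contracted; what remains slides to a pole. *)
Definition null_loop r := (1 - s4) * ((1 - s1) * r + s1 * collar r).
Definition null_heightA := (1 - s2) * t + s2 * clip1 (3 * t + 2).
Definition null_heightB := (1 - s2) * t + s2 * clip1 (3 * t - 2).
Definition null_height := (1 - s5) * ((1 - s3) *
  (t + bump p * (null_heightA - t) + bump q * (null_heightB - t)) + s3 * zigzag t) + s5.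

Let integral (r : R) := r = 0 \/ r = 1 \/ r = -1.

Let stage0 i : 5 * s <= i -> stage_time i = 0.
Proof. by move=> h; rewrite /stage_time; have := clip0_cases (5 * s - i); lra. Qed.

Let stage1 (i : R) : i + 1 <= 5 * s -> stage_time i = 1.
Proof. by move=> h; rewrite /stage_time; have := clip0_cases (5 * s - i); lra. Qed.

Let stage_cases : [\/ s2 = 0 /\ s3 = 0 /\ s4 = 0 /\ s5 = 0,
   s1 = 1 /\ s3 = 0 /\ s4 = 0 /\ s5 = 0,
   s1 = 1 /\ s2 = 1 /\ s4 = 0 /\ s5 = 0 |
   (s1 = 1 /\ s2 = 1 /\ s3 = 1 /\ s5 = 0) \/ (s2 = 1 /\ s3 = 1 /\ s4 = 1)].
Proof.
have [h1|h1] := leP (5 * s) 1.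
  by apply: Or41; rewrite !stage0//; lra.
have [h2|h2] := leP (5 * s) 2.
  by apply: Or42; rewrite (@stage1 0) ?stage0//; lra.
have [h3|h3] := leP (5 * s) 3.
  by apply: Or43; rewrite (@stage1 0) ?(@stage1 1) ?stage0//; lra.
have [h4|h4] := leP (5 * s) 4; apply: Or44; [left|right].
  by rewrite (@stage1 0) ?(@stage1 1) ?(@stage1 2) ?stage0//; lra.
by rewrite (@stage1 1) ?(@stage1 2) ?(@stage1 3)//; lra.
Qed.

(** In each of the five stages a loop away from the base point must find itself at the height
    matching its radius, or have radius 0. That one of [p], [q] is integral keeps the two loops from
    being active together until their heights are disjoint. *)
Lemma null_valid : -1 <= t <= 1 -> `|p| <= 1 -> `|q| <= 1 ->
  integral p \/ integral q ->
  cone_valid null_height (1 - `|null_heightA|) (1 - `|null_heightB|)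
    (null_loop p) (null_loop q).
Proof.
move=> t1 p1 q1 pq; have c1 := clip1_bound; have m11 : -1 <= (1 : R) <= 1 by apply/andP;
  split; lra.
have lo (r : R) : r <= 1 / 3 -> 3 * r - 2 <= -1 by lra.
have hi (r : R) : - 1 / 3 <= r -> 1 <= 3 * r + 2 by lra.
have third : - 1 / 3 <= 1 / 3 :> R by lra.
have b01 r : 0 <= bump r <= 1 by have := clip0_cases (Num.min (4 * `|r|) (4 * (1 -
  `|r|))); rewrite /bump; lra.
have bpq : bump p = 0 \/ bump q = 0.
  by case: pq => [/collar_int[_ ->]|/collar_int[_ ->]]; [left|right].
have st i : 0 <= stage_time i <= 1 by have := clip0_cases (5 * s - i);
  rewrite /stage_time; lra.
have conv k a b : 0 <= k <= 1 -> -1 <= a <= 1 -> -1 <= b <= 1 -> -1 <= (1 - k) * a + k *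
  b <= 1.
  by move=> /andP[? ?] /andP[? ?] /andP[? ?]; apply/andP; split; nra.
have hA : -1 <= null_heightA <= 1 by exact: conv.
have hB : -1 <= null_heightB <= 1 by exact: conv.
have hz := zigzag_bound t.
have h0 : -1 <= t + bump p * (null_heightA - t) + bump q * (null_heightB - t) <= 1.
  have cc k a : 0 <= k <= 1 -> -1 <= a <= 1 -> -1 <= t + k * (a - t) <= 1.
    by move=> ? ?; have := conv k t a;
      rewrite (_ : (1 - k) * t + k * a = t + k * (a - t)); [apply|ring].
  by case: bpq => ->; rewrite mul0r ?addr0; exact: cc.
have loop_norm r : `|r| <= 1 -> `|null_loop r| <= 1.
  move=> r1; have r1' : -1 <= r <= 1 by rewrite -ler_norml.
  have k1 : -1 <= collar r <= 1 by rewrite -ler_norml collar_norm.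
  have /andP[? ?] := conv _ _ _ (st 0) r1' k1; have /andP[? ?] := st 3.
  by rewrite ler_norml /null_loop; apply/andP; split; nra.
split; [|exact: loop_norm|exact: loop_norm|].
  have := conv _ _ _ (st 4) (conv _ _ _ (st 2) h0 hz) m11.
  by rewrite mulr1.
have collar_unit r : integral r -> unit_loop (collar r).
  by move=> ir; have [-> _] := collar_int ir; exact: unit_loop_int.
case: stage_cases => [[e2 [e3 [e4 e5]]]|[e1 [e3 [e4 e5]]]|[e1 [e2 [e4 e5]]]|[[e1 [e2 [e3
  e5]]]|[e2 [e3 e4]]]].
(* First stage: the heights have not moved, and an integral parameter stays put because [collar]
   fixes it. *)
- have eA : null_heightA = t by rewrite /null_heightA e2; ring.
  have eB : null_heightB = t by rewrite /null_heightB e2; ring.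
  have eh : null_height = t by rewrite /null_height e3 e5 eA eB; ring.
  have il r : integral r -> unit_loop (null_loop r).
    move=> ir; rewrite /null_loop e4 (collar_int ir).1.
    by rewrite (_ : (1 - 0) * _ = r); [exact: unit_loop_int|ring].
  rewrite eh eA eB; case: pq => [/il ip|/il iq]; [apply: Or33|apply: Or32]; split => //;
    by left.
(* Second stage: if one loop is active, its bump is 1 and the other is 0, so the height is exactly
   the one assigned to that circle. *)
- have lE r : null_loop r = collar r by rewrite /null_loop e1 e4; ring.
  rewrite !lE; case: (collar_bump p1) => [up|bp].
    case: (collar_bump q1) => [uq|bq]; first by apply: Or31; split; left.
    apply: Or33; split; last by left.
    have bp : bump p = 0 by case: bpq => //; rewrite bq => /eqP; rewrite oner_eq0.
    by congr (1 - `|_|); rewrite /null_height e3 e5 bp bq; ring.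
  have bq : bump q = 0 by case: bpq => //; rewrite bp => /eqP; rewrite oner_eq0.
  apply: Or32; split.
    by congr (1 - `|_|); rewrite /null_height e3 e5 bp bq; ring.
  left; case: pq => [/collar_int[_]|/collar_unit//].
  by rewrite bp => /eqP; rewrite oner_eq0.
(* Third stage: outside its own third a circle has radius 0, and inside it the zigzag has the height
   already reached. *)
- have lE r : null_loop r = collar r by rewrite /null_loop e1 e4; ring.
  have eA : null_heightA = clip1 (3 * t + 2) by rewrite /null_heightA e2; ring.
  have eB : null_heightB = clip1 (3 * t - 2) by rewrite /null_heightB e2; ring.
  rewrite !lE; case: (collar_bump p1) => [up|bp].
    case: (collar_bump q1) => [uq|bq]; first by apply: Or31; split; left.
    have bp : bump p = 0 by case: bpq => //; rewrite bq => /eqP; rewrite oner_eq0.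
    have [t13|t13] := leP t (1 / 3).
      apply: Or31; split; [by left|right]; rewrite eB clip1_low; last exact: lo.
      by rewrite normrN normr1 subrr.
    apply: Or33; split; [|by left]; congr (1 - `|_|).
    have zE := zigzag_high (ltW t13).
    by rewrite /null_height e5 bp bq zE eB; ring.
  have bq : bump q = 0 by case: bpq => //; rewrite bp => /eqP; rewrite oner_eq0.
  have uq : unit_loop (collar q).
    by case: pq => [/collar_int[_]|/collar_unit//]; rewrite bp => /eqP; rewrite oner_eq0.
  have [t13|t13] := leP (- 1 / 3) t.
    apply: Or31; split; [right|by left]; rewrite eA clip1_high; last exact: hi.
    by rewrite normr1 subrr.
  apply: Or32; split; [|by left]; congr (1 - `|_|).
  have zE := zigzag_low (ltW t13).
  by rewrite /null_height e5 bp bq zE eA; ring.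
(* Fourth stage: at every height at least one radius vanishes, so the loops are deformed
   independently. *)
- have eA : null_heightA = clip1 (3 * t + 2) by rewrite /null_heightA e2; ring.
  have eB : null_heightB = clip1 (3 * t - 2) by rewrite /null_heightB e2; ring.
  have eh : null_height = zigzag t by rewrite /null_height e3 e5; ring.
  have oA : - 1 / 3 <= t -> 1 - `|null_heightA| = 0.
    by move=> /hi tt; rewrite eA clip1_high// normr1 subrr.
  have oB : t <= 1 / 3 -> 1 - `|null_heightB| = 0.
    by move=> /lo tt; rewrite eB clip1_low// normrN normr1 subrr.
  have [t13|t13] := leP t (- 1 / 3).
    apply: Or32; split; last by right; apply: oB; exact: le_trans third.
    by rewrite eh eA zigzag_low.
  have [t13'|t13'] := leP (1 / 3) t.
    apply: Or33; split; last by right; apply: oA; exact: le_trans t13'.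
    by rewrite eh eB zigzag_high.
  by apply: Or31; split; right; [exact: oA (ltW t13)|exact: oB (ltW t13')].
- have l0 r : null_loop r = 0 by rewrite /null_loop e4; ring.
  by apply: Or31; rewrite !l0; split; left; apply: unit_loop_int; left.
Qed.

End Data.

Lemma phi_norm (b : B) : `|phi1 b| <= 1 /\ `|phi2 b| <= 1.
Proof.
have [w [v [r [wv -> -> _ rE]]]] := bouquet_branch b.
have r1 : `|r| = 1 by case: rE => -[-> _]; rewrite ?normrN normr1.
have w2 : `|w ^+ 2| <= 1 by rewrite ger0_norm ?sqr_ge0// -wv lerDl sqr_ge0.
have v2 : `|v ^+ 2| <= 1 by rewrite ger0_norm ?sqr_ge0// -wv lerDr sqr_ge0.
by rewrite !normrM r1 !mul1r; case: (quarterP wv) => -[_ _ -> ->]; rewrite ?normr0 ?normr1.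
Qed.

(** On every quarter of either circle one of the two parameters is constant, equal to 0, 1 or -1. *)
Lemma phi_integral (b : B) : (phi1 b = 0 \/ phi1 b = 1 \/ phi1 b = -1) \/
  (phi2 b = 0 \/ phi2 b = 1 \/ phi2 b = -1).
Proof.
have [w [v [r [wv -> -> _ rE]]]] := bouquet_branch b.
have r1 : r = 1 \/ r = -1 by case: rE => -[-> _]; [left|right].
by case: (quarterP wv) => -[_ _ -> ->]; rewrite ?mulr0 ?mulr1; tauto.
Qed.

Lemma null_cone_pt_continuous (X : topologicalType) (p q t s : X -> R) :
  continuous p -> continuous q -> continuous t -> continuous s ->
  continuous (fun d => cone_pt (null_height (p d) (q d) (t d) (s d))
    (1 - `|null_heightA (t d) (s d)|) (1 - `|null_heightB (t d) (s d)|)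
    (null_loop (s d) (p d)) (null_loop (s d) (q d))).
Proof.
move=> cp cq ct cs.
have cc (k : R) : continuous (fun _ : X => k) by exact: continuous_cst.
have cD := @continuous_addr R X; have cS := @continuous_subr R X.
have cM := @continuous_mulr R X; have cN := @continuous_oppr R X.
have cst i : continuous (fun d => stage_time (s d) i).
  by apply: clip0_continuous; apply: (cS) => //; exact: (cM).
have ccol f : continuous f -> continuous (fun d : X => collar (f d)).
  move=> cf; apply: (cS); apply: clip0_continuous; apply: (cS) => //; exact: (cM).
have cbump f : continuous f -> continuous (fun d : X => bump (f d)).
  move=> cf; have cn := continuous_normr cf.
  by apply: clip0_continuous; apply: continuous_minr; apply: (cM) => //; exact: (cS).
have cl f : continuous f -> continuous (fun d => null_loop (s d) (f d)).
  move=> cf; apply: (cM); first exact: (cS).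
  by apply: (cD); apply: (cM) => //; [exact: (cS)|exact: (ccol)].
have c3 k : continuous (fun d => 3 * t d + k) by apply: (cD) => //; exact: (cM).
have cA : continuous (fun d => null_heightA (t d) (s d)).
  by apply: (cD); apply: (cM) => //; [exact: (cS)|exact: clip1_continuous].
have cBB : continuous (fun d => null_heightB (t d) (s d)).
  by apply: (cD); apply: (cM) => //; [exact: (cS)|apply: clip1_continuous; exact: (c3)].
have cz : continuous (fun d => zigzag (t d)).
  apply: (cD); last by apply: clip1_continuous; exact: (c3).
  apply: (cD); first by apply: clip1_continuous; exact: (c3).
  by apply: clip1_continuous; exact: (cM).
have ch : continuous (fun d => null_height (p d) (q d) (t d) (s d)).
  apply: (cD) => //; apply: (cM); first exact: (cS).
  apply: (cD); last exact: (cM).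
  apply: (cM); first exact: (cS).
  apply: (cD); last by apply: (cM); [exact: (cbump)|exact: (cS)].
  by apply: (cD) => //; apply: (cM); [exact: (cbump)|exact: (cS)].
have cnh : continuous (fun d => 1 - `|null_height (p d) (q d) (t d) (s d)|).
  by apply: (cS) => //; exact: continuous_normr.
have cnA : continuous (fun d => 1 - `|null_heightA (t d) (s d)|).
  by apply: (cS) => //; exact: continuous_normr.
have cnB : continuous (fun d => 1 - `|null_heightB (t d) (s d)|).
  by apply: (cS) => //; exact: continuous_normr.
apply: pair_continuous => //; apply: pair_continuous; apply: pair_continuous.
- by apply: (cD) => //; apply: (cM) => //; apply: (cS) => //; apply: loopx_continuous;
  exact: (cl).
- by apply: (cM) => //; apply: loopy_continuous; exact: (cl).
- by apply: (cD) => //; apply: (cM) => //; apply: (cS) => //; apply: loopx_continuous;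
  exact: (cl).
- by apply: (cM) => //; apply: loopy_continuous; exact: (cl).
Qed.

Let D := ((B * J) * I01)%type.
Let dp (d : D) := phi1 d.1.1.
Let dq (d : D) := phi2 d.1.1.
Let dt (d : D) : R := \val d.1.2.
Let ds (d : D) : R := \val d.2.

Let null_cone (d : D) : V := cone_pt (null_height (dp d) (dq d) (dt d) (ds d))
  (1 - `|null_heightA (dt d) (ds d)|) (1 - `|null_heightB (dt d) (ds d)|)
  (null_loop (ds d) (dp d)) (null_loop (ds d) (dq d)).

Let null_coneP (d : D) : exists y : SB, u y = null_cone d.
Proof.
apply: cone_validP; have [p1 q1] := phi_norm d.1.1; apply: null_valid => //.
  exact: cinterval_bounds.
exact: phi_integral.
Qed.

Let null_map (d : D) : SB := sval (cid (null_coneP d)).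

Let u_null_map d : u (null_map d) = null_cone d.
Proof. by rewrite /null_map; case: cid. Qed.

Let uI : injective u. Proof. exact: (susp_emb_inj (@bouquet_emb_inj R)). Qed.

Let null_cone_continuous : continuous null_cone.
Proof.
have cB : continuous (fun d : D => d.1.1) := comp_continuous (@fst_continuous _ _)
  (@fst_continuous _ _).
apply: null_cone_pt_continuous.
- exact: (comp_continuous cB (@phi1_continuous R)).
- exact: (comp_continuous cB (@phi2_continuous R)).
- exact: (comp_continuous (comp_continuous (@fst_continuous (B * J)%type I01)
  (@snd_continuous B J))
    (@cinterval_val_continuous R _ _)).
- exact: (comp_continuous (@snd_continuous (B * J)%type I01) (@cinterval_val_continuous R
  _ _)).
Qed.

(** [null_map] is chosen pointwise, yet continuous because its composite with the embedding [u]
    is. *)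
Let null_map_continuous : continuous null_map.
Proof.
apply: (compact_embedding_lift (@susp_bouquet_compact R) (@norm_hausdorff _ V)
  (susp_emb_continuous (@bouquet_emb_continuous R)) uI).
by rewrite (_ : _ \o _ = null_cone)//; apply/funext => d; exact: u_null_map.
Qed.

(** At t = 1 and t = -1 both radii vanish and the height does not depend on the point of B, so the
    map descends to the suspension. *)
Let null_map_rel (x x' : B) (t t' : J) (s : I01) :
  susp_rel (x, t) (x', t') -> null_map ((x, t), s) = null_map ((x', t'), s).
Proof.
move=> /or3P[/eqP[-> ->]//|/=|/=] /andP[/eqP t1 /eqP t1'].
  apply: uI; rewrite !u_null_map /null_cone /dp /dq /dt /ds /= t1 t1'.
  have eA (s' : R) : null_heightA 1 s' = 1.
    by rewrite /null_heightA clip1_high; [ring|lra].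
  have eB (s' : R) : null_heightB 1 s' = 1.
    by rewrite /null_heightB clip1_high; [ring|lra].
  have eh p q (s' : R) : null_height p q 1 s' = (1 - stage_time s' 4) * ((1 - stage_time
    s' 2) + stage_time s' 2 * zigzag 1) + stage_time s' 4.
    by rewrite /null_height eA eB; ring.
  by rewrite !eh !eA !eB /cone_pt normr1 subrr !mul0r.
apply: uI; rewrite !u_null_map /null_cone /dp /dq /dt /ds /= t1 t1'.
have eA (s' : R) : null_heightA (- 1) s' = - 1.
  by rewrite /null_heightA clip1_low; [ring|lra].
have eB (s' : R) : null_heightB (- 1) s' = - 1.
  by rewrite /null_heightB clip1_low; [ring|lra].
have eh p q (s' : R) : null_height p q (- 1) s' = (1 - stage_time s' 4) * (- (1 -
  stage_time s' 2) + stage_time s' 2 * zigzag (- 1)) + stage_time s' 4.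
  by rewrite /null_height eA eB; ring.
by rewrite !eh !eA !eB /cone_pt normrN normr1 subrr !mul0r.
Qed.

Let H (ys : SB * I01) : SB := null_map (repr (ys.1 : {eq_quot susp_equiv R B}), ys.2).

Let HE (x : B) (t : J) (s : I01) : H (susp_pt (x, t), s) = null_map ((x, t), s).
Proof.
rewrite /H /=.
have : susp_pt (repr (susp_pt (x, t) : {eq_quot susp_equiv R B})) =
  susp_pt (x, t) by rewrite /susp_pt reprK.
by case: (repr _) => x' t' /susp_pt_eq /null_map_rel ->.
Qed.

Let m11 : -1 <= 1 :> R. Proof. lra. Qed.

Definition susp_north : SB := susp_pt (bouquet_center R, clamp m11 1).

(** The homotopy treats the two circles at opposite heights and ends at one pole, so it breaks the
    symmetry t -> -t and gives no equivariant information. *)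
Lemma susp_map_nullhomotopic : exists H : SB * I01 -> SB,
  [/\ continuous H,
    forall (y : SB) (s : I01), \val s = 0 -> H (y, s) = susp_map (@bouquet_map R) y
  & forall (y : SB) (s : I01), \val s = 1 -> H (y, s) = susp_north].
Proof.
exists H; split.
- apply: susp_cylinder_continuous.
  + exact: bouquet_compact.
  + exact: susp_bouquet_hausdorff.
  + rewrite (_ : (fun d : D => H (susp_pt d.1, d.2)) = null_map);
    first exact: null_map_continuous.
    by apply/funext => -[[x t] s]; exact: HE.
- move=> y s s0; have [[x t] ->] := susp_ptP y; rewrite HE susp_mapE.
  apply: uI; rewrite u_null_map /u susp_embE /null_cone /dp /dq /dt /ds /= s0.
  have st i : 0 <= i -> stage_time 0 i = 0.
    by move=> i0; have := clip0_cases (5 * 0 - i); rewrite /stage_time; lra.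
  have s1 := st 0 (lexx _); have s2 := st 1 ler01;
    have s3 : stage_time 0 2 = 0 by apply: st; lra.
  have s4 : stage_time 0 3 = 0 by apply: st; lra.
  have s5 : stage_time 0 4 = 0 by apply: st; lra.
  have eA : null_heightA (\val t) 0 = \val t by rewrite /null_heightA s2; ring.
  have eB : null_heightB (\val t) 0 = \val t by rewrite /null_heightB s2; ring.
  have eh : null_height (phi1 x) (phi2 x) (\val t) 0 = \val t.
    by rewrite /null_height s3 s5 eA eB; ring.
  have el r : null_loop 0 r = r by rewrite /null_loop s4 s1; ring.
  rewrite eA eB eh !el /cone_pt /bouquet_emb; have [-> -> -> ->] := bouquet_mapE x.
  have mulE (k z : R) : k *: z = k * z by [].
  by congr (((_, _), (_, _)), _); rewrite mulE /=; ring.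
- move=> y s s1'; have [[x t] ->] := susp_ptP y; rewrite HE.
  apply: uI; rewrite u_null_map /u /susp_north susp_embE val_clamp; last by lra.
  rewrite /null_cone /dp /dq /dt /ds /= s1'.
  have st i : i <= 4 -> stage_time 1 i = 1.
    by move=> i0; have := clip0_cases (5 * 1 - i); rewrite /stage_time; lra.
  have s4 : stage_time 1 3 = 1 by apply: st; lra.
  have s5 : stage_time 1 4 = 1 by apply: st; lra.
  have eh : null_height (phi1 x) (phi2 x) (\val t) 1 = 1 by rewrite /null_height s5; ring.
  have el r : null_loop 1 r = 0 by rewrite /null_loop s4; ring.
  have [lx ly] := loop0 R.
  by rewrite eh !el /cone_pt lx ly !subrr !mulr0 normr1 subrr scale0r addr0.
Qed.

End NullHomotopy.

(** * The one-point system *)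

Definition one_point (R : realType) : Type := unit.

Section OnePoint.
Context (R : realType).

HB.instance Definition _ := Choice.copy (one_point R) unit.

Let dist (x y : one_point R) : R := 0.

Let dist_positivity (x y : one_point R) : dist x y = 0 -> x = y.
Proof. by case: x; case: y. Qed.

Let dist_triangle (y x z : one_point R) : dist x z <= dist x y + dist y z.
Proof. by rewrite /dist addr0. Qed.

HB.instance Definition _ := @isMetric.Build R (one_point R) dist
  (fun _ => erefl) dist_positivity (fun _ _ => erefl) dist_triangle.

End OnePoint.

Section TrivialShape.
Context (R : realType).
Local Notation pt := (trivial_gspace 'I_1 (discrete_topology unit)).
Local Notation homotopic := (@ghomotopic R _ _ _).

Let pt_eq (x y : pt) : x = y. Proof. by case: x; case: y. Qed.

Lemma unit_p_paracompact : p_paracompact R (discrete_topology unit).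
Proof.
split; first by move=> x y _; exact: (pt_eq x y).
exists (one_point R), (fun=> tt); split.
- exact: continuous_cst.
- by move=> [] _; exists tt.
- by move=> A _; apply: pconst_closed; exact: metric_hausdorff.
- by move=> y; apply: finite_compact; exact: finite_finset.
Qed.

Lemma unit_GANR : is_GANR R pt.
Proof.
split; first exact: unit_p_paracompact.
move=> Z i _ _; exists setT, (fun=> tt); split => //.
- by rewrite interiorT.
- exact: continuous_cst.
Qed.

Definition unit_system : inverse_gsystem R 'I_1 :=
  @InverseGSystem R 'I_1 unit (fun _ _ => True) (inhabits tt) (fun _ => Logic.I)
    (fun _ _ _ _ _ => Logic.I) (fun _ _ => ex_intro _ tt (conj Logic.I Logic.I))
    (fun _ => pt) (fun _ _ _ => gmap_id pt)
    (fun _ _ => ghomotopic_refl R (gmap_id pt))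
    (fun _ _ _ _ _ _ => ghomotopic_ext R (fun _ => erefl)).

Lemma unit_system_GANR : GANR_system unit_system.
Proof. by move=> a; exact: unit_GANR. Qed.

Definition const_gmap (X K : topologicalType) (k : K) :
  gmap (trivial_gspace 'I_1 X) (trivial_gspace 'I_1 K) :=
  trivial_gmap (@continuous_cst X K k).

(** The factorization condition is the hypothesis. For the other one, a homotopy between two maps
    factoring through the point, restricted to [x0], is a homotopy on the point itself. *)
Lemma unit_system_associated (X : topologicalType) (x0 : X) :
  (forall (K : gspace 'I_1) (h : gmap (trivial_gspace 'I_1 X) K), is_GANR R K ->
    exists f : gmap pt K, forall p : gmap (trivial_gspace 'I_1 X) pt, homotopic h (f \og p)) ->
  associated (trivial_gspace 'I_1 X) unit_system.
Proof.
move=> nullX; pose p : gmap (trivial_gspace 'I_1 X) pt := const_gmap X (tt :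
  discrete_topology unit).
exists (fun _ => p); split=> [a a' l|K aK]; first exact: ghomotopic_ext.
split=> [h|a f f' [H [cH eH H0 H1]]].
  by have [f hf] := nullX K h aK; exists tt, f; exact: hf.
exists tt, Logic.I; exists (fun xt => H (x0, xt.2)); split.
- apply: (comp_continuous (f := fun xt => (x0, xt.2))) cH.
  by apply: pair_continuous; [exact: continuous_cst|exact: snd_continuous].
- by move=> g x t /=; rewrite -eH.
- by move=> x t t0; rewrite H0//=; congr (f _); exact: pt_eq.
- by move=> x t t1; rewrite H1//=; congr (f' _); exact: pt_eq.
Qed.

Lemma trivial_act (K : gspace 'I_1) (g : 'I_1) (x : K) : gact g x = x.
Proof. by rewrite (_ : g = 1%g) ?gact1// [g]ord1 [1%g]ord1. Qed.

Lemma pt_gmap (K : gspace 'I_1) (k : K) : exists f : gmap pt K, forall x, f x = k.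
Proof.
by exists (@GMap 'I_1 pt K (fun=> k) (@continuous_cst _ _ k) (fun g _ => esym
  (trivial_act g k))).
Qed.

Lemma pro_isomorphic_refl (S : inverse_gsystem R 'I_1) : pro_isomorphic S S.
Proof.
have coh (b b' : sys_index S) (l : sys_le b b') : exists a (l1 : sys_le b a) (l2 : sys_le
  b' a),
    ghomotopic R (gmap_id (S b) \og bond l1) (bond l \og (gmap_id (S b') \og bond l2)).
  exists b', l, (sys_refl b'); apply: ghomotopic_trans.
    apply: ghomotopic_trans (ghomotopic_sym (bond_comp l (sys_refl b') l)).
    exact: ghomotopic_ext.
  exact: ghomotopic_ext.
pose h := @SystemMap R 'I_1 S S id (fun b => gmap_id (S b)) coh.
have r : pro_retract h h.
  by move=> a; exists a, (sys_refl a), (sys_refl a); exact: ghomotopic_ext.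
by exists h, h.
Qed.

(** A map to an ANR factors through stage n up to homotopy, hence through the null homotopic bonding
    map from stage n + 1. Thus one and the same system is associated with both spaces. *)
Lemma SigmaP_trivial_shape : trivial_shape R (SigmaP R).
Proof.
exists unit_system, unit_system; split.
- exact: unit_system_GANR.
- have [x0 _] := SP_nonempty R; apply: (unit_system_associated x0) => K h aK.
  have [n [q hq]] := trivial_factorization h aK.
  have [f fE] := pt_gmap (q (susp_north R)); exists f => p.
  apply: ghomotopic_trans hq _.
  have [H [cH H0 H1]] := susp_map_nullhomotopic R.
  exists (fun xt => q (H (SP_proj n.+1 xt.1, xt.2))); split.
  + apply: comp_continuous (@gmap_continuous _ _ _ q).
    apply: comp_continuous cH; apply: pair_continuous; last exact: snd_continuous.
    exact: (comp_continuous (@fst_continuous _ _) (@SP_proj_continuous R n.+1)).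
  + by move=> g x t; rewrite [RHS]trivial_act.
  + by move=> x t t0; rewrite H0// SP_projF.
  + by move=> x t t1; rewrite H1//= fE.
- exact: unit_system_GANR.
- apply: (@unit_system_associated _ (tt : discrete_topology unit)) => K h aK.
  have [f fE] := pt_gmap (h tt); exists f => p; apply: ghomotopic_ext => x.
  by rewrite /= fE; congr (h _); exact: pt_eq.
- exact: pro_isomorphic_refl.
Qed.

End TrivialShape.

(** * Movability and graph neighborhoods *)

Section BoundedExtension.
Context (R : realType).

Definition bounded_extensor (V : normedModType R) :=
  forall (X : topologicalType) (A : set X) (f : X -> V) (M : R),
    normal_space X -> closed A -> {within A, continuous f} ->
    (forall x, A x -> `|f x| <= M) ->
    exists g : X -> V, continuous g /\ forall x, A x -> g x = f x.

Lemma real_bounded_extensor : bounded_extensor R.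
Proof.
move=> X A f M nX cA cf fM.
have M0 : 0 < Num.max M 1 by rewrite lt_max ltr01 orbT.
have [|g [gf cg _]] := continuous_bounded_extension nX cA M0 cf.
  by move=> x Ax; rewrite le_max fM.
by exists g; split => // x /mem_set Ax; rewrite gf.
Qed.

Lemma prod_bounded_extensor (V W : normedModType R) :
  bounded_extensor V -> bounded_extensor W -> bounded_extensor (V * W)%type.
Proof.
move=> eV eW X A f M nX cA cf fM.
have [|g [cg gf]] := eV X A (fun x => (f x).1) M nX cA (comp_continuous cf
  (@fst_continuous V W)).
  by move=> x /fM; rewrite prod_normE ge_max => /andP[].
have [|h [ch hf]] := eW X A (fun x => (f x).2) M nX cA (comp_continuous cf
  (@snd_continuous V W)).
  by move=> x /fM; rewrite prod_normE ge_max => /andP[].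
exists (fun x => (g x, h x)); split; first exact: pair_continuous.
by move=> x Ax; rewrite gf// hf//; case: (f x).
Qed.

End BoundedExtension.

Section SubsetMetric.
Context (R : realType) (V : normedModType R) (W : set V).

Definition metric_subset : Type := set_type W.

HB.instance Definition _ := Choice.copy metric_subset (set_type W).

Let sval_ (x : metric_subset) : V := \val (x : set_type W).

Let dist (x y : metric_subset) : R := `|sval_ x - sval_ y|.

Let distxx x : dist x x = 0. Proof. by rewrite /dist subrr normr0. Qed.

Let dist_positivity x y : dist x y = 0 -> x = y.
Proof. by move=> /normr0_eq0/eqP; rewrite subr_eq0 => /eqP/val_inj. Qed.

Let dist_sym x y : dist x y = dist y x. Proof. exact: distrC. Qed.

Let dist_triangle y x z : dist x z <= dist x y + dist y z.
Proof. exact: ler_distD. Qed.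

HB.instance Definition _ := @isMetric.Build R metric_subset dist distxx
  dist_positivity dist_sym dist_triangle.

Lemma subset_p_paracompact : p_paracompact R (set_type W).
Proof.
split.
  apply: (@initial_hausdorff _ V (\val : set_type W -> V)); last exact: val_inj.
    exact: norm_hausdorff.
  exact: initial_continuous.
have cv : continuous (\val : set_type W -> V) by exact: initial_continuous.
pose q (x : set_type W) : metric_subset := x.
have cq : continuous q.
  move=> x U; rewrite /= -nbhs_ballE => -[e /= e0]; rewrite ballEmdist => eU.
  have : \forall y \near x, `|\val x - \val y| < e.
    by have /cvgrPdist_lt := cv x; apply.
  by apply: (@filterS _ (nbhs x) (nbhs_filter x)) => y xy; exact: eU.
pose q' (x : metric_subset) : set_type W := x.
have cq' : continuous q'.
  apply: continuous_comp_initial => x.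
  apply/(@cvgrPdist_lt R V metric_subset (nbhs x)) => e e0.
  by rewrite /prop_near1 -nbhs_ballE; exists e => //; rewrite ballEmdist.
exists metric_subset, q; split; first exact: cq.
- by move=> y _; exists y.
- move=> A cA; rewrite (_ : q @` A = q' @^-1` A).
    by apply: preimage_closed => // x _; exact: cq'.
  by apply/seteqP; split => [_ [x Ax <-]//|x Ax]; exists x.
- move=> y; rewrite (_ : q @^-1` [set y] = [set y]) //; exact: compact_set1.
Qed.

End SubsetMetric.

Section TestSpace.
Context (R : realType) (V : normedModType R) (s : V -> V) (W : set V).
Hypotheses (extV : bounded_extensor V) (sK : involutive s) (cs : continuous s).
Hypotheses (sD : forall v w, s (v + w) = s v + s w)
  (sZ : forall k v, s (k *: v) = k *: s v).
Hypotheses (oW : open W) (sW : forall v, W v -> W (s v)).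
Hypothesis (bW : exists M, forall v, W v -> `|v| <= M).

Lemma subset_invol_subproof (v : set_type W) : s (\val v) \in W.
Proof. by apply/mem_set/sW/set_mem/valP. Qed.

Definition subset_invol (v : set_type W) : set_type W :=
  exist (fun v => v \in W) _ (subset_invol_subproof v).

Lemma subset_involK : involutive subset_invol.
Proof. by move=> v; apply: val_inj => /=; rewrite sK. Qed.

Lemma subset_invol_continuous : continuous subset_invol.
Proof.
apply: continuous_comp_initial.
by apply: (comp_continuous (@initial_continuous _ _ _) cs).
Qed.

Definition test_space : gspace 'Z_2 :=
  invol_gspace subset_involK subset_invol_continuous.

(** Given a closed embedding of [W] in [Z], Tietze extends its inverse to a map from [Z] to [V], as
    [Z] is normal and [W] bounded. Averaging over the group makes the extension equivariant, since
    [s] is linear, and the preimage of the open set [W] is the neighborhood that retracts. *)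
Lemma test_space_GANR : is_GANR R test_space.
Proof.
split; first exact: subset_p_paracompact.
move=> Z i pZ [iI icl]; have nZ := p_paracompact_normal pZ.
have [[w0 _]|W0] := pselect ([set: set_type W] !=set0); last first.
  exists set0; have nU (u : set_type (set0 : set Z)) : False by have := set_mem (valP u).
  exists (fun u => False_rect _ (nU u)); split.
  - by move=> z [w _ wz]; case: W0; exists w.
  - by [].
  - by move=> u; case: (nU u).
  - by move=> g u; case: (nU u).
  - by move=> y u; case: (nU u).
pose inv (z : Z) : set_type W := xget w0 [set w | i w = z].
have iK : cancel i inv.
  by move=> w; apply: iI; exact: (@xgetPex _ _ [set y | i y = i w] (ex_intro _ w erefl)).
pose A := range i.
have cA : closed A by apply: icl; exact: closedT.
have cinv : {within A, continuous (fun z => \val (inv z) : V)}.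
  apply/continuous_closedP => F cF; apply/closed_subspaceP.
  exists (i @` ((fun w : set_type W => \val w : V) @^-1` F)).
    by apply: icl; apply: preimage_closed => // x _; exact: initial_continuous.
  apply/seteqP; split => t.
    move=> [[x Fx <-] _]; split; last by exists x.
    by change (F (\val (inv (i x)))); rewrite iK.
  move=> [Ft [x _ xt]]; have {Ft} : F (\val (inv t)) by [].
  by rewrite -xt iK => Fx; split; exists x.
have [M WM] := bW.
have [|Psi [cPsi PsiA]] := extV (M := M) nZ cA cinv.
  by move=> z _; apply: WM; exact: set_mem (valP (inv z)).
have Psii w : Psi (i w) = \val w by rewrite PsiA ?iK//; exists w.
pose gen : 'Z_2 := 1.
have Z2E (k : 'Z_2) : k = 1%g \/ k = gen.
  by case: k => -[|[|//]] ?; [left|right]; apply: val_inj.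
have genE (w : test_space) : gact gen w = subset_invol w by [].
have gengen : (gen * gen = 1)%g by apply: val_inj.
pose Phi (z : Z) : V := (1/2 : R) *: (Psi z + s (Psi (gact gen z))).
have cPhi : continuous Phi.
  have c1 : continuous (fun z => s (Psi (gact gen z))).
    apply: comp_continuous cs; apply: comp_continuous cPsi; exact: gact_continuous1.
  by move=> z; apply: cvgZr; apply: cvgD; [exact: cPsi|exact: c1].
have Phigen z : Phi (gact gen z) = s (Phi z).
  by rewrite /Phi sZ sD sK -gactM gengen gact1 addrC.
have Phii w : Phi (i w) = \val w.
  rewrite /Phi -gmap_equivariant !Psii genE /= sK.
  by rewrite scalerDr -scalerDl (_ : 1/2 + 1/2 = 1 :> R) ?scale1r//; lra.
pose U := Phi @^-1` W.
have oU : open U by apply: open_comp => // ? _; exact: cPhi.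
have rU (u : set_type U) : Phi (\val u) \in W by exact/mem_set/(set_mem (valP u)).
exists U, (fun u => exist (fun v => v \in W) _ (rU u)); split.
- have -> : interior U = U by apply/interior_id.
  by move=> _ [w _ <-]; rewrite /U /= Phii; exact: set_mem (valP w).
- move=> g z Uz; have [->|->] := Z2E g; first by rewrite gact1.
  by rewrite /U /= Phigen; exact: sW.
- apply: continuous_comp_initial.
  by apply: (comp_continuous (@initial_continuous _ _ _) cPhi).
- move=> g u v; have [->|->] := Z2E g; rewrite ?gact1 ?genE => uv.
    by apply: val_inj; rewrite /= uv.
  by apply: val_inj; rewrite /= uv Phigen.
- by move=> y u uy; apply: val_inj; rewrite /= uy Phii.
Qed.

End TestSpace.

(** * Movability seen on the tower *)

Section MovableTower.
Context (R : realType) (G : finGroupType) (X Y : gspace G) (F : gmap Y Y) (proj : nat ->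
  gmap X Y).
Local Notation homotopic := (@ghomotopic R _ _ _).
Hypothesis proj_iter : forall n m x, iter n F (proj (n + m) x) = proj m x.
Hypothesis factor : forall (K : gspace G) (h : gmap X K), is_GANR R K ->
  exists n (q : gmap Y K), homotopic h (q \og proj n).
Hypothesis equalize : forall (K : gspace G) n (q q' : gmap Y K), is_GANR R K ->
  homotopic (q \og proj n) (q' \og proj n) ->
  exists m, homotopic (q \og gmap_iter F m) (q' \og gmap_iter F m).

(** Transfers movability from an arbitrary associated system to the tower. The map [u] at stage 0
    factors through some [S a], movability supplies [a'], and the projection to [S a'] comes from a
    stage of the tower; this gives [k]. Any later factorization is compared with it on a common term
    of the system. *)
Lemma movable_tower (K : gspace G) (u : gmap Y K) : gmovable R X -> is_GANR R K ->
  exists k, forall (K' : gspace G) (u' : gmap Y K') (w : gmap K' K) N,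
    is_GANR R K' -> homotopic (w \og u') (u \og gmap_iter F N) ->
    exists chi : gmap Y K', homotopic (u \og gmap_iter F k) (w \og chi).
Proof.
move=> [S [aS [p [pcoh pK]] mS]] aK.
have [exK eqK] := pK K aK.
have [a [phi hphi]] := exK (u \og proj 0).
have [a' [l mov]] := mS a.
have [n [q hq]] := factor (p a') (aS a').
pose g := phi \og bond l \og q.
have hg : homotopic (g \og proj n) (u \og gmap_iter F n \og proj n).
  apply: (@ghomotopic_trans _ _ _ _ _ (phi \og bond l \og p a')).
    apply: (@ghomotopic_trans _ _ _ _ _ ((phi \og bond l) \og (q \og proj n))).
      exact: ghomotopic_ext.
    by apply: ghomotopic_compl; exact: ghomotopic_sym.
  apply: (@ghomotopic_trans _ _ _ _ _ (phi \og p a)).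
    apply: (@ghomotopic_trans _ _ _ _ _ (phi \og (bond l \og p a'))).
      exact: ghomotopic_ext.
    by apply: ghomotopic_compl; apply: ghomotopic_sym; exact: pcoh.
  apply: ghomotopic_trans (ghomotopic_sym hphi) _.
  by apply: ghomotopic_ext => x /=; rewrite -[in LHS](proj_iter n 0) addn0.
have [m hm] := equalize aK hg.
(* This [k] depends only on [u]; [K'] and [N] are introduced after it. *)
exists (n + m)%N => K' u' w N aK' hw.
have [exK' _] := pK K' aK'.
have [b [phi' hphi']] := exK' (u' \og proj N).
have [c [ac bc]] := sys_directed a b.
(* Both sides represent [u] after [proj 0] on the limit, because [proj 0] is F^N after [proj N].
   They therefore agree on a later term of the system. *)
have hc : homotopic ((w \og phi' \og bond bc) \og p c) ((phi \og bond ac) \og p c).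
  apply: (@ghomotopic_trans _ _ _ _ _ (phi \og p a)); last first.
    apply: (@ghomotopic_trans _ _ _ _ _ (phi \og (bond ac \og p c)));
      last exact: ghomotopic_ext.
    by apply: ghomotopic_compl; exact: pcoh.
  apply: (@ghomotopic_trans _ _ _ _ _ (u \og proj 0)); last exact: hphi.
  apply: (@ghomotopic_trans _ _ _ _ _ ((w \og phi') \og p b)).
    apply: (@ghomotopic_trans _ _ _ _ _ ((w \og phi') \og (bond bc \og p c))).
      exact: ghomotopic_ext.
    by apply: ghomotopic_compl; apply: ghomotopic_sym; exact: pcoh.
  apply: (@ghomotopic_trans _ _ _ _ _ (w \og (u' \og proj N))).
    apply: (@ghomotopic_trans _ _ _ _ _ (w \og (phi' \og p b))); first exact: ghomotopic_ext.
    by apply: ghomotopic_compl; exact: ghomotopic_sym.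
  apply: (@ghomotopic_trans _ _ _ _ _ ((u \og gmap_iter F N) \og proj N)).
    apply: (@ghomotopic_trans _ _ _ _ _ ((w \og u') \og proj N)); first exact: ghomotopic_ext.
    exact: ghomotopic_compr.
  by apply: ghomotopic_ext => x /=; rewrite -[in RHS](proj_iter N 0) addn0.
have [c' [l1 hc']] := eqK c _ _ hc.
(* Movability maps [S a'] to that later term, from which [phi'] leads to [K']. *)
have [r hr] := mov c' (sys_trans ac l1).
exists ((phi' \og bond bc \og bond l1 \og r \og q) \og gmap_iter F m).
apply: (@ghomotopic_trans _ _ _ _ _ (g \og gmap_iter F m)).
  apply: ghomotopic_sym; apply: ghomotopic_trans hm _.
  by apply: ghomotopic_ext => x; rewrite /= iterD.
apply: (@ghomotopic_trans _ _ _ _ _ ((w \og (phi' \og bond bc \og bond l1 \og r \og q))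
  \og gmap_iter F m)).
  apply: ghomotopic_compr.
  apply: (@ghomotopic_trans _ _ _ _ _ ((phi \og bond l) \og q)); first exact: ghomotopic_ext.
  apply: (@ghomotopic_trans _ _ _ _ _ ((w \og phi' \og bond bc \og bond l1 \og r) \og
    q)); last exact: ghomotopic_ext.
  apply: ghomotopic_compr.
  apply: (@ghomotopic_trans _ _ _ _ _ (phi \og (bond (sys_trans ac l1) \og r))).
    by apply: ghomotopic_compl; exact: ghomotopic_sym.
  apply: (@ghomotopic_trans _ _ _ _ _ ((phi \og (bond ac \og bond l1)) \og r)).
    apply: (@ghomotopic_trans _ _ _ _ _ ((phi \og bond (sys_trans ac l1)) \og r)).
      exact: ghomotopic_ext.
    apply: ghomotopic_compr; apply: ghomotopic_compl; apply: ghomotopic_sym.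
    exact: bond_comp.
  apply: ghomotopic_compr; apply: ghomotopic_sym.
  by apply: ghomotopic_trans hc' _; exact: ghomotopic_ext.
exact: ghomotopic_ext.
Qed.

End MovableTower.

Lemma SP_proj_iter (R : realType) n m x :
  iter n (susp_map (@bouquet_map R)) (SP_proj (n + m) x) = SP_proj m x.
Proof. by elim: n => // n IH; rewrite iterSr addSn SP_projF. Qed.

(** * Neighborhoods of the graphs of the iterates *)

Section BouquetNeighborhoods.
Context (R : realType).
Local Notation B := (bouquet R).
Local Notation f := (@bouquet_map R).
Local Notation SB := (susp R B).
Local Notation Y := (susp_gspace R B).
Local Notation F := (susp_gmap R).
Local Notation E := ((R * R) * (R * R))%type.
Local Notation V := ((E * E) * R)%type.
Local Notation iota := (@bouquet_emb R).

(** The second coordinate records the argument: a map into a neighborhood of the graph carries,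
    besides an approximate value of f^N, an approximate argument that varies continuously. *)
Definition graph_emb (N : nat) (b : B) : E * E := (iota (iter N f b), iota b).

(* Only the fixed points of the involution, where [v.2 = 0], are required to be
   close to the graph. *)
Definition graph_nbhd (N : nat) (d : R) : set V :=
  [set v | (v.2 != 0 \/ exists b, `|v.1 - graph_emb N b| < d) /\ `|v| < 2].

Definition flip (v : V) : V := (v.1, - v.2).

Lemma iter_bouquet_continuous N : continuous (iter N f).
Proof.
elim: N => [x|N IH]; first exact: cvg_id.
exact: (comp_continuous IH (@bouquet_map_continuous R)).
Qed.

Lemma graph_emb_continuous N : continuous (graph_emb N).
Proof.
have c : continuous (fun b : B => iota (iter N f b)).
  apply: (@comp_continuous B B E (iter N f) iota); last exact: bouquet_emb_continuous.
  exact: iter_bouquet_continuous.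
exact: (pair_continuous c (@bouquet_emb_continuous R)).
Qed.

Lemma graph_emb_norm N b : `|graph_emb N b| <= 1.
Proof. by rewrite prod_normE ge_max /= !bouquet_emb_norm. Qed.

Lemma graph_nbhd_open N d : open (graph_nbhd N d).
Proof.
apply: openI; last first.
  apply: (@open_comp V R (fun v => `|v|) [set r | r < 2]) => [v _|]; last exact: open_lt.
  exact: (@norm_continuous _ V).
apply: openU.
  apply: (@open_comp V R snd [set r | r != 0]) => [v _|]; first exact: snd_continuous.
  exact: open_neq.
rewrite [X in open X](_ : _ =
    \bigcup_b (fun v : V => `|v.1 - graph_emb N b|) @^-1` [set r | r < d]); last first.
  by apply/seteqP; split => [v [b ?]|v [b _ ?]]; exists b.
apply: bigcup_open => b _; apply: open_comp => [v _|]; last exact: open_lt.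
apply: (@continuous_comp _ _ _ (fun v : V => v.1 - graph_emb N b) (fun v => `|v|)).
  by apply: cvgB; [exact: fst_continuous|exact: cvg_cst].
exact: (@norm_continuous _ (E * E)%type).
Qed.

Lemma flipK : involutive flip.
Proof. by move=> [v t]; rewrite /flip /= opprK. Qed.

Lemma flip_continuous : continuous flip.
Proof.
apply: pair_continuous; first exact: fst_continuous.
by apply: continuous_oppr; exact: snd_continuous.
Qed.

Lemma flipD v w : flip (v + w) = flip v + flip w.
Proof. by case: v w => [v t] [w r]; rewrite /flip /=; congr (_, _) => /=; rewrite opprD. Qed.

Lemma flipZ (k : R) v : flip (k *: v) = k *: flip v.
Proof. by case: v => [v t]; rewrite /flip /=; congr (_, _) => /=; rewrite -mulrN. Qed.

Lemma graph_nbhd_flip N d v : graph_nbhd N d v -> graph_nbhd N d (flip v).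
Proof.
move=> [H n2]; split; last by move: n2; rewrite !prod_normE /= normrN.
by case: H => [v0|[b bv]]; [left; rewrite /= oppr_eq0|right; exists b].
Qed.

Definition graph_space N d : gspace 'Z_2 :=
  test_space flipK flip_continuous (@graph_nbhd_flip N d).

Lemma graph_space_GANR N d : is_GANR R (graph_space N d).
Proof.
apply: test_space_GANR.
- by do !apply: prod_bounded_extensor => //; exact: real_bounded_extensor.
- exact: flipD.
- exact: flipZ.
- exact: graph_nbhd_open.
- by exists 2 => v [_ /ltW].
Qed.

Lemma graph_susp_subproof N (d : {posnum R}) (y : SB) :
  susp_emb (graph_emb N) y \in graph_nbhd N d%:num.
Proof.
apply/mem_set; split; last first.
  by apply: le_lt_trans (susp_emb_norm y (graph_emb_norm N)) _; rewrite ltr1n.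
have [[b t] ->] := susp_ptP y; rewrite susp_embE /=.
have [->|t0] := eqVneq (\val t) 0; last by left.
by right; exists b; rewrite normr0 subr0 scale1r subrr normr0.
Qed.

Definition graph_susp N (d : {posnum R}) (y : SB) : graph_space N d%:num :=
  exist (fun v => v \in graph_nbhd N d%:num) _ (graph_susp_subproof N d y).

Lemma graph_susp_continuous N d : continuous (@graph_susp N d).
Proof.
by apply: continuous_comp_initial; apply: susp_emb_continuous; exact: graph_emb_continuous.
Qed.

Lemma graph_susp_equivariant N d g (y : Y) : graph_susp N d (gact g y) = gact g
  (graph_susp N d y).
Proof.
rewrite /gact /= /susp_act /invol_act; case: (g == _) => //.
by apply: val_inj; exact: susp_emb_flip.
Qed.

Definition graph_gsusp N d : gmap Y (graph_space N d%:num) :=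
  @GMap 'Z_2 Y (graph_space N d%:num) (graph_susp N d)
    (@graph_susp_continuous N d) (@graph_susp_equivariant N d).

(** The value is doubled because the target is a neighborhood of the graph of f^0, the diagonal. *)
Definition diag (v : V) : V := ((v.1.1, v.1.1), v.2).

Lemma graph_diag_subproof N d e (de : d <= e) (v : set_type (graph_nbhd N d)) :
  diag (\val v) \in graph_nbhd 0 e.
Proof.
have /set_mem [H n2] := valP v; apply/mem_set; split.
  case: H => [v0|[b]]; first by left.
  rewrite !prod_normE gt_max => /andP[vb _]; right; exists (iter N f b).
  by rewrite prod_normE /= maxxx; exact: lt_le_trans vb de.
move: n2; rewrite /diag !prod_normE /= !gt_max => /andP[/andP[n1 n2] n3].
by rewrite n1 n3.
Qed.

Definition graph_diag N d e (de : d <= e) (v : graph_space N d) : graph_space 0 e :=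
  exist (fun v => v \in graph_nbhd 0 e) _ (graph_diag_subproof de v).

Lemma graph_diag_continuous N d e (de : d <= e) : continuous (@graph_diag N d e de).
Proof.
apply: continuous_comp_initial.
have cv : continuous (\val : graph_space N d -> V) by exact: initial_continuous.
have c1 : continuous (fun v : V => v.1.1) := comp_continuous (@fst_continuous _ _)
  (@fst_continuous _ _).
apply: (comp_continuous cv (g := diag)); apply: pair_continuous; last exact: snd_continuous.
exact: pair_continuous.
Qed.

Lemma graph_diag_equivariant N d e (de : d <= e) g (v : graph_space N d) :
  graph_diag de (gact g v) = gact g (graph_diag de v).
Proof.
rewrite /gact /= /invol_act; case: (g == _) => //.
exact: val_inj.
Qed.

Definition graph_gdiag N d e (de : d <= e) : gmap (graph_space N d) (graph_space 0 e) :=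
  @GMap 'Z_2 (graph_space N d) (graph_space 0 e) (@graph_diag N d e de)
    (@graph_diag_continuous N d e de) (@graph_diag_equivariant N d e de).

Lemma susp_gmap_iterE N x (t : cinterval (- 1 : R) 1) :
  iter N F (susp_pt (x, t)) = susp_pt (iter N f x, t).
Proof. by elim: N => // N IH; rewrite !iterS IH [LHS]susp_mapE. Qed.

Lemma graph_diag_susp N (d e : {posnum R}) (de : d%:num <= e%:num) :
  graph_gdiag N de \og graph_gsusp N d =1 graph_gsusp 0 e \og gmap_iter F N.
Proof.
move=> y; apply: val_inj; have [[x t] ->] := susp_ptP y.
by rewrite /= susp_gmap_iterE !susp_embE.
Qed.

End BouquetNeighborhoods.

(** * Restriction to the fixed points *)

Section FixedPoints.
Context (R : realType).
Local Notation B := (bouquet R).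
Local Notation f := (@bouquet_map R).
Local Notation SB := (susp R B).
Local Notation Y := (susp_gspace R B).
Local Notation F := (susp_gmap R).
Local Notation E := ((R * R) * (R * R))%type.
Local Notation iota := (@bouquet_emb R).
Local Notation I01 := (cinterval (0 : R) 1).

Let m11 : -1 <= 1 :> R. Proof. lra. Qed.

Let clamp0 : \val (clamp m11 0) = 0. Proof. by rewrite val_clamp//; lra. Qed.

Definition equator (b : B) : SB := susp_pt (b, clamp m11 0).

Lemma equator_continuous : continuous equator.
Proof.
apply: (@comp_continuous _ _ _ (fun b : B => (b, clamp m11 0)));
  last exact: susp_pt_continuous.
by apply: pair_continuous; [move=> b; exact: cvg_id|exact: continuous_cst].
Qed.

Lemma equator_fixed (g : 'Z_2) (b : B) : gact g (equator b : Y) = equator b.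
Proof.
change (susp_act g (equator b) = equator b); rewrite /susp_act; case: (g == _) => //.
rewrite susp_flipE.
congr (susp_pt (_, _)); apply: val_inj.
by change (- \val (clamp m11 0) = \val (clamp m11 0)); rewrite clamp0 oppr0.
Qed.

Lemma graph_space_fixed N (d : R) (v : graph_space N d) : (forall g, gact g v = v) ->
  exists b, `|(\val v).1 - graph_emb N b| < d.
Proof.
move=> /(_ (1 : 'Z_2)) /(congr1 val) /= vv.
have v0 : (\val v).2 = 0 by have := congr1 snd vv; rewrite /= => ?; lra.
by have [] := set_mem (valP v); rewrite v0 eqxx => -[].
Qed.

(** The equator is fixed, so an equivariant homotopy sends it to fixed points, which are close to
    the graph. [gamma] is the value along the homotopy and [eta] the approximate argument carried by
    [chi]; the last clause keeps closed loops closed. *)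
Lemma fixed_homotopy k N (d e : {posnum R}) (de : d%:num <= e%:num) (chi : gmap Y
  (graph_space N d%:num))
    (l : I01 -> B) :
  ghomotopic R (graph_gsusp 0 e \og gmap_iter F k) (graph_gdiag N de \og chi) ->
  continuous l ->
  exists (gamma : I01 * I01 -> E) (eta : I01 -> E), continuous gamma /\ continuous eta /\
  [/\ forall p, exists b, `|gamma p - iota b| < e%:num,
      forall (s t : I01), \val t = 0 -> gamma (s, t) = iota (iter k f (l s)),
      forall (s t : I01), \val t = 1 -> exists b,
        `|gamma (s, t) - iota (iter N f b)| < d%:num /\ `|eta s - iota b| < d%:num
    & forall (s s' t : I01), l s = l s' -> gamma (s, t) = gamma (s', t) /\ eta s = eta s'].
Proof.
move=> [H [cH eH H0 H1]] cl.
pose V := ((E * E) * R)%type.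
have cv M (r : R) : continuous (\val : graph_space M r -> V) by exact: initial_continuous.
exists (fun p => (\val (H (equator (l p.1), p.2))).1.1), (fun s => (\val (chi (equator (l
  s)))).1.2).
have cel : continuous (fun s => equator (l s)) := comp_continuous cl equator_continuous.
have Hfix b t g : gact g (H (equator b, t)) = H (equator b, t).
  by rewrite -eH equator_fixed.
have cfix b g : gact g (chi (equator b)) = chi (equator b).
  by rewrite -gmap_equivariant equator_fixed.
split; [|split; [|split]].
- have c1 : continuous (fun p : I01 * I01 => (equator (l p.1), p.2)).
    apply: pair_continuous; last exact: snd_continuous.
    exact: (comp_continuous (@fst_continuous I01 I01) cel).
  have c2 := comp_continuous (comp_continuous c1 cH) (@cv 0 e%:num).
  exact: (comp_continuous (comp_continuous c2 (@fst_continuous _ _)) (@fst_continuous _ _)).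
- have c2 := comp_continuous (comp_continuous cel (@gmap_continuous _ _ _ chi)) (@cv N d%:num).
  exact: (comp_continuous (comp_continuous c2 (@fst_continuous _ _)) (@snd_continuous _ _)).
- move=> [s t]; have [b] := graph_space_fixed (Hfix (l s) t).
  by rewrite prod_normE gt_max => /andP[bH _]; exists b.
- move=> s t t0; rewrite H0//.
  have -> : \val ((graph_gsusp 0 e \og gmap_iter F k) (equator (l s))) =
      susp_emb (graph_emb 0) (iter k F (equator (l s))) by [].
  by rewrite susp_gmap_iterE susp_embE clamp0 normr0 subr0 scale1r.
- move=> s t t1; rewrite H1//=; have [b] := graph_space_fixed (cfix (l s)).
  by rewrite prod_normE gt_max => /andP[bH1 bH2]; exists b.
- move=> s s' t ll; split; first exact: (congr1 (fun b => (\val (H (equator b, t))).1.1) ll).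
  exact: (congr1 (fun b => (\val (chi (equator b))).1.2) ll).
Qed.

End FixedPoints.

(** * Holonomy of chains in the bouquet *)

Section Holonomy.
Context (R : realType) (G : unitRingType).
Local Notation B := (bouquet R).
Local Notation f := (@bouquet_map R).
Implicit Types (a b c d : G) (x y : B) (u v : R).

Definition jump a v v' : G :=
  (if v < 0 then a else 1)^-1 * (if v' < 0 then a else 1).

Lemma if_unit (t : bool) a : a \is a GRing.unit -> (if t then a else 1) \is a GRing.unit.
Proof. by case: t => // _; exact: unitr1. Qed.

Lemma jump_unit a v v' : a \is a GRing.unit -> jump a v v' \is a GRing.unit.
Proof.
move=> ua; rewrite /jump; by apply: rpredM; rewrite ?rpredV; exact: if_unit.
Qed.

Lemma jump_same a v v' : a \is a GRing.unit -> (v < 0) = (v' < 0) -> jump a v v' = 1.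
Proof. by move=> ua vv; rewrite /jump vv mulVr//; exact: if_unit. Qed.

Lemma jumpM a v1 v2 v3 : a \is a GRing.unit -> jump a v1 v2 * jump a v2 v3 = jump a v1 v3.
Proof.
by move=> ua; rewrite /jump mulrA -[X in X * _]mulrA divrr ?mulr1//; exact: if_unit.
Qed.

(** Requiring both ends in the left half discards changes of sign of the second coordinate near
    1. *)
Definition arc_step a u v u' v' : G := if (u < 0) && (u' < 0) then jump a v v' else 1.

Lemma arc_step_unit a u v u' v' : a \is a GRing.unit ->
  arc_step a u v u' v' \is a GRing.unit.
Proof. by move=> ua; rewrite /arc_step; case: ifP => _; [exact: jump_unit|exact: unitr1]. Qed.

(** A point with u < 0 within 1/4 of the right half has |v| > 1/4, so a step shorter than 1/4 cannot
    change the sign of v. *)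
Lemma arc_step_same a u v u' v' u'' : a \is a GRing.unit -> u ^+ 2 + v ^+ 2 = 1 ->
  `|u - u''| < 1/4 -> `|v - v'| < 1/4 -> 0 <= u'' -> arc_step a u v u' v' = 1.
Proof.
move=> ua uv; rewrite !ltr_norml => /andP[? ?] /andP[? ?] u''0; rewrite /arc_step.
case: ifP => // /andP[u0 _]; apply: jump_same => //.
have [v0|v0] := ltP v 0; have [v0'|v0'] := ltP v' 0 => //; nra.
Qed.

Lemma arc_stepM a u1 v1 u2 v2 u3 v3 : a \is a GRing.unit ->
  u1 ^+ 2 + v1 ^+ 2 = 1 -> u2 ^+ 2 + v2 ^+ 2 = 1 -> u3 ^+ 2 + v3 ^+ 2 = 1 ->
  `|u1 - u2| < 1/4 -> `|v1 - v2| < 1/4 -> `|u2 - u3| < 1/4 -> `|v2 - v3| < 1/4 ->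
  `|u1 - u3| < 1/4 -> `|v1 - v3| < 1/4 ->
  arc_step a u1 v1 u2 v2 * arc_step a u2 v2 u3 v3 = arc_step a u1 v1 u3 v3.
Proof.
move=> ua e1 e2 e3 n12 m12 n23 m23 n13 m13.
have n11 : `|u1 - u1| < 1/4 by rewrite subrr normr0; lra.
have n22 : `|u2 - u2| < 1/4 by rewrite subrr normr0; lra.
have n21 : `|u2 - u1| < 1/4 by rewrite distrC.
have [u10|u10] := ltP u1 0; last first.
  rewrite (arc_step_same _ ua e1 n11 m12 u10) (arc_step_same _ ua e2 n21 m23 u10).
  by rewrite (arc_step_same _ ua e1 n11 m13 u10) mulr1.
have [u20|u20] := ltP u2 0; last first.
  rewrite (arc_step_same _ ua e1 n12 m12 u20) (arc_step_same _ ua e2 n22 m23 u20).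
  by rewrite (arc_step_same _ ua e1 n12 m13 u20) mulr1.
have [u30|u30] := ltP u3 0; last first.
  rewrite (arc_step_same _ ua e1 n13 m12 u30) (arc_step_same _ ua e2 n23 m23 u30).
  by rewrite (arc_step_same _ ua e1 n13 m13 u30) mulr1.
by rewrite /arc_step u10 u20 u30 /= jumpM.
Qed.

Definition bouquet_near (e : R) x y := [/\ `|xA x - xA y| < e, `|yA x - yA y| < e,
  `|xB x - xB y| < e & `|yB x - yB y| < e].

Lemma bouquet_near_sym (e : R) x y : bouquet_near e x y -> bouquet_near e y x.
Proof. by move=> [? ? ? ?]; split; rewrite distrC. Qed.

Lemma bouquet_near_le (e e' : R) x y : e <= e' -> bouquet_near e x y -> bouquet_near e' x y.
Proof. by move=> ee [? ? ? ?]; split; apply: lt_le_trans ee. Qed.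

(* [a], resp. [b], is picked up by a step that crosses -1 counterclockwise on
   the first, resp. second, circle. *)
Definition transition a b x y : G :=
  arc_step a (xA x) (yA x) (xA y) (yA y) * arc_step b (xB x) (yB x) (xB y) (yB y).

Lemma transition_unit a b x y : a \is a GRing.unit -> b \is a GRing.unit ->
  transition a b x y \is a GRing.unit.
Proof. by move=> ua ub; apply: rpredM; exact: arc_step_unit. Qed.

(** The cocycle identity on small triangles. The middle point is on the left half of at most one
    circle, so the other circle contributes nothing and the factors regroup without commuting [a]
    and [b]. *)
Lemma transitionM a b x y z : a \is a GRing.unit -> b \is a GRing.unit ->
  bouquet_near (1/4) x y -> bouquet_near (1/4) y z -> bouquet_near (1/4) x z ->
  transition a b x y * transition a b y z = transition a b x z.
Proof.
move=> ua ub [n1 n2 n3 n4] [m1 m2 m3 m4] [k1 k2 k3 k4].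
have [x1 x2 xx] := bouquetP x; have [y1 y2 yy] := bouquetP y; have [z1 z2 zz] := bouquetP z.
have A := arc_stepM ua x1 y1 z1 n1 n2 m1 m2 k1 k2.
have B' := arc_stepM ub x2 y2 z2 n3 n4 m3 m4 k3 k4.
rewrite /transition -A -B'.
suff [[e1 e2]|[e1 e2]] : (arc_step b (xB x) (yB x) (xB y) (yB y) = 1 /\ arc_step b (xB y)
  (yB y) (xB z) (yB z) = 1)
    \/ (arc_step a (xA x) (yA x) (xA y) (yA y) = 1 /\ arc_step a (xA y) (yA y) (xA z) (yA
      z) = 1).
- by rewrite e1 e2 !mulr1.
- by rewrite e1 e2 !mul1r.
move: n1 n3 m1 m3; rewrite !ltr_norml => /andP[? ?] /andP[? ?] /andP[? ?] /andP[? ?].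
rewrite /arc_step; have [xAy|xAy] := ltP (xA y) 0.
  left; have : xB y = 1 by case: yy => -[? ?] //; lra.
  by move=> ->; rewrite ltr10 andbF.
by right; rewrite andbF.
Qed.

Definition holonomy a b (p : nat -> B) (n : nat) : G :=
  \prod_(i < n) transition a b (p i) (p i.+1).

Lemma holonomyS a b p n :
  holonomy a b p n.+1 = holonomy a b p n * transition a b (p n) (p n.+1).
Proof. by rewrite /holonomy big_ord_recr. Qed.

Lemma holonomy0 a b p : holonomy a b p 0 = 1.
Proof. by rewrite /holonomy big_ord0. Qed.

(** A discrete homotopy: each square between the rows is split by the diagonal from [p i] to
    [q i.+1] into two triangles. *)
Lemma holonomy_row a b (p q : nat -> B) n :
  a \is a GRing.unit -> b \is a GRing.unit ->
  (forall i, (i < n)%N -> bouquet_near (1/4) (p i) (p i.+1)) ->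
  (forall i, (i < n)%N -> bouquet_near (1/4) (q i) (q i.+1)) ->
  (forall i, (i <= n)%N -> bouquet_near (1/4) (p i) (q i)) ->
  (forall i, (i < n)%N -> bouquet_near (1/4) (p i) (q i.+1)) ->
  holonomy a b p n * transition a b (p n) (q n) =
  transition a b (p 0%N) (q 0%N) * holonomy a b q n.
Proof.
move=> ua ub; elim: n => [|n IH] np nq npq nd.
  by rewrite !holonomy0 mul1r mulr1.
rewrite !holonomyS -mulrA transitionM//; [|exact: np|exact: npq|exact: nd].
rewrite -(@transitionM a b (p n) (q n) (q n.+1))//;
  [|exact: npq (leqnSn _)|exact: nq|exact: nd].
have e : holonomy a b p n * transition a b (p n) (q n) =
    transition a b (p 0%N) (q 0%N) * holonomy a b q n.
  by apply: IH => i i_n; [exact: np (leqW _)|exact: nq (leqW _)|exact: npq (leqW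
    _)|exact: nd (leqW _)].
by rewrite mulrA e mulrA.
Qed.

(** Since the rows are closed, the two vertical sides of each strip coincide, so consecutive rows
    have conjugate holonomies. *)
Lemma holonomy_grid a b (p : nat -> nat -> B) n m :
  a \is a GRing.unit -> b \is a GRing.unit ->
  (forall i j, (i < n)%N -> (j <= m)%N -> bouquet_near (1/4) (p j i) (p j i.+1)) ->
  (forall i j, (i <= n)%N -> (j < m)%N -> bouquet_near (1/4) (p j i) (p j.+1 i)) ->
  (forall i j, (i < n)%N -> (j < m)%N -> bouquet_near (1/4) (p j i) (p j.+1 i.+1)) ->
  (forall j, (j <= m)%N -> p j n = p j 0%N) ->
  exists2 c, c \is a GRing.unit & holonomy a b (p 0%N) n * c = c * holonomy a b (p m) n.
Proof.
move=> ua ub; elim: m => [|m IH] n1 n2 n3 cl.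
  by exists 1; rewrite ?unitr1// mulr1 mul1r.
have [|||| c uc cE] := IH.
- by move=> i j ? jm; apply: n1 => //; exact: leqW.
- by move=> i j ? jm; apply: n2 => //; exact: leqW.
- by move=> i j ? jm; apply: n3 => //; exact: leqW.
- by move=> j jm; apply: cl; exact: leqW.
have := @holonomy_row a b (p m) (p m.+1) n ua ub.
rewrite (cl m)// (cl m.+1)// => row.
exists (c * transition a b (p m 0%N) (p m.+1 0%N)).
  by apply: rpredM => //; exact: transition_unit.
rewrite mulrA cE -[LHS]mulrA -[RHS]mulrA; congr (c * _); apply: row => i i_n.
- exact: n1.
- exact: n1.
- exact: n2.
- exact: n3.
Qed.

(** The holonomy collected from parameter 0 to [p], as the loop passes -1 at p = 1/2 and p = -1/2.
    The strict and weak inequalities match the strict test [v < 0] in [jump]. *)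
Definition half_jump a (p : R) : G := if 1/2 < p then a else if p <= - (1/2) then a^-1 else 1.

Lemma half_jump_unit a p : a \is a GRing.unit -> half_jump a p \is a GRing.unit.
Proof.
move=> ua; rewrite /half_jump; case: ifP => // _; case: ifP => _; last exact: unitr1.
by rewrite unitrV.
Qed.

Lemma loopx_neg (p : R) : loopx p < 0 -> 1/8 < p \/ p < - (1/8).
Proof.
have [p0|p0] := leP 0 p; rewrite /loopx ?(ger0_norm p0) ?(ltr0_norm p0) => h.
  by left; rewrite ltNge; apply/negP => ?; nra.
by right; rewrite ltNge; apply/negP => ?; nra.
Qed.

Lemma loopx_ge0 (p : R) : 0 <= loopx p ->
  [\/ p < - (4/5), - (1/5) < p < 1/5 | 4/5 < p].
Proof.
rewrite /loopx; have [p0|p0] := leP 0 p; rewrite ?(ger0_norm p0) ?(ltr0_norm p0) => h.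
  have [?|?] := ltP p (1/5); first by apply: Or32; apply/andP; split => //; lra.
  by apply: Or33; rewrite ltNge; apply/negP => ?; nra.
have [?|?] := ltP (- (1/5)) p; first by apply: Or32; apply/andP; split => //; lra.
by apply: Or31; rewrite ltNge; apply/negP => ?; nra.
Qed.

Lemma loopy_pos (p : R) : 0 < p -> p < 1 -> (loopy p < 0) = (1/2 < p).
Proof.
move=> p0 p1; rewrite /loopy (gtr0_norm p0) (max_idPr (_ : - p <= 0)); last by lra.
rewrite sqrtr0 subr0 (max_idPl (ltW p0)) pmulr_rlt0.
  by rewrite subr_lt0 ltr_pdivrMr// mulrC.
by rewrite !mulr_gt0// sqrtr_gt0// subr_gt0.
Qed.

Lemma loopy_neg (p : R) : p < 0 -> - 1 < p -> (loopy p < 0) = (- (1/2) < p).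
Proof.
move=> p0 p1; rewrite -[p]opprK loopyN oppr_lt0.
have q0 : 0 < - p by rewrite oppr_gt0.
rewrite /loopy (gtr0_norm q0) (max_idPr (_ : - - p <= 0)); last by rewrite opprK ltW.
rewrite sqrtr0 subr0 (max_idPl (ltW q0)) pmulr_rgt0.
  by rewrite subr_gt0 ltrN2 ltr_pdivlMr// mulrC.
by rewrite !mulr_gt0// sqrtr_gt0// subr_gt0 ltrNl.
Qed.

Lemma loopx_neg_lt1 (p : R) : `|p| <= 1 -> loopx p < 0 -> - 1 < p < 1.
Proof.
move=> p1 lx; rewrite -ltr_norml lt_neqAle p1 andbT; apply: contraTneq lx => e.
by rewrite /loopx e -leNgt; lra.
Qed.

(** Pulled back to the real parameter the cocycle is the coboundary of [half_jump]. If an end is in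
    the right half, [p] is far from 1/2 and -1/2, so neither side registers a crossing. *)
Lemma arc_step_loop a (p p' : R) : a \is a GRing.unit -> `|p| <= 1 -> `|p'| <= 1 ->
  `|p - p'| < 1/10 ->
  arc_step a (loopx p) (loopy p) (loopx p') (loopy p') = (half_jump a p)^-1 * half_jump a p'.
Proof.
move=> ua p1 p1'; rewrite ltr_norml => /andP[d1 d2].
rewrite /arc_step; case: ifP => [/andP[lx lx']|].
  have /andP[? ?] := loopx_neg_lt1 p1 lx; have /andP[? ?] := loopx_neg_lt1 p1' lx'.
  rewrite /jump /half_jump; case: (loopx_neg lx) => h.
    have h' : 0 < p' by lra.
    rewrite !loopy_pos//; last by lra.
    have e1 : (p <= - (1/2)) = false by apply/negbTE; rewrite -ltNge; lra.
    have e2 : (p' <= - (1/2)) = false by apply/negbTE; rewrite -ltNge; lra.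
    by rewrite e1 e2.
  have h' : p' < 0 by lra.
  rewrite !loopy_neg//; last by lra.
  have e1 : (1/2 < p) = false by apply/negbTE; rewrite -leNgt; lra.
  have e2 : (1/2 < p') = false by apply/negbTE; rewrite -leNgt; lra.
  rewrite e1 e2 !(leNgt _ (- (1/2))); case: (_ < p); case: (_ < p') => /=;
    by rewrite ?invrK ?invr1 ?mul1r ?mulr1 ?divrr ?mulVr// mulrV.
move=> /negbT; rewrite negb_and -!leNgt => far.
suff -> : half_jump a p = half_jump a p' by rewrite mulVr// half_jump_unit.
rewrite /half_jump.
have [e1 e2] : (1/2 < p) = (1/2 < p') /\ (p <= - (1/2)) = (p' <= - (1/2)).
  by case/orP: far => /loopx_ge0 [h|/andP[h h']|h]; split; apply/idP/idP => ?; lra.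
by rewrite e1 e2.
Qed.

End Holonomy.

(** * The cocycle pulled back by f *)

Section Gauge.
Context (R : realType) (G : unitRingType).
Local Notation B := (bouquet R).
Local Notation f := (@bouquet_map R).
Implicit Types (a b c d : G) (x y : B).

(** Here the second parameter moves only while the first is held at 1 or -1, so a path from the base
    point has holonomy in the order a-part, b-part. On the lower half the order is reversed; this
    dictates [gauge]. *)
Lemma phi_upper x : upper x -> phi2 x = 0 \/ `|phi1 x| = 1.
Proof.
have [u [v [s [uv -> -> -> sE]]]] := bouquet_branch x => v0.
have s1 : `|s| = 1 by case: sE => -[-> _]; rewrite ?normrN normr1.
case: (quarterP uv) => -[_ v' -> ->]; rewrite ?mulr0 ?mulr1; auto;
  by exfalso; lra.
Qed.

Lemma phi_lower x : ~~ upper x -> phi1 x = 0 \/ `|phi2 x| = 1.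
Proof.
have [u [v [s [uv -> -> -> sE]]]] := bouquet_branch x => v0.
have s1 : `|s| = 1 by case: sE => -[-> _]; rewrite ?normrN normr1.
case: (quarterP uv) => -[_ v' -> ->]; rewrite ?mulr0 ?mulr1; auto;
  by exfalso; lra.
Qed.

Lemma transition_half c d x y : c \is a GRing.unit -> d \is a GRing.unit ->
  upper x = upper y -> transition c d x y = 1.
Proof.
move=> uc ud xy; rewrite /transition.
suff [-> ->] : arc_step c (xA x) (yA x) (xA y) (yA y) = 1 /\ arc_step d (xB x) (yB x) (xB
  y) (yB y) = 1.
  by rewrite mulr1.
rewrite /upper in xy; rewrite /arc_step.
have [u [v [s [_ _ _ _]]]] := bouquet_branch x.
have [u' [v' [s' [_ _ _ _]]]] := bouquet_branch y.
case=> -[_ [e1 e2 e3 e4]] -[] [_ [e1' e2' e3' e4']];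
  rewrite e1 e2 e3 e4 e1' e2' e3' e4' ?lexx ?andbT /= in xy *;
  rewrite ?ltr10 ?andbF /=; split=> //; case: ifP => // _; apply: jump_same => //;
  by rewrite !ltNge xy.
Qed.

Lemma half_jump0 a : half_jump a (0 : R) = 1.
Proof. by rewrite /half_jump !ifF//; apply/negbTE; rewrite -?leNgt -?ltNge; lra. Qed.

Lemma half_jump_small a (p : R) : `|p| < 1/2 -> half_jump a p = 1.
Proof.
rewrite ltr_norml => /andP[? ?].
by rewrite /half_jump !ifF//; apply/negbTE; rewrite -?leNgt -?ltNge; lra.
Qed.

Lemma half_jump_pos a (p : R) : 1/2 < p -> half_jump a p = a.
Proof. by rewrite /half_jump => ->. Qed.

Lemma half_jump_neg a (p : R) : p < - (1/2) -> half_jump a p = a^-1.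
Proof. by rewrite /half_jump => p2; rewrite ifF ?ifT ?ltW//; apply/negbTE;
  rewrite -leNgt; lra. Qed.

Lemma half_jump_near1 a (p p' : R) : `|p - p'| < 1/10 -> `|p| = 1 ->
  half_jump a p = half_jump a p'.
Proof.
rewrite ltr_norml => /andP[? ?]; have [p0|p0] := leP 0 p;
  rewrite ?(ger0_norm p0) ?(ltr0_norm p0) => e.
  by rewrite !half_jump_pos//; lra.
by rewrite !half_jump_neg//; lra.
Qed.

Lemma max_sqr_near (e u v : R) : `|u| <= 1 -> `|v| <= 1 -> `|u - v| < e ->
  `|Num.max u 0 ^+ 2 - Num.max v 0 ^+ 2| < 2 * e.
Proof.
move=> u1 v1 uv.
have k : `|Num.max u 0 - Num.max v 0| <= `|u - v|.
  have [h|h] := leP u 0; have [h'|h'] := leP v 0;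
    rewrite ?subrr ?normr0// ?subr0 ?sub0r ?normrN.
  - by rewrite distrC !ger0_norm; lra.
  - by rewrite !ger0_norm; lra.
have k2 : `|Num.max u 0 + Num.max v 0| <= 2.
  move: u1 v1; rewrite !ler_norml => /andP[? ?] /andP[? ?].
  by have [h|h] := leP u 0; have [h'|h'] := leP v 0; apply/andP; split; lra.
rewrite subr_sqr normrM mulrC; have := normr_ge0 (Num.max u 0 - Num.max v 0).
have := normr_ge0 (Num.max u 0 + Num.max v 0); nra.
Qed.

Lemma coordinate_norm x : [/\ `|xA x| <= 1, `|yA x| <= 1, `|xB x| <= 1 & `|yB x| <= 1].
Proof.
have c (u v : R) : u ^+ 2 + v ^+ 2 = 1 -> `|u| <= 1 /\ `|v| <= 1.
  by move=> uv; rewrite !ler_norml; split; apply/andP; split; nra.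
by have [/c[? ?] /c[? ?] _] := bouquetP x.
Qed.

(** Four squares, each of Lipschitz constant 2 on [-1, 1]. For e = 1/100 the bound stays below the
    1/10 of [arc_step_loop]. *)
Lemma phi_near (e : R) x y : bouquet_near e x y ->
  `|phi1 x - phi1 y| < 8 * e /\ `|phi2 x - phi2 y| < 8 * e.
Proof.
move=> [n1 n2 n3 n4].
have [a1 a2 a3 a4] := coordinate_norm x; have [b1 b2 b3 b4] := coordinate_norm y.
have m (u v : R) : `|u| <= 1 -> `|v| <= 1 -> `|u - v| < e ->
  `|Num.max (- u) 0 ^+ 2 - Num.max (- v) 0 ^+ 2| < 2 * e.
  by move=> u1 v1 uv; apply: max_sqr_near; rewrite ?normrN// -opprD normrN.
have sum4 (t1 t2 t3 t4 r1 r2 r3 r4 : R) : `|t1 - r1| < 2 * e -> `|t2 - r2| < 2 * e ->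
    `|t3 - r3| < 2 * e -> `|t4 - r4| < 2 * e ->
    `|(t1 + t2 - (t3 + t4)) - (r1 + r2 - (r3 + r4))| < 8 * e.
  clear; move=> h1 h2 h3 h4.
  rewrite (_ : _ - _ = (t1 - r1) + (t2 - r2) - ((t3 - r3) + (t4 - r4))); last by ring.
  apply: le_lt_trans (ler_normB _ _) _.
  by have := ler_normD (t1 - r1) (t2 - r2); have := ler_normD (t3 - r3) (t4 - r4); lra.
by split; apply: sum4; (exact: max_sqr_near || exact: m).
Qed.

(* [f] winds the two circles along the commutators [commA] and [commB], so that
   the cocycle of [commA a b], [commB a b] is that of [a], [b] pulled back by
   [f], up to this change of gauge. *)
Definition gauge a b x : G :=
  if upper x then half_jump a (phi1 x) * half_jump b (phi2 x)
  else half_jump b (phi2 x) * half_jump a (phi1 x).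

Lemma gauge_unit a b x : a \is a GRing.unit -> b \is a GRing.unit ->
  gauge a b x \is a GRing.unit.
Proof. by move=> ua ub; rewrite /gauge; case: ifP => _; apply: rpredM;
  exact: half_jump_unit. Qed.

Definition commA a b : G := a * b * a^-1 * b^-1.
Definition commB a b : G := a^-1 * b^-1 * a * b.

Lemma commA_unit a b : a \is a GRing.unit -> b \is a GRing.unit -> commA a b \is a GRing.unit.
Proof. by move=> ua ub; rewrite /commA !rpredM ?rpredV. Qed.

Lemma commB_unit a b : a \is a GRing.unit -> b \is a GRing.unit -> commB a b \is a GRing.unit.
Proof. by move=> ua ub; rewrite /commB !rpredM ?rpredV. Qed.

Lemma quarter_right (u v : R) : u ^+ 2 + v ^+ 2 = 1 -> `|v| < 1/50 -> 0 <= u ->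
  [/\ 9/10 < u, `|quarter1 u v| < 1/2 & `|quarter2 u v| < 1/2].
Proof.
rewrite ltr_norml => uv /andP[v1 v2] u0.
have v22 : `|v ^+ 2| < 1/2 by rewrite ger0_norm ?sqr_ge0//; nra.
have n0 : `|0 : R| < 1/2 by rewrite normr0; lra.
have u1 : 9/10 < u by rewrite ltNge; apply/negP => h; nra.
by case: (quarterP uv) => -[h _ -> ->]; split=> //; exfalso; move: u1 h; clear; lra.
Qed.

Lemma quarter_left (u v : R) : u ^+ 2 + v ^+ 2 = 1 -> `|v| < 1/50 -> u < 0 ->
  [/\ u < - (9/10), 1/2 < quarter1 u v & 1/2 < quarter2 u v].
Proof.
rewrite ltr_norml => uv /andP[v1 v2] u0.
have u1 : u < - (9/10) by rewrite ltNge; apply/negP => h; nra.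
have u2 : 1/2 < u ^+ 2 by nra.
have n1 : (1/2 : R) < 1 by lra.
by case: (quarterP uv) => -[h _ -> ->]; split=> //; exfalso; move: u1 h; clear; lra.
Qed.

(** A short step between the two halves passes -1 on the first circle, -1 on the second, or the
    neighborhood of the wedge point; in the last case the circle may change. *)
Lemma mixed_jumps x y : bouquet_near (1/100) x y -> upper x -> ~~ upper y ->
  [\/ [/\ 1/2 < phi1 x, 1/2 < phi1 y, 1/2 < phi2 x & 1/2 < phi2 y] /\
        [/\ xA x < 0, xA y < 0, 0 <= yA x, yA y < 0 & xB x = 1],
      [/\ phi1 x < - (1/2), phi1 y < - (1/2), phi2 x < - (1/2) & phi2 y < - (1/2)] /\
        [/\ xB x < 0, xB y < 0, 0 <= yB x, yB y < 0 & xA x = 1] |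
      [/\ `|phi1 x| < 1/2, `|phi1 y| < 1/2, `|phi2 x| < 1/2 & `|phi2 y| < 1/2] /\
        [/\ 0 < xA x & 0 < xB x]].
Proof.
have key (p q p' q' : R) : `|p - p'| < 1/100 -> `|q - q'| < 1/100 -> 0 <= q -> q' < 0 ->
  `|q| < 1/50 /\ `|q'| < 1/50 /\ (9/10 < p -> 0 <= p') /\ (p < - (9/10) -> p' < 0).
  by rewrite !ltr_norml => /andP[? ?] /andP[? ?] ? ?; split; [|split; [|split]]; lra.
have near1 (p q : R) : `|1 - p| < 1/100 -> `|0 - q| < 1/100 -> 0 <= p /\ `|q| < 1/50.
  by rewrite !ltr_norml => /andP[? ?] /andP[? ?]; split; lra.
have near1' (p q : R) : `|p - 1| < 1/100 -> `|q - 0| < 1/100 -> 0 <= p /\ `|q| < 1/50.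
  by rewrite !ltr_norml => /andP[? ?] /andP[? ?]; split; lra.
have pos (w : R) : 9/10 < w -> 0 < w by lra.
have o1 : 0 < 1 :> R by [].
have neg (w : R) : 1/2 < w -> - w < - (1/2) by lra.
have [u [v [s [uv pE qE uE sE]]]] := bouquet_branch x.
have [u' [v' [s' [uv' pE' qE' uE' sE']]]] := bouquet_branch y.
rewrite pE qE pE' qE' uE uE' -ltNge.
case=> n1 n2 n3 n4 v0 v0'.
case: sE => -[s1 [e1 e2 e3 e4]]; case: sE' => -[s1' [e1' e2' e3' e4']];
  rewrite s1 s1' e1 e2 e3 e1' e2' e3' e4 e4' ?(mul1r (quarter1 _ _)) ?(mul1r (quarter2 _
    _)) ?mulN1r ?normrN in n1 n2 n3 n4 *.
- have [k1 [k2 [k3 k4]]] := key _ _ _ _ n1 n2 v0 v0'; have [u0|u0] := leP 0 u.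
    have [/[dup] /pos ? /k3 u0' ? ?] := quarter_right uv k1 u0.
    by have [? ? ?] := quarter_right uv' k2 u0'; apply: Or33.
  have [/[dup] ? /k4 u0' ? ?] := quarter_left uv k1 u0.
  by have [? ? ?] := quarter_left uv' k2 u0'; apply: Or31.
- have [u0 k1] := near1' _ _ n1 n2; have [u0' k2] := near1 _ _ n3 n4.
  have [/pos ? ? ?] := quarter_right uv k1 u0; have [? ? ?] := quarter_right uv' k2 u0'.
  by apply: Or33.
- have [u0 k1] := near1' _ _ n3 n4; have [u0' k2] := near1 _ _ n1 n2.
  have [/pos ? ? ?] := quarter_right uv k1 u0; have [? ? ?] := quarter_right uv' k2 u0'.
  by apply: Or33.
- have [k1 [k2 [k3 k4]]] := key _ _ _ _ n3 n4 v0 v0'; have [u0|u0] := leP 0 u.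
    have [/[dup] /pos ? /k3 u0' ? ?] := quarter_right uv k1 u0.
    by have [? ? ?] := quarter_right uv' k2 u0'; apply: Or33.
  have [/[dup] ? /k4 u0' /neg ? /neg ?] := quarter_left uv k1 u0.
  by have [? /neg ? /neg ?] := quarter_left uv' k2 u0'; apply: Or32.
Qed.

Section Commutator.
Variables (a b : G).
Hypotheses (ua : a \is a GRing.unit) (ub : b \is a GRing.unit).
Local Notation c := (commA a b).
Local Notation d := (commB a b).

(** The commutator is what exchanges the two orders of the factors in [gauge] when the step crosses
    -1. *)
Lemma commAE : c * (b * a) = a * b.
Proof. by rewrite /commA -!mulrA mulKr// mulVr// mulr1. Qed.

Lemma commBE : d * (b^-1 * a^-1) = a^-1 * b^-1.
Proof. by rewrite /commB -!mulrA [b * _]mulrA mulrV// mul1r mulrV// mulr1. Qed.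

Lemma mixed_gauge x y : bouquet_near (1/100) x y -> upper x -> ~~ upper y ->
  [/\ half_jump a (phi1 x) = half_jump a (phi1 y), half_jump b (phi2 x) = half_jump b (phi2 y)
    & gauge a b x = transition c d x y * gauge a b y].
Proof.
move=> xy ux uy; rewrite /gauge ux (negbTE uy) /transition /arc_step.
case: (mixed_jumps xy ux uy) => -[[p1 p2 q1 q2]].
- move=> [h1 h2 h3 h4 h5]; rewrite !half_jump_pos// h1 h2 h5 ltr10 /= /jump h4.
  by rewrite ltNge h3 /= invr1 mul1r mulr1 commAE.
- move=> [h1 h2 h3 h4 h5]; rewrite !half_jump_neg// h1 h2 h5 ltr10 /= /jump h4.
  by rewrite ltNge h3 /= invr1 !mul1r commBE.
- move=> [h1 h2]; rewrite !half_jump_small//.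
  by rewrite [xA x < 0]ltNge (ltW h1) [xB x < 0]ltNge (ltW h2) /= !mulr1.
Qed.

Lemma transition_bouquet_map x y : bouquet_near (1/100) x y ->
  transition a b (f x) (f y) = (half_jump a (phi1 x))^-1 * half_jump a (phi1 y) *
    ((half_jump b (phi2 x))^-1 * half_jump b (phi2 y)).
Proof.
move=> /phi_near[n1 n2]; have [px qx] := phi_norm x; have [py qy] := phi_norm y.
have [e1 e2 e3 e4] := bouquet_mapE x; have [e1' e2' e3' e4'] := bouquet_mapE y.
rewrite /transition e1 e2 e3 e4 e1' e2' e3' e4' !arc_step_loop//.
  by apply: lt_trans n2 _; lra.
by apply: lt_trans n1 _; lra.
Qed.

(** Within one half the pulled-back commutator cocycle is trivial, and of the two factors of the
    gauge either the first is constant or the second is 1. Across the halves both factors are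
    constant and only their order changes, by exactly the transition. *)
Lemma gauge_transition x y : bouquet_near (1/100) x y ->
  gauge a b x * transition a b (f x) (f y) = transition c d x y * gauge a b y.
Proof.
move=> xy; rewrite transition_bouquet_map//.
have [n1 n2] := phi_near xy.
have {}n1 : `|phi1 x - phi1 y| < 1/10 by apply: lt_trans n1 _; lra.
have {}n2 : `|phi2 x - phi2 y| < 1/10 by apply: lt_trans n2 _; lra.
have n1' := n1; have n2' := n2; rewrite distrC in n1'; rewrite distrC in n2'.
have J1 (z : B) := half_jump_unit (phi1 z) ua; have J2 (z : B) := half_jump_unit (phi2 z) ub.
have uc := commA_unit ua ub; have ud := commB_unit ua ub.
have inv (z w : B) : bouquet_near (1/100) z w -> transition c d z w * transition c d w z = 1.
  move=> zw; have m : bouquet_near (1/4) z w by apply: bouquet_near_le zw; lra.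
  have zz : bouquet_near (1/4) z z by split; rewrite subrr normr0; lra.
  by rewrite transitionM// ?transition_half//; exact: bouquet_near_sym.
have [ux|ux] := boolP (upper x); have [uy|uy] := boolP (upper y).
- rewrite transition_half ?ux ?uy// mul1r /gauge ux uy.
  have [e|[e1 e2]] : half_jump a (phi1 x) = half_jump a (phi1 y) \/
      (half_jump b (phi2 x) = 1 /\ half_jump b (phi2 y) = 1).
    have [q|/(half_jump_near1 a n1)] := phi_upper ux; last by left.
    have [q'|/(half_jump_near1 a n1')] := phi_upper uy; last by left.
    by right; rewrite q q' half_jump0.
  + by rewrite e mulVr// mul1r -mulrA mulVKr.
  + by rewrite e1 e2 invr1 !mulr1 mulVKr.
- have [e1 e2 e3] := mixed_gauge xy ux uy.
  by rewrite e1 e2 !mulVr// !mulr1.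
- have yx := bouquet_near_sym xy; have [e1 e2 e3] := mixed_gauge yx uy ux.
  by rewrite e1 e2 !mulVr// !mulr1 e3 mulrA inv// mul1r.
- rewrite transition_half ?(negbTE ux) ?(negbTE uy)// mul1r /gauge (negbTE ux) (negbTE uy).
  have [e|[e1 e2]] : half_jump b (phi2 x) = half_jump b (phi2 y) \/
      (half_jump a (phi1 x) = 1 /\ half_jump a (phi1 y) = 1).
    have [q|/(half_jump_near1 b n2)] := phi_lower ux; last by left.
    have [q'|/(half_jump_near1 b n2')] := phi_lower uy; last by left.
    by right; rewrite q q' half_jump0.
  + by rewrite e mulVr// mulr1 -mulrA mulVKr.
  + by rewrite e1 e2 invr1 !mulr1 mul1r mulVKr.
Qed.

Lemma gauge_holonomy (p : nat -> B) n :
  (forall i, (i < n)%N -> bouquet_near (1/100) (p i) (p i.+1)) ->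
  gauge a b (p 0%N) * holonomy a b (f \o p) n = holonomy c d p n * gauge a b (p n).
Proof.
elim: n => [|n IH] np; first by rewrite !holonomy0 mulr1 mul1r.
rewrite !holonomyS mulrA IH; last by move=> i i_n; exact: np (leqW _).
by rewrite -mulrA gauge_transition ?mulrA//; exact: np.
Qed.

End Commutator.

End Gauge.

(** * Iterated commutators of integer matrices *)

Section Congruence.
Context (G : unitRingType).
Implicit Types (a b t M : G).

Definition one_mod (m : nat) M := exists X, M = 1 + X *+ m.

Lemma one_mod_1 m : one_mod m 1.
Proof. by exists 0; rewrite mul0rn addr0. Qed.

Lemma one_mod_mul m M N : one_mod m M -> one_mod m N -> one_mod m (M * N).
Proof.
move=> [X ->] [Y ->]; exists (X + Y + X * Y *+ m).
by rewrite mulrDl mul1r mulrDr mulr1 !mulrnDl mulrnAl mulrnAr !addrA [1 + X *+ m + Y *+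
  m]addrAC.
Qed.

Lemma one_mod_inv m M : one_mod m M -> one_mod m M^-1.
Proof.
have [uM|nM] := boolP (M \is a GRing.unit); last by rewrite invr_out.
move=> [X ME]; exists (- (X * M^-1)); rewrite mulNrn -mulrnAl.
have -> : X *+ m = M - 1 by rewrite ME addrC addKr.
by rewrite mulrBl mulrV// mul1r opprB addrC subrK.
Qed.

Lemma one_mod_conj m t M N : t \is a GRing.unit -> t * M = N * t -> one_mod m N -> one_mod m M.
Proof.
move=> ut tM [X NE]; exists (t^-1 * X * t).
rewrite -[LHS](mulKr ut) tM NE mulrDl mul1r mulrDr mulVr//.
by rewrite mulrnAl mulrnAr mulrA.
Qed.

(** As 1 is central, only the commutator of the two deviations from 1 survives, and each carries a
    factor [m]. *)
Lemma commutator_one_mod m a b : one_mod m a -> one_mod m b ->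
  exists X, a * b - b * a = X *+ (m ^ 2).
Proof.
move=> [X ->] [Y ->]; exists (X * Y - Y * X).
have mm (x y : G) : x * y *+ m ^ 2 = (x *+ m) * (y *+ m).
  by rewrite mulrnAl mulrnAr -mulrnA mulnn.
rewrite mulrnBl !mm; move: (X *+ m) (Y *+ m) => x y.
rewrite !mulrDl !mul1r !mulrDr !mulr1 [1 + x + _]addrACA.
by rewrite opprD [LHS]addrACA subrr add0r opprD [LHS]addrACA subrr add0r.
Qed.

Lemma commA_one_mod m a b : a \is a GRing.unit -> b \is a GRing.unit ->
  one_mod m a -> one_mod m b -> one_mod (m ^ 2) (commA a b).
Proof.
move=> ua ub ca cb; have [X XE] := commutator_one_mod ca cb.
exists (X * a^-1 * b^-1); rewrite -!mulrnAl -XE /commA !mulrBl.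
by rewrite -[b * a / a]mulrA mulrV// mulr1 mulrV// addrC subrK.
Qed.

Lemma commB_one_mod m a b : a \is a GRing.unit -> b \is a GRing.unit ->
  one_mod m a -> one_mod m b -> one_mod (m ^ 2) (commB a b).
Proof.
move=> ua ub ca cb; have [X XE] := commutator_one_mod ca cb.
exists (a^-1 * b^-1 * X); rewrite -mulrnAr -XE /commB mulrBr.
have -> : a^-1 * b^-1 * (b * a) = 1 by rewrite -!mulrA mulKr// mulVr.
by rewrite addrC subrK mulrA.
Qed.

Definition comm_pair (p : G * G) : G * G := (commA p.1 p.2, commB p.1 p.2).

Lemma comm_pair_unit k a b : a \is a GRing.unit -> b \is a GRing.unit ->
  (iter k comm_pair (a, b)).1 \is a GRing.unit /\
  (iter k comm_pair (a, b)).2 \is a GRing.unit.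
Proof.
move=> ua ub; elim: k => [//|k [u1 u2]] /=.
by split; [exact: commA_unit|exact: commB_unit].
Qed.

Lemma comm_pair_one_mod k m a b : a \is a GRing.unit -> b \is a GRing.unit ->
  one_mod m a -> one_mod m b ->
  one_mod (m ^ (2 ^ k)) (iter k comm_pair (a, b)).1 /\
  one_mod (m ^ (2 ^ k)) (iter k comm_pair (a, b)).2.
Proof.
move=> ua ub ca cb; elim: k => [|k [c1 c2]]; first by rewrite expn0 expn1.
have [u1 u2] := comm_pair_unit k ua ub.
rewrite expnSr expnM /=; split; [exact: commA_one_mod|exact: commB_one_mod].
Qed.

Lemma holonomy_one_mod (R : realType) m a b (p : nat -> bouquet R) n :
  one_mod m a -> one_mod m b -> one_mod m (holonomy a b p n).
Proof.
move=> ca cb.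
have ci (t : bool) c : one_mod m c -> one_mod m (if t then c else 1).
  by case: t => // _; exact: one_mod_1.
have cs c (u v u' v' : R) : one_mod m c -> one_mod m (arc_step c u v u' v').
  by move=> cc; apply: (ci); apply: one_mod_mul; [apply: one_mod_inv|]; exact: ci.
elim: n => [|n IH]; first by rewrite holonomy0; exact: one_mod_1.
by rewrite holonomyS; apply: one_mod_mul => //; apply: one_mod_mul; exact: cs.
Qed.

(** The outermost application of f is removed first, replacing a, b by their commutators; the gauges
    multiply to a single conjugating element because the chain is closed. *)
Lemma iter_holonomy (R : realType) k a b (p : nat -> bouquet R) n :
  a \is a GRing.unit -> b \is a GRing.unit -> p n = p 0%N ->
  (forall j i, (j < k)%N -> (i < n)%N ->
    bouquet_near (1/100) (iter j (@bouquet_map R) (p i)) (iter j (@bouquet_map R) (p i.+1))) ->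
  exists2 t : G, t \is a GRing.unit &
    t * holonomy a b (iter k (@bouquet_map R) \o p) n =
    holonomy (iter k comm_pair (a, b)).1 (iter k comm_pair (a, b)).2 p n * t.
Proof.
move=> ua ub pn; elim: k a b ua ub => [|k IH] a b ua ub np.
  by exists 1; rewrite ?unitr1// mul1r mulr1.
have [||j i jk i_n|t ut tE] := IH (commA a b) (commB a b).
- exact: commA_unit.
- exact: commB_unit.
- by apply: np => //; exact: leqW.
have gE := @gauge_holonomy R G a b ua ub (iter k (@bouquet_map R) \o p) n.
have {}gE := gE (fun i i_n => np k i (ltnSn k) i_n).
exists (t * gauge a b (iter k (@bouquet_map R) (p 0%N))).
  by apply: rpredM => //; exact: gauge_unit.
rewrite iterSr -mulrA [X in t * X]gE mulrA tE /= pn mulrA.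
by [].
Qed.

(** The product telescopes to [half_jump a] at the current parameter, which is 1 at 0 and [a] at
    1. *)
Lemma holonomy_loop (R : realType) a b (l : nat -> bouquet R) (s : nat -> R) n :
  a \is a GRing.unit -> s 0%N = 0 -> s n = 1 ->
  (forall i, [/\ xA (l i) = loopx (s i), yA (l i) = loopy (s i), xB (l i) = 1 & yB (l i)
    = 0]) ->
  (forall i, (i <= n)%N -> `|s i| <= 1) ->
  (forall i, (i < n)%N -> `|s i - s i.+1| < 1/10) ->
  holonomy a b l n = a.
Proof.
move=> ua s0 sn lE s1 ss.
suff H j : (j <= n)%N -> holonomy a b l j = half_jump a (s j).
  by rewrite H// sn half_jump_pos//; lra.
elim: j => [|j IH] jn; first by rewrite holonomy0 s0 half_jump0.
rewrite holonomyS IH ?(ltnW jn)//.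
have [e1 e2 e3 e4] := lE j; have [e1' e2' e3' e4'] := lE j.+1.
rewrite /transition e1 e2 e3 e4 e1' e2' e3' e4' [X in _ * (_ * X)]/arc_step ltr10 /= mulr1.
rewrite arc_step_loop//; [|exact: s1 (ltnW jn)|exact: s1|exact: ss].
by rewrite mulrA mulrV ?mul1r//; exact: half_jump_unit.
Qed.

End Congruence.

(** * Ping-pong for iterated commutators *)

Section PingPong.
Implicit Types (v : 'cV[int]_2) (X : set 'cV[int]_2).

(** [X], [X'], [Y], [Y'] receive the images of [v] under words beginning with a, a^-1, b, b^-1: each
    letter may follow anything but its inverse. *)
Definition ping_pong v (X X' Y Y' : set 'cV[int]_2) (a b : 'M[int]_2) := [/\
  ~ X v,
  forall w, (w = v \/ X w) \/ (Y w \/ Y' w) -> X (a *m w),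
  forall w, (w = v \/ X' w) \/ (Y w \/ Y' w) -> X' (a^-1 *m w),
  forall w, (w = v \/ Y w) \/ (X w \/ X' w) -> Y (b *m w) &
  forall w, (w = v \/ Y' w) \/ (X w \/ X' w) -> Y' (b^-1 *m w)].

(* The same four sets serve for the commutators, in another order; this avoids
   any discussion of reduced words. *)
Lemma ping_pong_comm v X X' Y Y' (a b : 'M[int]_2) :
  a \is a GRing.unit -> b \is a GRing.unit ->
  ping_pong v X X' Y Y' a b -> ping_pong v X Y X' Y' (commA a b) (commB a b).
Proof.
move=> ua ub [Xv pa pA pb pB].
have cV : (commA a b)^-1 = b * a * b^-1 * a^-1.
  by rewrite /commA !invrM ?invrK ?rpredM ?rpredV// !mulrA.
have dV : (commB a b)^-1 = b^-1 * a^-1 * b * a.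
  by rewrite /commB !invrM ?invrK ?rpredM ?rpredV// !mulrA.
split=> // w h; rewrite ?cV ?dV /commA /commB -!mulmxA.
- by apply: pa; right; left; apply: pb; right; right; apply: pA; right; right; apply: pB;
  tauto.
- by apply: pb; right; left; apply: pa; right; right; apply: pB; right; right; apply: pA;
  tauto.
- by apply: pA; right; right; apply: pB; right; left; apply: pa; right; left; apply: pb; tauto.
- by apply: pB; right; right; apply: pA; right; left; apply: pb; right; left; apply: pa; tauto.
Qed.

Definition shear1 (c : int) : 'M[int]_2 := 1 + c *: delta_mx 0 1.
Definition shear2 (c : int) : 'M[int]_2 := 1 + c *: delta_mx 1 0.

Lemma shear_mul (i j : 'I_2) (c : int) : i != j ->
  (1 + c *: delta_mx i j : 'M[int]_2) * (1 - c *: delta_mx i j) = 1.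
Proof.
move=> ij; rewrite mulrDl mul1r mulrBr mulr1 -scalerAl -scalerAr.
have -> : delta_mx i j * delta_mx i j = 0 :> 'M[int]_2 by rewrite -[LHS]/(_ *m _)
  mul_delta_mx_0// eq_sym.
by rewrite !scaler0 subr0 subrK.
Qed.

Lemma shear1_inv c : shear1 c \is a GRing.unit /\ (shear1 c)^-1 = shear1 (- c).
Proof.
have h e : shear1 e * shear1 (- e) = 1 by rewrite /shear1 scaleNr shear_mul.
have h' := h (- c); rewrite opprK in h'.
have u : shear1 c \is a GRing.unit by apply/unitrP; exists (shear1 (- c)); rewrite h h'.
by split=> //; apply: (mulrI u); rewrite mulrV// h.
Qed.

Lemma shear2_inv c : shear2 c \is a GRing.unit /\ (shear2 c)^-1 = shear2 (- c).
Proof.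
have h e : shear2 e * shear2 (- e) = 1 by rewrite /shear2 scaleNr shear_mul.
have h' := h (- c); rewrite opprK in h'.
have u : shear2 c \is a GRing.unit by apply/unitrP; exists (shear2 (- c)); rewrite h h'.
by split=> //; apply: (mulrI u); rewrite mulrV// h.
Qed.

Lemma shear1_mul c (w : 'cV[int]_2) :
  (shear1 c *m w) 0 0 = w 0 0 + c * w 1 0 /\ (shear1 c *m w) 1 0 = w 1 0.
Proof.
have e10 : lift ord0 ord0 = 1 :> 'I_2 by apply: val_inj.
rewrite /shear1 mulmxDl mul1mx -scalemxAl !mxE !big_ord_recl !big_ord0 !mxE /= e10.
by rewrite ?mul1r ?mul0r ?addr0 ?add0r ?mulr0 ?addr0.
Qed.

Lemma shear2_mul c (w : 'cV[int]_2) :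
  (shear2 c *m w) 0 0 = w 0 0 /\ (shear2 c *m w) 1 0 = w 1 0 + c * w 0 0.
Proof.
have e10 : lift ord0 ord0 = 1 :> 'I_2 by apply: val_inj.
rewrite /shear2 mulmxDl mul1mx -scalemxAl !mxE !big_ord_recl !big_ord0 !mxE /= e10.
by rewrite ?mul1r ?mul0r ?addr0 ?add0r ?mulr0 ?addr0.
Qed.

(** The sets are pairs of opposite sectors between the axes and the diagonals. Adding 3 or -3 times
    a coordinate to one that is not larger in absolute value makes it strictly larger, with the
    expected sign. The base vector (1, 1) lies on a diagonal, outside all four sets. *)
Lemma ping_pong_shear : exists v X X' Y Y', ping_pong v X X' Y Y' (shear1 3) (shear2 3).
Proof.
exists (const_mx 1),
  (fun w => (0 < w 1 0 /\ w 1 0 < w 0 0) \/ (w 1 0 < 0 /\ w 0 0 < w 1 0)),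
  (fun w => (0 < w 1 0 /\ w 0 0 < - w 1 0) \/ (w 1 0 < 0 /\ - w 1 0 < w 0 0)),
  (fun w => (0 < w 0 0 /\ w 0 0 < w 1 0) \/ (w 0 0 < 0 /\ w 1 0 < w 0 0)),
  (fun w => (0 < w 0 0 /\ w 1 0 < - w 0 0) \/ (w 0 0 < 0 /\ - w 0 0 < w 1 0)).
have [_ i1] := shear1_inv 3; have [_ i2] := shear2_inv 3.
split; first by rewrite !mxE; lia.
all: move=> w; rewrite ?i1 ?i2.
all: have [p1 p2] := shear1_mul 3 w; have [p3 p4] := shear1_mul (-3) w.
all: have [q1 q2] := shear2_mul 3 w; have [q3 q4] := shear2_mul (-3) w.
all: have v0 : w = const_mx 1 -> w 0 0 = 1 /\ w 1 0 = 1 by move=> ->; rewrite !mxE.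
all: rewrite ?p1 ?p2 ?p3 ?p4 ?q1 ?q2 ?q3 ?q4; clear -v0; move: (w 0 0) (w 1 0) v0 => x y v0.
all: case=> -[]; try (move=> /v0[-> ->]); lia.
Qed.

Lemma ping_pong_iter k (a b : 'M[int]_2) : a \is a GRing.unit -> b \is a GRing.unit ->
  (exists v X X' Y Y', ping_pong v X X' Y Y' a b) ->
  exists v X X' Y Y', ping_pong v X X' Y Y' (iter k (@comm_pair _) (a, b)).1
    (iter k (@comm_pair _) (a, b)).2.
Proof.
move=> ua ub pp; elim: k => [//|k [v [X [X' [Y [Y' h]]]]]].
have [u1 u2] := comm_pair_unit k ua ub.
by exists v, X, Y, X', Y'; exact: ping_pong_comm.
Qed.

(** For a nonzero entry z of M - 1 take N = |z|: then |z| < 2^N < 3^(2^N), so z cannot be a multiple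
    of the modulus. *)
Lemma one_mod_neq (M : 'M[int]_2) : M != 1 -> exists N, ~ one_mod (3 ^ (2 ^ N)) M.
Proof.
move=> M1; have [i [j ij]] : exists i j, (M - 1) i j != 0.
  apply: contrapT => /forallNP h; case/negP: M1; rewrite -subr_eq0; apply/eqP/matrixP => i j.
  have /forallNP/(_ j)/negP := h i; rewrite negbK => /eqP ->.
  by rewrite mxE.
exists (absz ((M - 1)%R i j)) => -[X XE].
have e : (M - 1) i j = X i j *+ 3 ^ (2 ^ absz ((M - 1)%R i j)).
  rewrite {1}XE addrC addKr; elim: (3 ^ _)%N => [|n IH]; first by rewrite !mulr0n mxE.
  by rewrite !mulrSr mxE IH.
move: e ij; set z := (M - 1) i j; set x := X i j => e z0.
have x0 : (0 < absz x)%N.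
  by rewrite absz_gt0; apply: contraNneq z0 => x0; rewrite e x0 mul0rn.
have := congr1 absz e; rewrite -mulr_natr abszM natz absz_nat => h.
have h1 := ltn_expl (absz z) (isT : 1 < 2)%N.
have h2 := ltn_expl (2 ^ absz z) (isT : 1 < 3)%N.
by nia.
Qed.

(** The iterated commutator sends the base vector into [X], to which the vector does not belong, so
    it is not the identity. *)
Lemma shear_iter_one_mod k : exists N,
  ~ one_mod (3 ^ (2 ^ N)) (iter k (@comm_pair _) (shear1 3, shear2 3)).1.
Proof.
apply: one_mod_neq; have [u1 _] := shear1_inv 3; have [u2 _] := shear2_inv 3.
have [v [X [X' [Y [Y' [Xv h _ _ _]]]]]] := ping_pong_iter k u1 u2 ping_pong_shear.
apply/eqP => e; have := h v; rewrite e -[1]/(1%:M) mul1mx => /(_ _)/Xv; apply; tauto.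
Qed.

Lemma shear_one_mod : one_mod 3 (shear1 3) /\ one_mod 3 (shear2 3).
Proof.
by split; [exists (delta_mx 0 1)|exists (delta_mx 1 0)]; rewrite -scaler_nat.
Qed.

End PingPong.

(** * Failure of movability *)

Section UniformContinuity.
Context (R : realType).

(** The distance between values of the injective map [h] replaces a metric on [X]: the compact set
    of pairs on which [g] varies by at least [e] has a compact set of [h]-distances that misses
    0. *)
Lemma compact_uniform (X : topologicalType) (V W : normedModType R) (g : X -> V) (h : X
  -> W) (e : R) :
  compact [set: X] -> continuous g -> continuous h -> injective h -> 0 < e ->
  exists2 d : R, 0 < d & forall x y, `|h x - h y| < d -> `|g x - g y| < e.
Proof.
move=> Xc cg ch hI e0.
have dc (U : normedModType R) (k : X -> U) : continuous k ->
    continuous (fun p : X * X => `|k p.1 - k p.2| : R).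
  move=> ck p; apply: (@continuous_comp _ _ _ (fun p : X * X => k p.1 - k p.2) (fun v : U
    => `|v|)).
    apply: continuousB.
      exact: (comp_continuous (@fst_continuous X X) ck).
    exact: (comp_continuous (@snd_continuous X X) ck).
  exact: norm_continuous.
pose K := [set p : X * X | e <= `|g p.1 - g p.2|].
have Kc : compact K.
  apply: (@subclosed_compact _ K setT) => //; last by rewrite -setXTT; exact: compact_setX.
  apply: (@preimage_closed _ _ (fun p : X * X => `|g p.1 - g p.2|) [set r : R | e <= r]).
    by move=> p _; exact: dc.
  exact: closed_ge.
have Ic : closed ((fun p : X * X => `|h p.1 - h p.2|) @` K).
  apply: compact_closed; first exact: Rhausdorff.
  by apply: continuous_compact => //; apply: continuous_subspaceT; exact: dc.
have n0 : nbhs (0 : R) (~` ((fun p : X * X => `|h p.1 - h p.2|) @` K)).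
  apply: open_nbhs_nbhs; split; first exact: closed_openC.
  move=> [[x y] /=] xy /normr0_eq0/subr0_eq/hI exy.
  by move: xy; rewrite /K /= exy subrr normr0 leNgt e0.
have /nbhs_ballP[d /= d0 dP] := n0.
exists d => // x y xy; rewrite ltNge; apply/negP => K1.
apply: (dP `|h x - h y|); last by exists (x, y).
by rewrite /ball /= sub0r normrN normr_id.
Qed.

Lemma compact_uniform_list (X : topologicalType) (V W : normedModType R) (g : nat -> X ->
  V) (h : X -> W)
    (e : R) n : compact [set: X] -> (forall j, continuous (g j)) -> continuous h ->
      injective h -> 0 < e ->
  exists2 d : R, 0 < d & forall j x y, (j < n)%N -> `|h x - h y| < d -> `|g j x - g j y| < e.
Proof.
move=> Xc cg ch hI e0; elim: n => [|n [d d0 dP]]; first by exists 1.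
have [d' d'0 dP'] := compact_uniform Xc (cg n) ch hI e0.
exists (Num.min d d'); first by rewrite lt_min d0.
move=> j x y; rewrite ltnS leq_eqVlt lt_min => /orP[/eqP -> /andP[_]|jn /andP[+ _]];
  [exact: dP'|exact: dP].
Qed.

Local Notation B := (bouquet R).
Local Notation iota := (@bouquet_emb R).
Local Notation I01 := (cinterval (0 : R) 1).

Lemma bouquet_nearP (e : R) (x y : B) : bouquet_near e x y <-> `|iota x - iota y| < e.
Proof.
rewrite !prod_normE !gt_max /=; split=> [[-> -> -> ->]//|].
by move=> /andP[/andP[? ?] /andP[? ?]].
Qed.

Lemma base_loop_subproof (s : I01) : loopx (\val s) ^+ 2 + loopy (\val s) ^+ 2 = 1.
Proof.
have /andP[s0 s1] := cinterval_bounds s.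
by apply: loop_circle; rewrite ger0_norm.
Qed.

Definition base_loop (s : I01) : B :=
  bouquet_mk (base_loop_subproof s) (etrans (congr1 (@GRing.add R _) (expr0n R 2))
    (etrans (addr0 _) (expr1n R 2)))
    (or_intror (conj erefl erefl)).

Lemma base_loopE s : [/\ xA (base_loop s) = loopx (\val s), yA (base_loop s) = loopy (\val s),
  xB (base_loop s) = 1 & yB (base_loop s) = 0].
Proof. by []. Qed.

Lemma base_loop_continuous : continuous base_loop.
Proof.
have cv := @cinterval_val_continuous R 0 1.
apply: continuous_comp_initial; apply: pair_continuous.
  by apply: Complex_continuous; [exact: loopx_continuous|exact: loopy_continuous].
exact: continuous_cst.
Qed.

Lemma base_loop_closed (s s' : I01) : \val s = 0 -> \val s' = 1 -> base_loop s = base_loop s'.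
Proof.
move=> s0 s1; have [x0 y0] := loop0 R; have [x1 y1] := loop1 R.
have [e1 e2 e3 e4] := base_loopE s; have [e1' e2' e3' e4'] := base_loopE s'.
by apply: bouquet_eq; rewrite ?e1 ?e2 ?e3 ?e4 ?e1' ?e2' ?e3' ?e4' ?s0 ?s1 ?x0 ?x1 ?y0 ?y1.
Qed.

End UniformContinuity.

(** * The contradiction *)

Section NotMovable.
Context (R : realType).
Local Notation B := (bouquet R).
Local Notation f := (@bouquet_map R).
Local Notation iota := (@bouquet_emb R).
Local Notation E := ((R * R) * (R * R))%type.
Local Notation I01 := (cinterval (0 : R) 1).

Lemma dist_chain (V : normedZmodType R) (a b u v : V) (e e' e'' : R) :
  `|u - a| < e -> `|u - v| < e' -> `|v - b| < e'' -> `|a - b| < e + e' + e''.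
Proof.
move=> h1 h2 h3; have := ler_distD u a b; have := ler_distD v u b.
rewrite (distrC a u); lra.
Qed.

(** The choices are made in this order: movability gives k, the k-fold commutator gives N, then N
    fixes the tolerance [d] of the graph neighborhood, and the resulting homotopy fixes the mesh 1/n
    of the grid. *)
Lemma SigmaP_not_movable : ~ gmovable R (SigmaP R).
Proof.
move=> mov.
have third (t : R) : t / 3 + t / 3 + t / 3 <= t by lra.
(* Two approximation errors and one motion of the homotopy, 1/20 each, stay within the tolerance 1/4
   of the cocycle identity. *)
have q20 : 1/20 + 1/20 + 1/20 <= 1/4 :> R by lra.
have e0_gt0 : 0 < 1/20 :> R by lra.
pose e0 := PosNum e0_gt0.
have [k kP] := @movable_tower R 'Z_2 (SigmaP R) (susp_gspace R B) (susp_gmap R)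
  (SP_gproj R) (@SP_proj_iter R) (@Z2_factorization R) (@Z2_equalization R)
  _ (graph_gsusp 0 e0) mov (graph_space_GANR 0 e0%:num).
have [N NP] := shear_iter_one_mod k.
have ci j : continuous (fun b : B => iota (iter j f b)).
  apply: (@comp_continuous B B E (iter j f) iota); last exact: bouquet_emb_continuous.
  exact: iter_bouquet_continuous.
have h100 : 0 < 1/100 :> R by lra.
(* Points closer than [d1] keep their images under f^j, j < N, within the 1/100 that [iter_holonomy]
   asks for. *)
have [d1 d1_gt0 d1P] := @compact_uniform_list R B E E (fun j b => iota (iter j f b)) iota
  (1/100) N
  (@bouquet_compact R) ci (@bouquet_emb_continuous R) (@bouquet_emb_inj R) h100.
(* With errors below d1/3, arguments chosen near consecutive values of [eta] are [d1]-close. *)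
have d_gt0 : 0 < Num.min (1/20) (d1 / 3) by rewrite lt_min e0_gt0 divr_gt0.
pose d := PosNum d_gt0.
have de : d%:num <= e0%:num by rewrite /= ge_min lexx.
have [chi hchi] := kP _ (graph_gsusp N d) (graph_gdiag N de) N (graph_space_GANR N _)
  (ghomotopic_ext R (graph_diag_susp N de)).
have [gamma [eta [cg [ce [gB g0 g1 gl]]]]] := fixed_homotopy hchi (@base_loop_continuous R).
have cl j : continuous (fun s : I01 => iota (iter j f (base_loop s))).
  exact: (comp_continuous (@base_loop_continuous R) (ci j)).
have cv := @cinterval_val_continuous R 0 1.
have cI := @cinterval_compact R 0 1 ler01.
have [d2 d2_gt0 d2P] := @compact_uniform_list R I01 E R^o _ _ (1/100) k cI cl cv val_inj h100.
have [d3 d3_gt0 d3P] := @compact_uniform R I01 E R^o eta _ (d1/3) cI ce cv val_inj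
  (divr_gt0 d1_gt0 (ltr0Sn _ 2)).
have cII : compact [set: I01 * I01] by rewrite -setXTT; exact: compact_setX.
have hI : injective (fun p : I01 * I01 => (\val p.1, \val p.2) : R * R).
  by move=> [s t] [s' t'] [/val_inj -> /val_inj ->].
have hc : continuous (fun p : I01 * I01 => (\val p.1, \val p.2) : R * R).
  by apply: pair_continuous; [exact: (comp_continuous (@fst_continuous _ _) cv)|exact:
    (comp_continuous (@snd_continuous _ _) cv)].
have [d4 d4_gt0 d4P] := compact_uniform cII cg hc hI e0_gt0.
(* The mesh must control the images of the base loop ([d2]), [eta] ([d3]), [gamma] ([d4]), and the
   parameter step 1/10 of [holonomy_loop]. *)
pose r := Num.min (Num.min d2 d3) (Num.min d4 (1/10)).
have r_gt0 : 0 < r by rewrite !lt_min d2_gt0 d3_gt0 d4_gt0 divr_gt0.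
pose n := Num.Def.archi_bound r^-1.
have nr : r^-1 < n%:R by apply: archi_boundP; rewrite invr_ge0 ltW.
have n_gt0 : 0 < n%:R :> R by apply: lt_trans nr; rewrite invr_gt0.
have n0 : (0 < n)%N by rewrite -(ltr0n R).
have nVr : n%:R^-1 < r by rewrite invf_plt.
pose S i : I01 := clamp ler01 (i%:R / n%:R).
have SE i : (i <= n)%N -> \val (S i) = i%:R / n%:R.
  move=> i_n; rewrite val_clamp// divr_ge0//= ler_pdivrMr// mul1r ler_nat//.
have S0 : \val (S 0%N) = 0 by rewrite SE// mul0r.
have S1 : \val (S n) = 1 by rewrite SE// divff// gt_eqF.
have step i : (i < n)%N -> `|\val (S i) - \val (S i.+1)| < r.
  move=> i_n; rewrite (SE _ i_n) (SE _ (ltnW i_n)) -mulrBl -natr1 opprD addNKr mulN1r.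
  by rewrite normrN gtr0_norm// invr_gt0.
have lS : base_loop (S n) = base_loop (S 0%N) by apply/esym/base_loop_closed.
have lt_r (t : R) : t < r -> [/\ t < d2, t < d3, t < d4 & t < 1/10].
  by rewrite !lt_min => /andP[/andP[-> ->] /andP[-> ->]].
(* The chosen point of B is a function of the approximated value, so equal values get equal points
   and closed rows stay closed. *)
have pick (T : Type) (P : T -> B -> Prop) : exists G : T -> B, forall v,
    (exists b, P v b) -> P v (G v).
  exists (fun v => xget (base_loop (S 0%N)) [set b | P v b]) => v [b Pb].
  exact: (xgetI (base_loop (S 0%N)) (x := b) (P := [set b | P v b])).
have [G GP] := pick E (fun v b => `|v - iota b| < e0%:num).
have [X XP] := pick (E * E)%type (fun v b =>
  `|v.1 - iota (iter N f b)| < d%:num /\ `|v.2 - iota b| < d%:num).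
pose x i := X (gamma (S i, S n), eta (S i)).
have xP i : `|gamma (S i, S n) - iota (iter N f (x i))| < d%:num /\ `|eta (S i) - iota (x
  i)| < d%:num.
  exact: (XP (_, _) (g1 _ _ S1)).
(* A grid from [f^k] of the base loop to [f^N] of a closed chain. *)
pose p j i := if j == 0%N then iter k f (base_loop (S i))
  else if j == n then iter N f (x i) else G (gamma (S i, S j)).
have pP j i : `|gamma (S i, S j) - iota (p j i)| < 1/20.
  rewrite /p; case: eqP => [->|_]; first by rewrite g0// subrr normr0.
  case: eqP => [->|_]; last exact: GP.
  by apply: lt_le_trans (xP i).1 _.
have stepS i j : (i <= n)%N -> (j <= n)%N -> (j == i) || (j == i.+1) -> `|\val (S i) -
  \val (S j)| < d4.
  move=> i_n jn /orP[/eqP ->|/eqP ji]; first by rewrite subrr normr0.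
  by rewrite ji in jn *; have [] := lt_r _ (step i jn).
have near i j i' j' : (i <= n)%N -> (j <= n)%N -> (i' <= n)%N -> (j' <= n)%N ->
    (i' == i) || (i' == i.+1) -> (j' == j) || (j' == j.+1) -> bouquet_near (1/4) (p j i)
      (p j' i').
  move=> i_n jn i_n' jn' ii jj; apply/bouquet_nearP.
  have gg : `|gamma (S i, S j) - gamma (S i', S j')| < 1/20.
    by apply: d4P; rewrite prod_normE /= gt_max !stepS.
  by apply: lt_le_trans (dist_chain (pP j i) gg (pP j' i')) q20.
have pcl j : p j n = p j 0%N.
  have lS' := gl _ _ _ lS.
  rewrite /p; case: eqP => _; first by rewrite lS.
  case: eqP => _; last by rewrite (lS' _).1.
  by rewrite /x (lS' _).1 (lS' (S n)).2.
pose y i := base_loop (S i).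
have [ua _] := shear1_inv 3; have [ub _] := shear2_inv 3.
have [c uc cE] : exists2 c, c \is a GRing.unit &
    holonomy (shear1 3) (shear2 3) (p 0%N) n * c = c * holonomy (shear1 3) (shear2 3) (p n) n.
  apply: holonomy_grid => //.
  + by move=> i j i_n jn; apply: near; rewrite ?eqxx ?orbT//; exact: ltnW.
  + by move=> i j i_n jn; apply: near; rewrite ?eqxx ?orbT//; exact: ltnW.
  + by move=> i j i_n jn; apply: near; rewrite ?eqxx ?orbT//; exact: ltnW.
have [ga gb] := comm_pair_unit k ua ub.
have l_hol : holonomy (iter k (@comm_pair _) (shear1 3, shear2 3)).1
    (iter k (@comm_pair _) (shear1 3, shear2 3)).2 y n =
    (iter k (@comm_pair _) (shear1 3, shear2 3)).1.
  apply: (@holonomy_loop _ R _ _ _ (fun i => \val (S i))) => //.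
  + by move=> i i_n; have /andP[? ?] := cinterval_bounds (S i); rewrite ger0_norm.
  + by move=> i /step/lt_r[].
have ynear j i : (j < k)%N -> (i < n)%N -> bouquet_near (1/100) (iter j f (y i)) (iter j
  f (y i.+1)).
  by move=> jk /step/lt_r[yd _ _ _]; apply/bouquet_nearP; exact: d2P.
have [t0 ut0 t0E] := iter_holonomy ua ub lS ynear.
rewrite l_hol in t0E.
have xcl : x n = x 0%N.
  by rewrite /x (gl _ _ (S n) lS).1 (gl _ _ (S n) lS).2.
have xnear i : (i < n)%N -> `|iota (x i) - iota (x i.+1)| < d1.
  move=> i_n; have [_ /d3P e3 _ _] := lt_r _ (step i i_n).
  have := (xP i).2; rewrite /= lt_min => /andP[_ h1].
  have := (xP i.+1).2; rewrite /= lt_min => /andP[_ h2].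
  by apply: lt_le_trans (dist_chain h1 e3 h2) (third _).
have fxnear j i : (j < N)%N -> (i < n)%N -> bouquet_near (1/100) (iter j f (x i)) (iter j
  f (x i.+1)).
  by move=> jN i_n; apply/bouquet_nearP; apply: d1P => //; exact: xnear.
have [t1 ut1 t1E] := iter_holonomy ua ub xcl fxnear.
have [sa sb] := shear_one_mod; have [ca cb] := comm_pair_one_mod N ua ub sa sb.
have hN := one_mod_conj ut1 t1E (holonomy_one_mod x n ca cb).
have p0E : p 0%N = iter k f \o y by [].
have pnE : p n = iter N f \o x by rewrite /p; case: (n) n0 => // m _; rewrite eqxx.
(* Congruence to 1 passes along conjugacies, from f^N of the chain [x] to f^k of the base loop, and
   from there to the k-fold commutator. *)
apply: NP; rewrite p0E in cE; rewrite pnE in cE.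
have conjV (t M M' : 'M[int]_2) q : t \is a GRing.unit -> t * M = M' * t -> one_mod q M
  -> one_mod q M'.
  move=> ut tE; apply: (@one_mod_conj _ q t^-1); first by rewrite unitrV.
  by apply: (mulrI ut); rewrite mulVKr// mulrA tE mulrK.
apply: (conjV _ _ _ _ ut0 t0E); apply: (conjV _ _ _ _ uc (esym cE)); exact: hN.
Qed.

End NotMovable.

Theorem proposition1 (R : realType) :
  trivial_shape R (SigmaP R) /\ ~ gmovable R (SigmaP R).
Proof. by split; [exact: SigmaP_trivial_shape|exact: SigmaP_not_movable]. Qed.
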